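(* Let $k$ be a field, let $H$ be a finite-dimensional Hopf algebra over $k$ with bijective antipode, and let $T$ be a left $H$-torsor. Let $m\ge 2$ be an integer. A connected graded right $H$-comodule algebra $A$ is $m$-Koszul if and only if $\widetilde A$ is $m$-Koszul.
   Context: A right (left) $H$-comodule algebra is an algebra object in the monoidal category of right (left) $H$-comodules. A left $H$-torsor is a left $H$-comodule algebra $T$, with structure map $\rho:T\to H\otimes T$ and multiplication $\mu$, such that (1) $T\cong H$ as left $H$-comodules; (2) the ring of coinvariants $\{t\in T: \rho(t)=1\otimes t\}$ equals $k$; (3) the map $(\mathrm{id}\otimes \mu)\circ(\rho\otimes \mathrm{id}):T\otimes T\to H\otimes T$ is bijective. A connected graded $H$-comodule algebra is an $\mathbb{N}$-graded algebra $A$ with $A_0=k$ that is a right $H$-comodule algebra such that every $A_i$ is a subcomodule. With $\rho_A:A\to A\otimes H$ its structure map, $\widetilde A=\{x\in A\otimes T:(\rho_A\otimes\mathrm{id})(x)=(\mathrm{id}\otimes\rho)(x)\}$, a graded subalgebra of $A\otimes T$ ($T$ in degree $0$). A connected graded algebra $A$ is $m$-Koszul if $A\cong TV/(R)$, where $TV$ is the tensor algebra on a vector space $V$ placed in degree $1$, $R\subseteq V^{\otimes m}$, and, for every $i$, the graded vector space $\mathrm{Ext}^i_A(k,k)$ is concentrated in just one degree. *)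

(* Defs.v *)
From HB Require Import structures.
From mathcomp Require Import all_boot all_algebra all_field.
From mathcomp Require Import boolp classical_sets.

Set Implicit Arguments.
Unset Strict Implicit.
Unset Printing Implicit Defensive.

Import GRing.Theory.
Local Open Scope ring_scope.
Local Open Scope quotient_scope.

(* A formal sum of pure tensors is a list of pairs; two formal sums are
   identified when no bilinear map separates them.  This is the quotient of the
   free module on U * V by the bilinearity relations (see [lift_tens] and
   [lift_unique] for the universal property). *)
Section Tensor.
Variables (k : fieldType) (U V : lmodType k).

Definition bilin (W : lmodType k) (f : U -> V -> W) : Prop :=
  (forall v, linear (f^~ v)) /\ (forall u, linear (f u)).

Definition tens_eval (W : lmodType k) (f : U -> V -> W) (s : seq (U * V)) : W :=
  \sum_(p <- s) f p.1 p.2.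

Definition tens_eq (s t : seq (U * V)) : bool :=
  `[< forall (W : lmodType k) (f : U -> V -> W),
        bilin f -> tens_eval f s = tens_eval f t >].

Lemma tens_eq_equiv : equiv_class_of tens_eq.
Proof.
split=> [s|s t|t s r]; first exact/asboolP.
- by apply/asboolP/asboolP => H W f bf; rewrite H.
- by move=> /asboolP H1 /asboolP H2; apply/asboolP => W f bf; rewrite H1 ?H2.
Qed.

Canonical tens_equiv_rel := EquivRelPack tens_eq_equiv.

Definition tens : Type := {eq_quot tens_equiv_rel}.

HB.instance Definition _ := Choice.on tens.
HB.instance Definition _ := EqQuotient.on tens.

Definition tens_pure (u : U) (v : V) : tens := \pi_tens [:: (u, v)].

Definition lift (W : lmodType k) (f : U -> V -> W) (x : tens) : W :=
  tens_eval f (repr x).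

Lemma tens_eqP s t :
  (forall (W : lmodType k) (f : U -> V -> W),
      bilin f -> tens_eval f s = tens_eval f t) <-> \pi_tens s = \pi_tens t.
Proof.
split=> [H|/eqP]; first by apply/eqP; rewrite piE; apply/asboolP.
by rewrite piE => /asboolP.
Qed.

Lemma lift_pi (W : lmodType k) (f : U -> V -> W) s :
  bilin f -> lift f (\pi_tens s) = tens_eval f s.
Proof. by move=> bf; apply: (tens_eqP _ _).2 => //; rewrite reprK. Qed.

Lemma lift_sep (x y : tens) :
  (forall (W : lmodType k) (f : U -> V -> W), bilin f -> lift f x = lift f y) ->
  x = y.
Proof.
move=> H; rewrite -[x]reprK -[y]reprK; apply/tens_eqP => W f bf; exact: H.
Qed.

Definition tens_add (x y : tens) : tens := \pi_tens (repr x ++ repr y).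
Definition tens_scale (c : k) (x : tens) : tens :=
  \pi_tens [seq (c *: p.1, p.2) | p <- repr x].

Lemma lift_add (W : lmodType k) (f : U -> V -> W) x y :
  bilin f -> lift f (tens_add x y) = lift f x + lift f y.
Proof. by move=> bf; rewrite lift_pi // /tens_eval big_cat. Qed.

Lemma lift_scale (W : lmodType k) (f : U -> V -> W) c x :
  bilin f -> lift f (tens_scale c x) = c *: lift f x.
Proof.
move=> bf; rewrite lift_pi // /lift /tens_eval big_map scaler_sumr.
by apply: eq_bigr => p _ /=; exact: (scalable_linear (bf.1 _)).
Qed.

Lemma lift_zero (W : lmodType k) (f : U -> V -> W) : bilin f -> lift f (\pi_tens [::]) = 0.
Proof. by move=> bf; rewrite lift_pi // /tens_eval big_nil. Qed.

Fact tens_addA : associative tens_add.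
Proof. by move=> x y z; apply: lift_sep => W f bf; rewrite !lift_add ?addrA. Qed.
Fact tens_addC : commutative tens_add.
Proof. by move=> x y; apply: lift_sep => W f bf; rewrite !lift_add 1?addrC. Qed.
Fact tens_add0 : left_id (\pi_tens [::]) tens_add.
Proof.
by move=> x; apply: lift_sep => W f bf; rewrite !lift_add ?lift_zero ?add0r.
Qed.
Fact tens_addN : left_inverse (\pi_tens [::]) (tens_scale (-1)) tens_add.
Proof.
move=> x; apply: lift_sep => W f bf.
by rewrite !lift_add ?lift_zero ?lift_scale // scaleN1r addNr.
Qed.

HB.instance Definition _ :=
  GRing.isZmodule.Build tens tens_addA tens_addC tens_add0 tens_addN.

Fact tens_scaleA a b x : tens_scale a (tens_scale b x) = tens_scale (a * b) x.
Proof. by apply: lift_sep => W f bf; rewrite !lift_scale ?scalerA. Qed.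
Fact tens_scale1 : left_id 1 tens_scale.
Proof. by move=> x; apply: lift_sep => W f bf; rewrite !lift_scale ?scale1r. Qed.
Fact tens_scaleDr : right_distributive tens_scale +%R.
Proof.
move=> a x y; apply: lift_sep => W f bf.
by rewrite !(lift_scale, lift_add) ?scalerDr.
Qed.
Fact tens_scaleDl x : {morph tens_scale^~ x : a b / a + b}.
Proof.
move=> a b; apply: lift_sep => W f bf.
by rewrite !(lift_scale, lift_add) ?scalerDl.
Qed.

HB.instance Definition _ :=
  GRing.Zmodule_isLmodule.Build k tens
    tens_scaleA tens_scale1 tens_scaleDr tens_scaleDl.

Lemma lift_linear (W : lmodType k) (f : U -> V -> W) : bilin f -> linear (lift f).
Proof. by move=> bf a x y; rewrite lift_add // lift_scale. Qed.

Lemma lift_tens (W : lmodType k) (f : U -> V -> W) u v :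
  bilin f -> lift f (tens_pure u v) = f u v.
Proof. by move=> bf; rewrite lift_pi // /tens_eval big_seq1. Qed.

Lemma tens_bilin : bilin tens_pure.
Proof.
split=> [v a x y|u a x y]; apply: lift_sep => W f bf;
  rewrite lift_linear // !lift_tens //.
- exact: (bf.1 v).
- exact: (bf.2 u).
Qed.

Lemma tens_sum x : x = \sum_(p <- repr x) tens_pure p.1 p.2.
Proof.
rewrite -[LHS]reprK; elim: (repr x) => [|[u v] s IH]; first by rewrite big_nil.
rewrite big_cons -IH; apply: lift_sep => W f bf /=.
rewrite [RHS]lift_add // lift_tens // !lift_pi //.
by rewrite /tens_eval big_cons.
Qed.

Lemma lift_unique (W : lmodType k) (g h : tens -> W) :
  linear g -> linear h ->
  (forall u v, g (tens_pure u v) = h (tens_pure u v)) -> g =1 h.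
Proof.
move=> lg lh gh x.
pose G : {linear tens -> W} := HB.pack g (GRing.isLinear.Build _ _ _ _ g lg).
pose H : {linear tens -> W} := HB.pack h (GRing.isLinear.Build _ _ _ _ h lh).
rewrite (tens_sum x) -[LHS]/(G _) -[RHS]/(H _) !raddf_sum.
by apply: eq_bigr => p _; exact: gh.
Qed.

End Tensor.

Arguments tens {k} (U V)%_type_scope.

Notation "U ⊗ V" := (tens U V) (at level 40, left associativity) : type_scope.
Notation "u ⊗ v" := (tens_pure u v) (at level 40, left associativity) : ring_scope.

Section TensorMaps.
Variable k : fieldType.

Section Bilin.
Variables (U V W : lmodType k) (f : U -> V -> W).
Hypothesis bf : bilin f.

Lemma bilinDl x y v : f (x + y) v = f x v + f y v.
Proof. by have := bf.1 v 1 x y; rewrite !scale1r. Qed.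
Lemma bilinDr u x y : f u (x + y) = f u x + f u y.
Proof. by have := bf.2 u 1 x y; rewrite !scale1r. Qed.
Lemma bilinZl a u v : f (a *: u) v = a *: f u v.
Proof. exact: (scalable_linear (bf.1 v)). Qed.
Lemma bilinZr a u v : f u (a *: v) = a *: f u v.
Proof. exact: (scalable_linear (bf.2 u)). Qed.

End Bilin.

(* A family of bilinear maps depending linearly on a parameter. *)
Lemma lift_param (U V W X : lmodType k) (f : X -> U -> V -> W) (x : U ⊗ V) :
  (forall u v, linear (fun z => f z u v)) -> linear (fun z => lift (f z) x).
Proof.
move=> lf a y z; rewrite /lift /tens_eval scaler_sumr -big_split /=.
by apply: eq_bigr => p _; rewrite lf.
Qed.

Section Pure.
Variables U V : lmodType k.

Lemma tensDl (x y : U) (v : V) : (x + y) ⊗ v = x ⊗ v + y ⊗ v.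
Proof. exact: (bilinDl (@tens_bilin _ U V)). Qed.
Lemma tensDr (u : U) (x y : V) : u ⊗ (x + y) = u ⊗ x + u ⊗ y.
Proof. exact: (bilinDr (@tens_bilin _ U V)). Qed.
Lemma tensZl a (u : U) (v : V) : (a *: u) ⊗ v = a *: (u ⊗ v).
Proof. exact: (bilinZl (@tens_bilin _ U V)). Qed.
Lemma tensZr a (u : U) (v : V) : u ⊗ (a *: v) = a *: (u ⊗ v).
Proof. exact: (bilinZr (@tens_bilin _ U V)). Qed.

End Pure.

Definition tensE := (tensDl, tensDr, tensZl, tensZr).

Section TMap.
Variables (U V U' V' : lmodType k) (f : {linear U -> U'}) (g : {linear V -> V'}).

Lemma tmap_bilin : bilin (fun (u : U) (v : V) => f u ⊗ g v).
Proof. by split=> [v|u] a x y; rewrite linearP !tensE. Qed.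

Definition tmap : U ⊗ V -> U' ⊗ V' := lift (fun u v => f u ⊗ g v).

HB.instance Definition _ := GRing.isLinear.Build k (U ⊗ V)%type (U' ⊗ V')%type *:%R tmap
  (lift_linear tmap_bilin).

Lemma tmapE u v : tmap (u ⊗ v) = f u ⊗ g v.
Proof. exact: (lift_tens _ _ tmap_bilin). Qed.

End TMap.

Section TAssoc.
Variables U V W : lmodType k.

Lemma tassoc_bilin1 (w : W) : bilin (fun (u : U) (v : V) => u ⊗ (v ⊗ w)).
Proof. by split=> [v|u] a x y; rewrite !tensE. Qed.

Lemma tassoc_bilin :
  bilin (fun (x : U ⊗ V) (w : W) => lift (fun u v => u ⊗ (v ⊗ w)) x).
Proof.
split=> [w|x]; first exact: (lift_linear (tassoc_bilin1 w)).
by apply: lift_param => u v a y z; rewrite !tensE.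
Qed.

Definition tassoc : U ⊗ V ⊗ W -> U ⊗ (V ⊗ W) :=
  lift (fun x w => lift (fun u v => u ⊗ (v ⊗ w)) x).

HB.instance Definition _ := GRing.isLinear.Build k (U ⊗ V ⊗ W)%type (U ⊗ (V ⊗ W))%type *:%R
  tassoc (lift_linear tassoc_bilin).

Lemma tassocE u v w : tassoc (u ⊗ v ⊗ w) = u ⊗ (v ⊗ w).
Proof.
by rewrite /tassoc lift_tens ?lift_tens //;
  [exact: tassoc_bilin1 | exact: tassoc_bilin].
Qed.

End TAssoc.

Section TUnit.
Variable V : lmodType k.

Lemma tunitl_bilin : bilin (fun (c : k^o) (v : V) => (c : k) *: v).
Proof.
split=> [v|c] a x y; first by rewrite scalerDl scalerA.
by rewrite scalerDr !scalerA mulrC.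
Qed.

Lemma tunitr_bilin : bilin (fun (v : V) (c : k^o) => (c : k) *: v).
Proof.
split=> [c|v] a x y; last by rewrite scalerDl scalerA.
by rewrite scalerDr !scalerA mulrC.
Qed.

Definition tunitl : k^o ⊗ V -> V := lift (fun (c : k^o) (v : V) => (c : k) *: v).
Definition tunitr : V ⊗ k^o -> V := lift (fun (v : V) (c : k^o) => (c : k) *: v).

HB.instance Definition _ := GRing.isLinear.Build k (k^o ⊗ V)%type V *:%R
  tunitl (lift_linear tunitl_bilin).
HB.instance Definition _ := GRing.isLinear.Build k (V ⊗ k^o)%type V *:%R
  tunitr (lift_linear tunitr_bilin).

End TUnit.

Lemma linear_form_ex (V : lmodType k) (e : V) :
  e != 0 -> exists f : V -> k^o, linear f /\ f e = 1.
Proof.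
move=> e0.
pose sub (P : set V) := forall (a : k) x y, P x -> P y -> P (a *: x + y).
have [P [[sP Pe] Pmax]] : exists A : set V, (sub A /\ ~ A e) /\
    forall B : set V, (A `<` B)%classic -> ~ (sub B /\ ~ B e).
  apply: (@Zorn_bigcup V (fun P => sub P /\ ~ P e)) => F FP Ftot; split; last first.
    by case=> X FX Xe; have [_] := FP _ FX; exact.
  move=> a x y [X FX Xx] [Y FY Yy].
  have [XY|YX] := Ftot _ _ FX FY.
    by exists Y => //; apply: (FP _ FY).1 => //; exact: XY.
  by exists X => //; apply: (FP _ FX).1 => //; exact: YX.
have P0 : P 0.
  apply: contrapT => nP0; apply: (Pmax (fun x => x = 0 \/ P x)).
    split=> [x Px|/(_ 0)]; first by right.
    by move=> h; apply: nP0; apply: h; left.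
  split=> [a x y|].
    have noP z : P z -> False by move=> Pz; apply: nP0; have := sP (-1) _ _ Pz Pz;
      rewrite scaleN1r addNr.
    move=> [->|/noP//] [->|/noP//]; left; by rewrite scaler0 addr0.
  by case=> [/eqP|//]; rewrite (negPf e0).
have ex x : exists c : k, P (x - c *: e).
  have [Px|nPx] := pselect (P x); first by exists 0; rewrite scale0r subr0.
  have [a Pa] : exists a : k, P (e - a *: x).
    apply: contrapT => na; apply: (Pmax (fun y => exists a : k, P (y - a *: x))).
      split=> [y Py|/(_ x)]; first by exists 0; rewrite scale0r subr0.
      by move=> h; apply: nPx; apply: h; exists 1; rewrite scale1r subrr.
    split=> // b y z [c Pc] [d Pd]; exists (b * c + d).
    have := sP b _ _ Pc Pd.
    by rewrite scalerBr scalerA scalerDl opprD addrACA.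
  have a0 : a != 0.
    by apply/eqP => a0; apply: Pe; move: Pa; rewrite a0 scale0r subr0.
  exists a^-1; have := sP (- a^-1) _ _ Pa P0.
  by rewrite addr0 scalerBr scalerA mulNr mulVf // !scaleNr scale1r opprK addrC.
have uniq_c x (c d : k) : P (x - c *: e) -> P (x - d *: e) -> c = d.
  move=> Pc Pd; apply: contrapT => /eqP cd; apply: Pe.
  have := sP (-1) _ _ Pc Pd.
  have -> : -1 *: (x - c *: e) + (x - d *: e) = (c - d) *: e.
    by rewrite scaleN1r opprB addrA subrK scalerBl.
  move=> /(sP (c - d)^-1) /(_ P0).
  by rewrite addr0 scalerA mulVf ?subr_eq0 // scale1r.
pose f x : k^o := projT1 (cid (ex x)).
have fP x : P (x - f x *: e) by rewrite /f; case: cid.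
exists f; split=> [a x y|]; last first.
  by apply: (uniq_c e); [exact: fP | rewrite scale1r subrr].
apply: (uniq_c (a *: x + y)); first exact: fP.
have := sP a _ _ (fP x) (fP y).
by rewrite scalerBr scalerA addrACA -opprD -scalerDl.
Qed.

End TensorMaps.
Section TensorAlgebra.
Variables (k : fieldType) (A B : algType k).

Lemma tens_ind (U V : lmodType k) (P : U ⊗ V -> Prop) :
  P 0 -> (forall u v x, P x -> P (u ⊗ v + x)) -> forall x, P x.
Proof.
move=> P0 PD x; rewrite (tens_sum x).
by elim: (repr x) => [|p s IH]; rewrite ?big_nil // big_cons; apply: PD.
Qed.

Definition tmul (x y : A ⊗ B) : A ⊗ B :=
  lift (fun a b => lift (fun a' b' => (a * a') ⊗ (b * b')) y) x.

Lemma tmul_bilin1 (a : A) (b : B) :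
  bilin (fun (a' : A) (b' : B) => (a * a') ⊗ (b * b')).
Proof.
by split=> [b'|a'] c x y; rewrite mulrDr -scalerAr !tensE.
Qed.

Lemma tmul_bilin2 (y : A ⊗ B) :
  bilin (fun (a : A) (b : B) => lift (fun a' b' => (a * a') ⊗ (b * b')) y).
Proof.
by split=> [b|a]; apply: lift_param => a' b' c x z;
  rewrite mulrDl -scalerAl !tensE.
Qed.

Lemma tmul_bilin : bilin tmul.
Proof.
split=> [y|x]; first exact: (lift_linear (tmul_bilin2 y)).
apply: lift_param => a b; exact: (lift_linear (tmul_bilin1 a b)).
Qed.

Lemma tmulE a b a' b' : tmul (a ⊗ b) (a' ⊗ b') = (a * a') ⊗ (b * b').
Proof.
rewrite /tmul lift_tens; last exact: tmul_bilin2.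
by rewrite lift_tens //; exact: tmul_bilin1.
Qed.

Let tmulDl := bilinDl tmul_bilin.
Let tmulDr := bilinDr tmul_bilin.
Let tmulZl := bilinZl tmul_bilin.
Let tmulZr := bilinZr tmul_bilin.

Fact tmul0l y : tmul 0 y = 0.
Proof. by rewrite -[X in tmul X](scale0r 0) tmulZl scale0r. Qed.
Fact tmul0r x : tmul x 0 = 0.
Proof. by rewrite -[X in tmul x X](scale0r 0) tmulZr scale0r. Qed.

Fact tmulA : associative tmul.
Proof.
elim/tens_ind => [y z|a b x IH y z]; first by rewrite !tmul0l.
rewrite !tmulDl IH; congr (_ + _).
elim/tens_ind: y z => [|a' b' y IHy] z; first by rewrite tmul0l tmul0r tmul0l.
rewrite !(tmulDl, tmulDr) IHy; congr (_ + _).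
elim/tens_ind: z => [|a'' b'' z IHz]; first by rewrite !tmul0r.
by rewrite !tmulDr IHz !tmulE !mulrA.
Qed.

Fact tmul1l : left_id (1 ⊗ 1) tmul.
Proof.
elim/tens_ind => [|a b x IH]; first by rewrite tmul0r.
by rewrite tmulDr IH tmulE !mul1r.
Qed.

Fact tmul1r : right_id (1 ⊗ 1) tmul.
Proof.
elim/tens_ind => [|a b x IH]; first by rewrite tmul0l.
by rewrite tmulDl IH tmulE !mulr1.
Qed.

Fact tmul_Dl : left_distributive tmul +%R.
Proof. by move=> x y z; rewrite tmulDl. Qed.
Fact tmul_Dr : right_distributive tmul +%R.
Proof. by move=> x y z; rewrite tmulDr. Qed.

Fact tens1_neq0 : (1 : A) ⊗ (1 : B) != 0.
Proof.
have [f [lf f1]] := linear_form_ex (oner_neq0 A).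
have [g [lg g1]] := linear_form_ex (oner_neq0 B).
have bh : bilin (fun (a : A) (b : B) => f a * g b : k^o).
  split=> [b|a] c x y; first by rewrite lf mulrDl -scalerAl.
  by rewrite lg mulrDr -scalerAr.
apply/eqP => /(congr1 (lift (fun (a : A) (b : B) => f a * g b : k^o))).
rewrite lift_tens // f1 g1 mulr1 => /eqP.
by rewrite lift_zero // oner_eq0.
Qed.

HB.instance Definition _ := GRing.Zmodule_isNzRing.Build (A ⊗ B)%type
  tmulA tmul1l tmul1r tmul_Dl tmul_Dr tens1_neq0.

Fact tmul_scaleAl (c : k) (x y : A ⊗ B) : c *: (x * y) = (c *: x) * y.
Proof. by rewrite [RHS]tmulZl. Qed.
Fact tmul_scaleAr (c : k) (x y : A ⊗ B) : c *: (x * y) = x * (c *: y).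
Proof. by rewrite [RHS]tmulZr. Qed.

HB.instance Definition _ :=
  GRing.Lmodule_isLalgebra.Build k (A ⊗ B)%type tmul_scaleAl.
HB.instance Definition _ :=
  GRing.Lalgebra_isAlgebra.Build k (A ⊗ B)%type tmul_scaleAr.

Lemma tens_mulE (a a' : A) (b b' : B) : (a ⊗ b) * (a' ⊗ b') = (a * a') ⊗ (b * b').
Proof. exact: tmulE. Qed.

Lemma tens_oneE : 1 = 1 ⊗ 1 :> A ⊗ B.
Proof. by []. Qed.

End TensorAlgebra.

Section TensorAlgebraMaps.
Variable k : fieldType.

Section TMap.
Variables (A B A' B' : algType k).
Variables (f : {lrmorphism A -> A'}) (g : {lrmorphism B -> B'}).

Fact tmap_monoid : monoid_morphism (tmap f g).
Proof.
split=> [|x y]; first by rewrite [LHS]tmapE !rmorph1.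
elim/tens_ind: x => [|a b x IH]; first by rewrite mul0r linear0 mul0r.
rewrite mulrDl !linearD /= IH mulrDl; congr (_ + _) => {IH}.
elim/tens_ind: y => [|a' b' y IHy]; first by rewrite mulr0 linear0 ?mulr0.
rewrite mulrDr !linearD /= IHy mulrDr; congr (_ + _).
by rewrite tens_mulE !tmapE tens_mulE !rmorphM.
Qed.

HB.instance Definition _ :=
  GRing.isMonoidMorphism.Build (A ⊗ B)%type (A' ⊗ B')%type (tmap f g) tmap_monoid.

End TMap.

Section TAssoc.
Variables A B C : algType k.

Fact tassoc_monoid : monoid_morphism (@tassoc k A B C).
Proof.
split=> [|x y]; first by rewrite [LHS]tassocE.
elim/tens_ind: x => [|u c x IH]; first by rewrite mul0r linear0 mul0r.
rewrite mulrDl !linearD /= IH mulrDl; congr (_ + _) => {IH}.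
elim/tens_ind: y => [|u' c' y IHy]; first by rewrite mulr0 linear0 ?mulr0.
rewrite mulrDr !linearD /= IHy mulrDr; congr (_ + _) => {IHy}.
rewrite tens_mulE.
elim/tens_ind: u => [|a b u IH].
  by rewrite mul0r -(scale0r 0) !tensE !scale0r !linear0 mul0r.
rewrite mulrDl !tensDl !linearD /= IH mulrDl; congr (_ + _) => {IH}.
elim/tens_ind: u' => [|a' b' u' IHu].
  by rewrite mulr0 -(scale0r 0) !tensE !scale0r !linear0 ?mulr0.
rewrite mulrDr !tensDl !linearD /= IHu mulrDr; congr (_ + _).
by rewrite !tens_mulE !tassocE !tens_mulE.
Qed.

HB.instance Definition _ := GRing.isMonoidMorphism.Build
  (A ⊗ B ⊗ C)%type (A ⊗ (B ⊗ C))%type (@tassoc k A B C) tassoc_monoid.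

End TAssoc.
End TensorAlgebraMaps.

Section Hopf.
Variable k : fieldType.

Lemma mul_bilin (A : algType k) : bilin (fun x y : A => x * y).
Proof.
split=> [y|x] c u v; first by rewrite mulrDl scalerAl.
by rewrite mulrDr scalerAr.
Qed.

Definition mulmap (A : algType k) : A ⊗ A -> A := lift (fun x y : A => x * y).

HB.instance Definition _ (A : algType k) :=
  GRing.isLinear.Build k (A ⊗ A)%type A *:%R (@mulmap A)
    (lift_linear (@mul_bilin A)).

Record hopf_algebra (H : algType k) := HopfAlgebra {
  coproduct : {lrmorphism H -> H ⊗ H};
  counit : {lrmorphism H -> k^o};
  antipode : {linear H -> H};
  coproductA : forall h,
    tassoc (tmap coproduct idfun (coproduct h))
      = tmap idfun coproduct (coproduct h);
  counitl : forall h, tunitl (tmap counit idfun (coproduct h)) = h;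
  counitr : forall h, tunitr (tmap idfun counit (coproduct h)) = h;
  antipodel : forall h,
    mulmap (tmap antipode idfun (coproduct h)) = (counit h)%:A;
  antipoder : forall h,
    mulmap (tmap idfun antipode (coproduct h)) = (counit h)%:A
}.

Section Comodules.
Variables (H : algType k) (hH : hopf_algebra H).

(* An algebra in the category of comodules: the multiplication and the unit are
   comodule maps exactly when the coaction is an algebra map, whence the type of
   [rho]. *)
Definition right_comodule_algebra (A : algType k)
    (rho : {lrmorphism A -> A ⊗ H}) : Prop :=
  (forall a, tassoc (tmap rho idfun (rho a))
               = tmap idfun (coproduct hH) (rho a)) /\
  (forall a, tunitr (tmap idfun (counit hH) (rho a)) = a).

Definition left_comodule_algebra (T : algType k)
    (rho : {lrmorphism T -> H ⊗ T}) : Prop :=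
  (forall t, tassoc (tmap (coproduct hH) idfun (rho t))
               = tmap idfun rho (rho t)) /\
  (forall t, tunitl (tmap (counit hH) idfun (rho t)) = t).

Record left_torsor (T : algType k) (rho : {lrmorphism T -> H ⊗ T}) : Prop :=
  LeftTorsor {
  torsor_comodule_algebra : left_comodule_algebra rho;
  torsor_iso : exists phi : {linear T -> H}, bijective phi /\
    forall t, coproduct hH (phi t) = tmap idfun phi (rho t);
  torsor_coinvariants : forall t, rho t = 1 ⊗ t <-> exists c : k, t = c%:A;
  torsor_galois :
    bijective (fun x : T ⊗ T =>
      tmap idfun (@mulmap T) (tassoc (tmap rho idfun x)) : H ⊗ T)
}.

End Comodules.

Section Twist.
(* The subalgebra of A ⊗ T equalizing the two coactions. *)
Variables (H A T : algType k).
Variables (rhoA : {lrmorphism A -> A ⊗ H}) (rhoT : {lrmorphism T -> H ⊗ T}).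

Definition twist_pred : {pred A ⊗ T} :=
  [pred x | tassoc (tmap rhoA idfun x) == tmap idfun rhoT x].

Fact twist_closed : GRing.subsemialg_closed twist_pred.
Proof.
split; first by rewrite inE !rmorph1.
- split=> [|x y]; first by rewrite inE !linear0.
  by rewrite !inE => /eqP hx /eqP hy; rewrite !linearD /= hx hy.
- by move=> c x; rewrite !inE => /eqP hx; rewrite !linearZ_LR /= hx.
- by move=> x y; rewrite !inE => /eqP hx /eqP hy; rewrite !rmorphM /= hx hy.
Qed.

Record twist := Twist { twist_val : A ⊗ T; _ : twist_val \in twist_pred }.

HB.instance Definition _ := [isSub of twist for twist_val].
HB.instance Definition _ := [Choice of twist by <:].
HB.instance Definition _ :=
  GRing.SubChoice_isSubAlgebra.Build k (A ⊗ T)%type _ twist twist_closed.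

End Twist.

End Hopf.
Section Grading.
Variables (I : eqType) (M : zmodType) (G : I -> M -> Prop).

(* M is the direct sum of the subgroups G i. *)
Record grading : Prop := Grading {
  grading0 : forall i, G i 0;
  gradingB : forall i x y, G i x -> G i y -> G i (x - y);
  grading_sum : forall x, exists (s : seq I) (c : I -> M),
    [/\ uniq s, forall i, G i (c i) & x = \sum_(i <- s) c i];
  grading_direct : forall (s : seq I) (c : I -> M),
    uniq s -> (forall i, G i (c i)) -> \sum_(i <- s) c i = 0 ->
    forall i, i \in s -> c i = 0
}.

Lemma gradingD : grading -> forall i x y, G i x -> G i y -> G i (x + y).
Proof.
move=> h i x y hx hy; rewrite -[y]opprK; apply: gradingB => //.
by rewrite -sub0r; apply: gradingB => //; exact: grading0.
Qed.

End Grading.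

Section GradedAlgebra.
Variables (k : fieldType) (A : algType k) (gr : nat -> A -> Prop).

(* The components are subspaces because gr 0 consists of the scalars. *)
Record connected_graded : Prop := ConnectedGraded {
  cgr_grading : grading gr;
  cgr_mul : forall i j a b, gr i a -> gr j b -> gr (i + j)%N (a * b);
  cgr_0 : forall a, gr 0%N a <-> exists c : k, a = c%:A
}.

(* k, on which A acts through the augmentation A -> A_0 = k. *)
Definition residue (h : connected_graded) : Type := k^o.

Section Augmentation.
Hypothesis h : connected_graded.

Let grZ n c a : gr n a -> gr n (c *: a).
Proof.
move=> ha; rewrite -[a]mul1r scalerAl -[n]add0n.
by apply: cgr_mul => //; apply/cgr_0 => //; exists c.
Qed.

Let gr0 n : gr n 0. Proof. exact: grading0 (cgr_grading h) n. Qed.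
Let grD n a b : gr n a -> gr n b -> gr n (a + b).
Proof. exact: gradingD (cgr_grading h) n a b. Qed.

Definition irrelevant (a : A) : Prop :=
  exists (n : nat) (c : nat -> A),
    [/\ forall i, gr i (c i), c 0%N = 0, forall i, (n <= i)%N -> c i = 0 &
        a = \sum_(i < n) c i].

Let pad n m (c : nat -> A) : (n <= m)%N ->
  (forall i, (n <= i)%N -> c i = 0) -> \sum_(i < n) c i = \sum_(i < m) c i.
Proof.
move=> nm c0; rewrite -(subnKC nm) big_split_ord /= [X in _ + X]big1 ?addr0 //.
by move=> i _; rewrite c0 // leq_addr.
Qed.

Lemma irrelevantD a b : irrelevant a -> irrelevant b -> irrelevant (a + b).
Proof.
move=> [n [c [cg c0 cn ->]]] [m [d [dg d0 dm ->]]].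
exists (maxn n m), (fun i => c i + d i); split.
- by move=> i; exact: grD.
- by rewrite c0 d0 addr0.
- by move=> i; rewrite geq_max => /andP[ni mi]; rewrite cn // dm // addr0.
by rewrite big_split /= -(pad (leq_maxl n m)) // -(pad (leq_maxr n m)).
Qed.

Lemma irrelevantZ x a : irrelevant a -> irrelevant (x *: a).
Proof.
move=> [n [c [cg c0 cn ->]]]; exists n, (fun i => x *: c i); split.
- by move=> i; exact: grZ.
- by rewrite c0 scaler0.
- by move=> i /cn ->; rewrite scaler0.
by rewrite scaler_sumr.
Qed.

Lemma irrelevant0 : irrelevant 0.
Proof. by exists 0%N, (fun=> 0); split=> //; rewrite big_ord0. Qed.

Lemma irrelevant_homog n a : (0 < n)%N -> gr n a -> irrelevant a.
Proof.
move=> n0 ha; exists n.+1, (fun i => if i == n then a else 0); split.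
- by move=> i; case: eqP => [->|_].
- by rewrite eq_sym -[_ == _]negbK -lt0n n0.
- by move=> i ni; case: eqP => // e; rewrite e ltnn in ni.
rewrite big_ord_recr /= eqxx big1 ?add0r // => i _.
by rewrite ltn_eqF.
Qed.

Lemma irrelevantM a b : irrelevant a -> irrelevant b -> irrelevant (a * b).
Proof.
move=> [n [c [cg c0 cn ->]]] [m [d [dg d0 dm ->]]].
rewrite mulr_suml; elim/big_ind: _ => [|x y|i _].
- exact: irrelevant0.
- exact: irrelevantD.
rewrite mulr_sumr; elim/big_ind: _ => [|x y|j _].
- exact: irrelevant0.
- exact: irrelevantD.
have [i0|i0] := posnP i; first by rewrite i0 c0 mul0r; exact: irrelevant0.
by apply: (@irrelevant_homog (i + j)); [rewrite addn_gt0 i0 | exact: cgr_mul].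
Qed.

Lemma irrelevant_scalar (x : k) : irrelevant x%:A -> x = 0.
Proof.
move=> [n [c [cg c0 cn e]]].
pose d i := if i == 0%N then x%:A else - c i.
have dg i : gr i (d i).
  rewrite /d; case: eqP => [->|_]; first by apply/cgr_0 => //; exists x.
  by rewrite -scaleN1r; exact: grZ.
have hs : \sum_(i <- iota 0 n.+1) d i = 0.
  rewrite -[iota _ _]/(index_iota 0 n.+1) big_mkord big_ord_recl /= {1}/d /= e.
  rewrite (pad (leqnSn n)) // big_ord_recl c0 add0r -big_split big1 //= => i _.
  by rewrite addrN.
have /eqP := grading_direct (cgr_grading h) (iota_uniq 0 n.+1) dg hs (mem_head 0%N _).
by rewrite /d /= scaler_eq0 oner_eq0 orbF => /eqP.
Qed.

Lemma augmentation_ex a : exists c : k, irrelevant (a - c%:A).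
Proof.
have [s [c [us cg ->]]] := grading_sum (cgr_grading h) a.
elim: s us => [|i s IH] /=.
  by move=> _; exists 0; rewrite big_nil scale0r subr0; exact: irrelevant0.
move=> /andP[_ /IH[x hx]]; rewrite big_cons.
have [i0|i0] := posnP i.
  have /cgr_0[//|y cy] := cg 0%N; exists (y + x).
  by rewrite i0 cy scalerDl opprD addrACA subrr add0r.
exists x; rewrite -addrA; apply: irrelevantD => //.
exact: irrelevant_homog (cg i).
Qed.

Definition augmentation (a : A) : k := projT1 (cid (augmentation_ex a)).

Lemma augmentationP a : irrelevant (a - (augmentation a)%:A).
Proof. by rewrite /augmentation; case: cid. Qed.

Lemma augmentation_eq a c : irrelevant (a - c%:A) -> augmentation a = c.
Proof.
move=> hc; apply/eqP; rewrite -subr_eq0; apply/eqP/irrelevant_scalar.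
have := irrelevantD hc (irrelevantZ (-1) (augmentationP a)).
by rewrite scaleN1r opprB addrC addrA subrK -scalerBl.
Qed.

Lemma augmentationD a b : augmentation (a + b) = augmentation a + augmentation b.
Proof.
apply: augmentation_eq; rewrite scalerDl opprD addrACA.
by apply: irrelevantD; exact: augmentationP.
Qed.

Lemma augmentation1 : augmentation 1 = 1.
Proof.
by apply: augmentation_eq; rewrite scale1r subrr; exact: irrelevant0.
Qed.

Lemma augmentationM a b : augmentation (a * b) = augmentation a * augmentation b.
Proof.
apply: augmentation_eq.
set x := augmentation a; set y := augmentation b.
have -> : a * b - (x * y)%:A
  = (a - x%:A) * (b - y%:A) + (x *: (b - y%:A) + y *: (a - x%:A)).
  have -> : x *: (b - y%:A) = x%:A * (b - y%:A) by rewrite -scalerAl mul1r.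
  have -> : y *: (a - x%:A) = (a - x%:A) * y%:A by rewrite -scalerAr mulr1.
  have -> : (x * y)%:A = x%:A * y%:A :> A by rewrite -scalerAl mul1r scalerA.
  by rewrite addrA -mulrDl subrK mulrBr mulrBl addrA subrK.
have ha := augmentationP a; have hb := augmentationP b.
apply: irrelevantD; first exact: irrelevantM.
by apply: irrelevantD; apply: irrelevantZ.
Qed.

Local Notation residue := (residue h).

HB.instance Definition _ := GRing.Zmodule.copy residue k^o.

Definition residue_scale (a : A) (c : residue) : residue := augmentation a * c.

Fact residue_scaleA a b c :
  residue_scale a (residue_scale b c) = residue_scale (a * b) c.
Proof. by rewrite /residue_scale augmentationM mulrA. Qed.
Fact residue_scale1 : left_id 1 residue_scale.
Proof. by move=> c; rewrite /residue_scale augmentation1 mul1r. Qed.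
Fact residue_scaleDr : right_distributive residue_scale +%R.
Proof. by move=> a x y; rewrite /residue_scale [LHS]mulrDr. Qed.
Fact residue_scaleDl c : {morph residue_scale^~ c : a b / a + b}.
Proof. by move=> a b; rewrite /residue_scale augmentationD [LHS]mulrDl. Qed.

HB.instance Definition _ := GRing.Zmodule_isLmodule.Build A residue
  residue_scaleA residue_scale1 residue_scaleDr residue_scaleDl.

End Augmentation.

Record graded_module (M : lmodType A) (G : int -> M -> Prop) : Prop :=
  GradedModule {
  gmod_grading : grading G;
  gmod_scale : forall (i : nat) (j : int) a x,
    gr i a -> G j x -> G (i%:Z + j) (a *: x)
}.

Record gmod := Gmod {
  gmod_sort :> lmodType A;
  gmod_gr : int -> gmod_sort -> Prop;
  gmodP : graded_module gmod_gr
}.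

Section Residue.
Hypothesis h : connected_graded.

Definition residue_gr (n : int) (c : residue h) : Prop := n <> 0 -> c = 0.

Fact residue_graded : graded_module residue_gr.
Proof.
split; first split.
- by [].
- by move=> i x y hx hy i0; rewrite hx // hy // subr0.
- move=> x; exists [:: 0], (fun i => if i == 0 then x else 0); split=> //.
    by move=> i; rewrite /residue_gr; case: eqP.
  by rewrite big_seq1.
- move=> s c us cg e i si; have [i0|/eqP/cg//] := eqVneq i 0.
  rewrite -{}e (bigD1_seq i) //= big1 ?addr0 // => j ji.
  by apply: cg; apply/eqP; rewrite -i0.
move=> i j a x ha hx ij.
have [j0|/eqP/hx->] := eqVneq j 0; last by rewrite scaler0.
have i0 : (0 < i)%N by move: ij; rewrite j0 addr0; case: i {ha}.
suff aug0 : augmentation h a = 0 by rewrite -[LHS]/(_ * _) aug0 mul0r.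
apply: augmentation_eq; rewrite scale0r subr0; exact: irrelevant_homog ha.
Qed.

Definition residue_gmod : gmod := Gmod residue_graded.

End Residue.

Definition homog (M N : gmod) (d : int) (f : M -> N) : Prop :=
  forall i x, gmod_gr i x -> gmod_gr (i + d) (f x).

Definition projective (P : gmod) : Prop :=
  forall (M N : gmod) (p : {linear M -> N}) (f : {linear P -> N}),
    homog 0 p -> (forall y, exists x, p x = y) -> homog 0 f ->
    exists g : {linear P -> M}, homog 0 g /\ forall x, p (g x) = f x.

Record resolution (M : gmod) := Resolution {
  res_mod :> nat -> gmod;
  res_d : forall n, {linear res_mod n.+1 -> res_mod n};
  res_aug : {linear res_mod 0 -> M};
  res_projective : forall n, projective (res_mod n);
  res_d_homog : forall n, homog 0 (res_d n);
  res_aug_homog : homog 0 res_aug;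
  res_aug_surj : forall y, exists x, res_aug x = y;
  res_aug_exact : forall x, res_aug x = 0 <-> exists y, x = res_d 0 y;
  res_exact : forall n x, res_d n x = 0 <-> exists y, x = res_d n.+1 y
}.

Definition ext_cocycle (M N : gmod) (P : resolution M) (i : nat) (d : int)
    (f : {linear P i -> N}) : Prop :=
  homog d f /\ forall x, f (res_d P i x) = 0.

Definition ext_coboundary (M N : gmod) (P : resolution M) (i : nat) (d : int) :
    {linear P i -> N} -> Prop :=
  match i with
  | 0 => fun f => forall x, f x = 0
  | j.+1 => fun f => exists g : {linear P j -> N},
      homog d g /\ forall x, f x = g (res_d P j x)
  end.

(* The degree d component of Ext^i_A(M, N) vanishes, i.e. the i-th cohomology
   of the complex of homogeneous A-linear maps of degree d from a projective resolution
   of M to N, vanishes. *)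
Definition ext_vanishes (M N : gmod) (i : nat) (d : int) : Prop :=
  forall (P : resolution M) (f : {linear P i -> N}),
    ext_cocycle d f -> ext_coboundary d f.

Definition is_tensor_algebra (V : lmodType k) (F : algType k)
    (iota : {linear V -> F}) : Prop :=
  forall (B : algType k) (f : {linear V -> B}),
    exists g : {lrmorphism F -> B}, (forall v, g (iota v) = f v) /\
      forall g' : {lrmorphism F -> B}, (forall v, g' (iota v) = f v) -> g' =1 g.

Definition tensor_power (V : lmodType k) (F : algType k) (iota : {linear V -> F})
    (n : nat) (x : F) : Prop :=
  exists s : seq (n.-tuple V), x = \sum_(t <- s) \prod_(v <- t) iota v.

Definition ideal_generated (F : algType k) (R : F -> Prop) (x : F) : Prop :=
  exists s : seq (F * F * F),
    (forall p, p \in s -> R p.1.2) /\ x = \sum_(p <- s) p.1.1 * p.1.2 * p.2.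

(* A is isomorphic to TV/(R) as a graded algebra, R being contained in the m-th
   tensor power of V. *)
Definition m_homogeneous (m : nat) : Prop :=
  exists (V : lmodType k) (TV : algType k) (iota : {linear V -> TV})
         (R : TV -> Prop) (pi : {lrmorphism TV -> A}),
    [/\ is_tensor_algebra iota,
        forall r, R r -> tensor_power iota m r,
        forall v, gr 1%N (pi (iota v)),
        forall a, exists x, pi x = a &
        forall x, pi x = 0 <-> ideal_generated R x].

(* A vanishing Ext^i counts as concentrated in one degree. *)
Definition m_koszul (m : nat) : Prop :=
  exists h : connected_graded,
    m_homogeneous m /\
    forall i, exists d, forall d', d' <> d ->
      ext_vanishes (residue_gmod h) (residue_gmod h) i d'.

End GradedAlgebra.

Section GradedComodule.
Variable k : fieldType.

(* The subspace P ⊗ V of U ⊗ V, for P a subspace of U. *)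
Definition tens_sub (U V : lmodType k) (P : U -> Prop) (x : U ⊗ V) : Prop :=
  exists s : seq (U * V),
    (forall p, p \in s -> P p.1) /\ x = \sum_(p <- s) p.1 ⊗ p.2.

Record graded_comodule_algebra (H : algType k) (hH : hopf_algebra H)
    (A : algType k) (gr : nat -> A -> Prop) (rho : {lrmorphism A -> A ⊗ H}) :
    Prop := GradedComoduleAlgebra {
  gca_graded : connected_graded gr;
  gca_comodule : right_comodule_algebra hH rho;
  gca_subcomodule : forall n a, gr n a -> tens_sub (gr n) (rho a)
}.

Definition twist_gr (H A T : algType k) (rhoA : {lrmorphism A -> A ⊗ H})
    (rhoT : {lrmorphism T -> H ⊗ T}) (gr : nat -> A -> Prop) (n : nat)
    (x : twist rhoA rhoT) : Prop :=
  tens_sub (gr n) (twist_val x).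

End GradedComodule.

(* Main.v *)
Require Import Defs.
From HB Require Import structures.
From mathcomp Require Import all_boot all_algebra all_field.
From mathcomp Require Import boolp classical_sets.
From mathcomp Require Import freeg.

(* Let B = A ⊗ T, which contains both A and the twisted algebra Ã, and let
   (b_j) be a basis of T.  Because the Galois map of T, and hence (the antipode
   being bijective) also its right-handed variant, is bijective, B is free with
   basis (1 ⊗ b_j) over A and over Ã, on either side.  For {R, S} = {A, Ã} the
   left action of R on B_S and the right action of S on the left R-module B
   thus give graded algebra maps alpha : R -> M_J(S) and gamma : S -> M_J(R) with
     sum_l gamma_{lq}(alpha_{lj} r) = delta_{qj} r  and
     sum_l alpha_{ql}(gamma_{jl} s) = delta_{qj} s,
   and this is all that is needed to pass from S to R.
   Ext: if P resolves k over S then P^J, an R-module through alpha, resolves k^J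
   over R; it is projective since Hom_R(P^J, N) = Hom_S(P, N^J), where S acts on
   N^J through gamma.  By the same adjunction a cocycle P_i^J -> k amounts to a
   family of S-linear cocycles P_i -> k, and k is a retract of k^J.
   Relations: A is a quotient of TV by relations of degree m >= 1 iff
   A_{n+1} = A_n A_1 for all n and the kernel of A ⊗ A_1 -> A is generated, as a
   left A-module, by its part in A_{m-1} ⊗ A_1; both conditions pass from S to R
   by applying alpha and gamma entrywise. *)

Set Implicit Arguments.
Unset Strict Implicit.
Unset Printing Implicit Defensive.

Import GRing.Theory.
Local Open Scope ring_scope.

(** * Gradings *)

(** The isomorphism of T with H makes T finite-dimensional and nonzero, so J is finite and nonempty.
    Writing the inverse Galois map as y |-> sum_l c_l(y) ⊗ b_l, the coordinates of B over Ã are a ⊗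
    t |-> a_0 ⊗ c_l(a_1 ⊗ t), and colinearity of the Galois map places them in Ã. The usual Galois
    map multiplies by b_l on the right and gives freeness of B as a left Ã-module, which the passage
    from A to Ã consumes. The passage back takes right freeness, hence the Galois map of the
    opposite multiplication, and there the antipode must be invertible. Ext vanishing is stated for
    all projective resolutions, so its transport has to start from one that is shown to exist and to
    end by comparing P^J with an arbitrary one. Relations are handled through syzygies because a
    presentation TV/(R) has no evident image under alpha and gamma, whose entries are not
    multiplicative. The condition on A ⊗ A_1 -> A involves only products of two factors, for which
    the matrix product rule suffices. *)

Section Grading.
Variables (I : eqType) (M : zmodType) (G : I -> M -> Prop).

(** Repeated indices are allowed, so closure under sums is concatenation. The duplicate-free form
    demanded by [grading] is recovered once, by collecting terms of equal index. *)
Definition decomposable (x : M) : Prop :=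
  exists s : seq (I * M), (forall p, p \in s -> G p.1 p.2) /\ x = \sum_(p <- s) p.2.

Lemma decomposable0 : decomposable 0.
Proof. by exists [::]; rewrite big_nil. Qed.

Lemma decomposableD x y : decomposable x -> decomposable y -> decomposable (x + y).
Proof.
move=> [s [sG ->]] [t [tG ->]]; exists (s ++ t); rewrite big_cat; split=> // p.
by rewrite mem_cat => /orP[/sG|/tG].
Qed.

Lemma decomposable_sum (T : eqType) (r : seq T) (F : T -> M) :
  (forall t, t \in r -> decomposable (F t)) -> decomposable (\sum_(t <- r) F t).
Proof.
elim: r => [|t r IH] h; first by rewrite big_nil; exact: decomposable0.
rewrite big_cons; apply: decomposableD; first by apply: h; rewrite mem_head.
by apply: IH => u ur; apply: h; rewrite inE ur orbT.
Qed.

Lemma decomposable_homog i x : G i x -> decomposable x.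
Proof.
by move=> h; exists [:: (i, x)]; rewrite big_seq1; split=> // p; rewrite inE => /eqP->.
Qed.

Hypothesis G0 : forall i, G i 0.
Hypothesis GB : forall i x y, G i x -> G i y -> G i (x - y).

Let GD i x y : G i x -> G i y -> G i (x + y).
Proof. by move=> hx hy; rewrite -[y]opprK; apply: GB => //; rewrite -sub0r; apply: GB. Qed.

Lemma decomposableP x : decomposable x <-> exists (s : seq I) (c : I -> M),
  [/\ uniq s, forall i, G i (c i) & x = \sum_(i <- s) c i].
Proof.
split; last first.
  move=> [s [c [_ cG ->]]]; apply: decomposable_sum => i _.
  exact: decomposable_homog (cG i).
move=> [s [sG ->]]; exists (undup (map fst s)), (fun i => \sum_(p <- s | p.1 == i) p.2).
split; first exact: undup_uniq.
  move=> i; rewrite big_seq_cond; elim/big_ind: _ => //= [|p /andP[/sG h /eqP<-] //].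
  by move=> u v; exact: GD.
rewrite (exchange_big_dep xpredT) //= big_seq [RHS]big_seq; apply: eq_bigr => p ps.
have pu : p.1 \in undup (map fst s) by rewrite mem_undup; apply: map_f.
rewrite big_mkcond (bigD1_seq p.1) ?undup_uniq //= eqxx big1 ?addr0 // => i ne.
by rewrite eq_sym (negPf ne).
Qed.

Lemma grading_of_decomposable :
  (forall x, decomposable x) ->
  (forall (s : seq I) (c : I -> M), uniq s -> (forall i, G i (c i)) ->
     \sum_(i <- s) c i = 0 -> forall i, i \in s -> c i = 0) ->
  grading G.
Proof. by move=> h1 h2; split=> // x; apply/decomposableP. Qed.

End Grading.

Section GradingProjection.
Variables (I : eqType) (M : zmodType) (G : I -> M -> Prop) (gG : grading G).

Let G0 := grading0 gG.
Let GB := gradingB gG.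
Let GD := gradingD gG.

Lemma grading_sum_closed i (T : eqType) (r : seq T) (P : pred T) (F : T -> M) :
  (forall t, t \in r -> P t -> G i (F t)) -> G i (\sum_(t <- r | P t) F t).
Proof.
move=> h; rewrite big_seq_cond; elim/big_ind: _ => //= [x y|t /andP[]]; first exact: GD.
exact: h.
Qed.

(** The family is cut to 0 outside its support, so that the same [c] also sums to [x] over every
    larger list. *)
Lemma gproj_ex x : exists c : I -> M, (forall i, G i (c i)) /\
  exists s, [/\ uniq s, forall i, i \notin s -> c i = 0 & x = \sum_(i <- s) c i].
Proof.
have [s [c [us cG ->]]] := grading_sum gG x.
exists (fun i => if i \in s then c i else 0); split=> [i|]; first by case: ifP.
exists s; split=> // [i h|]; first by rewrite (negPf h).
by rewrite big_seq [RHS]big_seq; apply: eq_bigr => i ->.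
Qed.

Definition gproj (i : I) (x : M) : M := projT1 (cid (gproj_ex x)) i.

Lemma gproj_gr i x : G i (gproj i x).
Proof. by rewrite /gproj; case: cid => c /= [h _]. Qed.

Lemma gproj_sum x : exists s : seq I, [/\ uniq s, forall i, i \notin s -> gproj i x = 0
  & x = \sum_(i <- s) gproj i x].
Proof. by rewrite /gproj; case: cid => c /= [h1 h2]. Qed.

Lemma gproj_sum_sub x : exists s : seq I, forall r : seq I, uniq r -> {subset s <= r} ->
  x = \sum_(i <- r) gproj i x.
Proof.
have [s [us s0 e]] := gproj_sum x; exists s => r ur sr.
rewrite {1}e [RHS](bigID (mem s)) /= [X in _ + X]big1 ?addr0; last first.
  by move=> i /s0.
rewrite -[RHS]big_filter;
apply: perm_big; apply: uniq_perm => // [|i].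
  exact: filter_uniq.
by rewrite mem_filter; case: (boolP (i \in s)) => // /sr ->.
Qed.

(** The components were picked by choice, separately for each element. This uniqueness, which is
    directness applied to a difference of two decompositions, makes them additive and natural. *)
Lemma gproj_eq x (s : seq I) (c : I -> M) i : uniq s -> (forall i, G i (c i)) ->
  x = \sum_(i <- s) c i -> gproj i x = if i \in s then c i else 0.
Proof.
(* The common index list contains [i] itself, which covers the case where [i] lies in neither
   support. *)
move=> us cG e; have [t /(_ (undup (i :: s ++ t)))] := gproj_sum_sub x.
set r := undup _ => /(_ (undup_uniq _)) h.
have {h} e2 : x = \sum_(j <- r) gproj j x.
  by apply: h => j jt; rewrite /r mem_undup inE mem_cat jt !orbT.
have e3 : x = \sum_(j <- r) (if j \in s then c j else 0).
  rewrite e -big_mkcond /= -[RHS]big_filter; apply: perm_big; apply: uniq_perm => // [|j].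
    by rewrite filter_uniq // undup_uniq.
  by rewrite mem_filter /r mem_undup inE mem_cat; case: (j \in s); rewrite //= orbT.
apply/eqP; rewrite -subr_eq0; apply/eqP.
apply: (grading_direct gG (s := r) (c := fun j => gproj j x - (if j \in s then c j else 0))).
- exact: undup_uniq.
- by move=> j; apply: GB; [exact: gproj_gr | case: ifP].
- by rewrite sumrB -e2 -e3 subrr.
- by rewrite /r mem_undup inE eqxx.
Qed.

Lemma gproj_homog i j x : G j x -> gproj i x = if i == j then x else 0.
Proof.
move=> hx; rewrite (@gproj_eq x [:: j] (fun l => if l == j then x else 0)) //.
- by rewrite inE; case: eqP.
- by move=> l; case: eqP => [->|].
- by rewrite big_seq1 eqxx.
Qed.

Lemma gproj_is_additive i : {morph gproj i : x y / x - y}.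
Proof.
move=> x y; have [s hs] := gproj_sum_sub x; have [t ht] := gproj_sum_sub y.
pose r := undup (i :: s ++ t).
have ur : uniq r by exact: undup_uniq.
rewrite (@gproj_eq (x - y) r (fun j => gproj j x - gproj j y)) //.
- by rewrite /r mem_undup inE eqxx.
- by move=> j; apply: GB; exact: gproj_gr.
- rewrite sumrB -hs -?ht // => j h; rewrite /r mem_undup inE mem_cat h ?orbT //.
Qed.

HB.instance Definition _ i := GRing.isZmodMorphism.Build M M (gproj i) (gproj_is_additive i).

End GradingProjection.

Lemma gproj_morph (I : eqType) (M N : zmodType) (G : I -> M -> Prop) (G' : I -> N -> Prop)
  (gG : grading G) (gG' : grading G') (f : {additive M -> N}) :
  (forall i x, G i x -> G' i (f x)) -> forall i x, f (gproj gG i x) = gproj gG' i (f x).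
Proof.
move=> h i x; have [s [us s0 e]] := gproj_sum gG x.
rewrite {2}e raddf_sum.
rewrite (@gproj_eq _ _ _ gG' _ s (fun j => f (gproj gG j x))) //.
  by case: ifPn => // /s0 ->; rewrite raddf0.
by move=> j; apply: h; exact: gproj_gr.
Qed.

Section ConnectedGraded.
Variables (k : fieldType) (A : algType k) (gr : nat -> A -> Prop).
Hypothesis h : connected_graded gr.

Lemma cgrZ n c a : gr n a -> gr n (c *: a).
Proof.
move=> ha; rewrite -[a]mul1r scalerAl -[n]add0n.
by apply: (cgr_mul h) => //; apply/(cgr_0 h) => //; exists c.
Qed.

Lemma cgr_scalar (c : k) : gr 0%N c%:A.
Proof. by apply/(cgr_0 h); exists c. Qed.

Definition cproj := gproj (cgr_grading h).

HB.instance Definition _ i := GRing.Additive.on (cproj i).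

Lemma cproj_scalable i : scalable (cproj i).
Proof.
move=> c x; symmetry.
exact: (@gproj_morph _ _ _ _ _ (cgr_grading h) (cgr_grading h) ( *:%R c)
  (fun i x => @cgrZ i c x) i x).
Qed.

HB.instance Definition _ i := GRing.isScalable.Build k A A *:%R (cproj i) (@cproj_scalable i).

Lemma cprojMr e n x a : gr e a -> cproj (n + e) (x * a) = cproj n x * a.
Proof.
move=> ha; have [s [us s0 ex]] := gproj_sum (cgr_grading h) x.
have hx i : gr i (cproj i x) by exact: gproj_gr.
rewrite {1}ex mulr_suml raddf_sum /=.
under eq_bigr => i _.
  rewrite /cproj (gproj_homog _ _ (cgr_mul h (hx i) ha)) eqn_add2r; over.
case: (boolP (n \in s)) => ns.
  rewrite (bigD1_seq n) //= eqxx big1 ?addr0 // => i ne.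
  by rewrite eq_sym (negPf ne).
rewrite [cproj n x](s0 _ ns) mul0r big_seq big1 // => i hi.
by rewrite ifN //; apply: contraNneq ns => ->.
Qed.

Lemma cprojMr_lt e n x a : gr e a -> (n < e)%N -> cproj n (x * a) = 0.
Proof.
move=> ha ne; have [s [us s0 ex]] := gproj_sum (cgr_grading h) x.
have hx i : gr i (cproj i x) by exact: gproj_gr.
rewrite {1}ex mulr_suml raddf_sum big1 //= => i _.
rewrite /cproj (gproj_homog _ _ (cgr_mul h (hx i) ha)) ifN //.
by rewrite neq_ltn (leq_trans ne) // leq_addl.
Qed.

Lemma augmentation_homog n a : (0 < n)%N -> gr n a -> augmentation h a = 0.
Proof.
by move=> n0 ha; apply: augmentation_eq; rewrite scale0r subr0; exact: irrelevant_homog ha.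
Qed.

Lemma augmentation_scalar (c : k) : augmentation h c%:A = c.
Proof. by apply: augmentation_eq; rewrite subrr; exact: irrelevant0. Qed.

Lemma augmentation0 : augmentation h 0 = 0.
Proof. by rewrite -(scale0r 1) augmentation_scalar. Qed.

Lemma connected_ind (P : A -> Prop) :
  P 0 -> (forall x y, P x -> P y -> P (x + y)) -> (forall c : k, P c%:A) ->
  (forall n a, (0 < n)%N -> gr n a -> P a) -> forall a, P a.
Proof.
move=> P0 PD Pc Pg a; have [s [c [_ cg ->]]] := grading_sum (cgr_grading h) a.
elim/big_ind: _ => // i _; have [i0|i0] := posnP i; last exact: Pg (cg i).
by have := cg i; rewrite {1}i0 => /(cgr_0 h)[x ->].
Qed.

End ConnectedGraded.

(** * Free modules and resolutions *)

Section Kernel.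
Variables (k : fieldType) (A : algType k) (gr : nat -> A -> Prop).
Variables (M N : gmod gr) (p : {linear M -> N}).

Definition kernel_pred : {pred M} := [pred x | p x == 0].

Fact kernel_closed : GRing.submod_closed kernel_pred.
Proof.
split=> [|a x y]; first by rewrite inE linear0.
by rewrite !inE => /eqP hx /eqP hy; rewrite linearP hx hy scaler0 addr0.
Qed.

Record kernel := Kernel { kernel_val : M; _ : kernel_val \in kernel_pred }.

HB.instance Definition _ := [isSub of kernel for kernel_val].
HB.instance Definition _ := [Choice of kernel by <:].
HB.instance Definition _ :=
  GRing.SubChoice_isSubLmodule.Build A M _ kernel kernel_closed.

Lemma kernelP (x : kernel) : p (\val x) = 0.
Proof. exact/eqP/(valP x). Qed.

Definition kernel_gr (d : int) (x : kernel) : Prop := gmod_gr d (\val x).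

Hypothesis hp : homog 0 p.

Lemma homog0 (d : int) (x : M) : gmod_gr d x -> gmod_gr d (p x).
Proof. by move=> /hp; rewrite addr0. Qed.

(** A degree-preserving map commutes with the projections, so the components of a kernel element are
    again in the kernel. *)
Fact kernel_graded : graded_module gr kernel_gr.
Proof.
have gM := gmod_grading (gmodP M); have gN := gmod_grading (gmodP N).
split; last first.
  by move=> i j a x ha hx; rewrite /kernel_gr linearZ; exact: (gmod_scale (gmodP M)).
have K0 : forall i, kernel_gr i 0 by move=> i; rewrite /kernel_gr raddf0; exact: grading0.
apply: grading_of_decomposable => //.
- by move=> i x y; rewrite /kernel_gr raddfB; exact: gradingB.
- move=> x; have [s [us s0 e]] := gproj_sum gM (\val x).
  have pc i : gproj gM i (\val x) \in kernel_pred.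
    have e1 : p (gproj gM i (\val x)) = gproj gN i (p (\val x)).
      exact: gproj_morph homog0 i _.
    by rewrite inE e1 kernelP raddf0.
  exists [seq (i, Kernel (pc i)) | i <- s]; split.
    by move=> q /mapP[i _ ->]; rewrite /kernel_gr /=; exact: gproj_gr.
  by apply: val_inj; rewrite big_map raddf_sum {1}e.
- move=> s c us cg /(congr1 val); rewrite raddf_sum raddf0 /= => e i si.
  apply: val_inj; rewrite raddf0.
  exact: (grading_direct gM us (c := fun i => \val (c i))) e _ si.
Qed.

Definition kernel_gmod : gmod gr := Gmod kernel_graded.

Lemma kernel_val_linear : linear (kernel_val : kernel_gmod -> M).
Proof. by move=> a x y; rewrite -![kernel_val _]/(\val _) linearP. Qed.

HB.instance Definition _ :=
  GRing.isLinear.Build A kernel_gmod M *:%R (kernel_val : kernel_gmod -> M) kernel_val_linear.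

End Kernel.

Section Free.
Variables (k : fieldType) (A : algType k) (gr : nat -> A -> Prop).
Hypothesis hgr : connected_graded gr.

Let gA := cgr_grading hgr.

(** Algebras are graded by naturals and modules by integers. Extending the algebra by 0 in negative
    degrees lets shifted copies of it serve as modules. *)
Definition int_gr (d : int) (a : A) : Prop :=
  match d with Posz n => gr n a | Negz _ => a = 0 end.

Lemma int_gr0 d : int_gr d 0.
Proof. by case: d => //= n; exact: grading0. Qed.

Lemma int_grB d a b : int_gr d a -> int_gr d b -> int_gr d (a - b).
Proof. by case: d => /= [n|_ -> ->]; [exact: gradingB | rewrite subr0]. Qed.

Lemma int_gr_grading : grading int_gr.
Proof.
apply: grading_of_decomposable; [exact: int_gr0 | exact: int_grB | |].
  move=> x; have [s [us _ e]] := gproj_sum gA x; exists [seq (Posz i, gproj gA i x) | i <- s].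
  split; last by rewrite big_map.
  by move=> q /mapP[i _ ->]; exact: gproj_gr.
move=> s c us cg e i si; case: i si => [n|n] si; last exact: (cg (Negz n)).
apply: (grading_direct gA (s := pmap (fun i => if i is Posz n then Some n else None) s)
          (c := fun n => c (Posz n))); last first.
- by rewrite mem_pmap; apply/mapP; exists (Posz n).
- rewrite -[RHS]e {e si}; elim: s {us} => [|i s IH] /=; first by rewrite !big_nil.
  rewrite [RHS]big_cons -IH; case: i => [i|i] /=; first by rewrite big_cons.
  by rewrite (cg (Negz i)) add0r.
- by move=> i; exact: (cg (Posz i)).
- apply: (pmap_uniq (g := fun i => Posz i)) us => -[i|i] //=.
Qed.

Lemma int_grM (i : nat) (d : int) a b : gr i a -> int_gr d b -> int_gr (i%:Z + d) (a * b).
Proof.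
case: d => [n|n] ha hb; first exact: (cgr_mul hgr).
by rewrite hb mulr0; exact: int_gr0.
Qed.

Section FreeModule.
Variables (K : choiceType) (deg : K -> int).

Notation F := {freeg K / A}.

(** The generator [z] sits in degree [deg z]: this is the direct sum of the shifted modules A(-deg
    z). *)
Definition free_gr (d : int) (x : F) : Prop := forall z, int_gr (d - deg z) (coeff z x).

Lemma free_grU z d a : int_gr d a -> free_gr (d + deg z) (<< a *g z >> : F).
Proof.
move=> ha y; rewrite coeffU; case: eqP => [->|_]; first by rewrite addrK mulr1.
by rewrite mulr0; exact: int_gr0.
Qed.

Fact free_graded : graded_module gr free_gr.
Proof.
have G0 d : free_gr d 0 by move=> z; rewrite coeff0; exact: int_gr0.
have GB d x y : free_gr d x -> free_gr d y -> free_gr d (x - y).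
  by move=> hx hy z; rewrite coeffB; apply: int_grB.
split; last first.
  by move=> i j a x ha hx z; rewrite coeffZ -addrA; exact: int_grM.
apply: grading_of_decomposable => //.
- move=> x; rewrite -(freeg_sumE x); apply: decomposable_sum => z _.
  have [s [us _ e]] := gproj_sum int_gr_grading (coeff z x).
  exists [seq (i + deg z, << gproj int_gr_grading i (coeff z x) *g z >>) | i <- s].
  split; first by move=> q /mapP[i _ ->]; apply: free_grU; exact: gproj_gr.
  rewrite big_map /= {1}e; elim: s {us e} => [|i s IH]; first by rewrite !big_nil freegU0.
  by rewrite !big_cons -IH freegUD.
move=> s c us cg e i si; apply/eqP/freeg_eqP => z /=; rewrite coeff0.
pose c' j := coeff z (c (j + deg z)).
suff: c' (i - deg z) = 0 by rewrite /c' subrK.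
apply: (@grading_direct _ _ _ int_gr_grading [seq i - deg z | i <- s] c').
- by rewrite map_inj_uniq // => u v /(congr1 (fun x => x + deg z)); rewrite !subrK.
- by move=> j; rewrite -[X in int_gr X](addrK (deg z)); exact: cg.
- rewrite big_map /c'; under eq_bigr => j _ do rewrite subrK.
  by have := congr1 (coeff z) e; rewrite raddf_sum coeff0.
- by apply/mapP; exists i.
Qed.

Definition free_gmod : gmod gr := Gmod free_graded.

Section Lift.
Variables (M : lmodType A) (f : K -> M).

Lemma fgliftE (x : F) : fglift f x = \sum_(z <- dom x) coeff z x *: f z.
Proof.
pose g : {additive F -> M} :=
  HB.pack (fglift f) (GRing.isZmodMorphism.Build _ _ _ (lift_is_additive f)).
rewrite -{1}(freeg_sumE x) -[LHS]/(g _) raddf_sum.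
by apply: eq_bigr => z _; exact: liftU.
Qed.

Lemma fglift_linear : linear (fglift f : F -> M).
Proof.
pose g : {additive F -> M} :=
  HB.pack (fglift f) (GRing.isZmodMorphism.Build _ _ _ (lift_is_additive f)).
move=> a x y; rewrite -![fglift f _]/(g _) raddfD; congr (_ + _).
rewrite -{1}(freeg_sumE x) scaler_sumr raddf_sum [RHS]/= fgliftE scaler_sumr.
apply: eq_bigr => z _; rewrite scalerA -[RHS](liftU f).
congr (fglift f _); apply/eqP/freeg_eqP => y'.
by rewrite coeffZ !coeffU mulrA.
Qed.

End Lift.

Lemma free_projective : projective free_gmod.
Proof.
move=> M N p f hp ps hf.
have gM := gmod_grading (gmodP M); have gN := gmod_grading (gmodP N).
have ex z : exists m : M, gmod_gr (deg z) m /\ p m = f << z >>.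
  have hz : gmod_gr (deg z) (f << z >>).
    apply: (homog0 hf); rewrite -[deg z]add0r; apply: free_grU => /=.
    by have := cgr_scalar hgr 1; rewrite scale1r.
  (* An arbitrary preimage need not be homogeneous, but its component of degree [deg z] is still a
     preimage. *)
  have [y py] := ps (f << z >>); exists (gproj gM (deg z) y); split; first exact: gproj_gr.
  have -> : p (gproj gM (deg z) y) = gproj gN (deg z) (p y).
    exact: gproj_morph (homog0 hp) _ _.
  by rewrite py (gproj_homog gN _ hz) eqxx.
pose m z := projT1 (cid (ex z)).
have [mg mp] : (forall z, gmod_gr (deg z) (m z)) /\ (forall z, p (m z) = f << z >>).
  by split=> z; rewrite /m; case: cid => ? /= [].
pose g : {linear free_gmod -> M} :=
  HB.pack (fglift m : free_gmod -> M) (GRing.isLinear.Build _ _ _ _ _ (fglift_linear m)).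
exists g; split=> [d x hx|x].
  rewrite addr0 [g x]fgliftE; apply: (grading_sum_closed gM) => z _ _.
  have := hx z; case E: (d - deg z) => [n|n] /= cz; last by rewrite cz scale0r; exact: grading0.
  by rewrite -(subrK (deg z) d) E; apply: (gmod_scale (gmodP M)).
rewrite [g x]fgliftE raddf_sum -[in RHS](freeg_sumE x) raddf_sum; apply: eq_bigr => z _ /=.
rewrite linearZ /= mp -linearZ; congr (f _); apply/eqP/freeg_eqP => y.
by rewrite coeffZ !coeffU mulrA mulr1.
Qed.

End FreeModule.

Section Cover.
Variable M : gmod gr.

(** The basis of the cover consists of all homogeneous elements tagged with their degrees, so no
    generators have to be selected. [{classic _}] provides the choice structure that [{freeg _ / _}]
    expects. *)
Definition homog_elt : Type := {classic {x : int * M | gmod_gr x.1 x.2}}.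

HB.instance Definition _ := Choice.on homog_elt.

Definition homog_deg (z : homog_elt) : int := (sval (z : {x : int * M | gmod_gr x.1 x.2})).1.
Definition homog_val (z : homog_elt) : M := (sval (z : {x : int * M | gmod_gr x.1 x.2})).2.

Definition cover : gmod gr := free_gmod homog_deg.

Definition cover_map : cover -> M := fglift homog_val.

HB.instance Definition _ :=
  GRing.isLinear.Build A cover M *:%R cover_map (fglift_linear homog_val).

Lemma cover_homog : homog 0 cover_map.
Proof.
have gM := gmod_grading (gmodP M).
move=> d x hx; rewrite addr0 [cover_map x]fgliftE; apply: (grading_sum_closed gM) => z _ _.
have := hx z; case E: (d - homog_deg z) => [n|n] /= cz; last by rewrite cz scale0r; exact: grading0.
rewrite -(subrK (homog_deg z) d) E; apply: (gmod_scale (gmodP M)) => //.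
by rewrite /homog_deg /homog_val; case: z {E cz hx}.
Qed.

Lemma cover_surj (y : M) : exists x, cover_map x = y.
Proof.
have gM := gmod_grading (gmodP M).
have [s [_ _ ->]] := gproj_sum gM y.
exists (\sum_(i <- s) << (exist _ (i, gproj gM i y) (gproj_gr gM i y) : homog_elt) >>).
rewrite raddf_sum; apply: eq_bigr => i _ /=.
by rewrite /cover_map liftU scale1r.
Qed.

End Cover.

Section Resolution.
Variable M : gmod gr.

Fixpoint syzygy (n : nat) : gmod gr :=
  match n with
  | 0 => M
  | n.+1 => kernel_gmod (@cover_homog (syzygy n))
  end.

Definition cover_d n : cover (syzygy n.+1) -> cover (syzygy n) :=
  (@kernel_val _ _ _ _ _ (@cover_map (syzygy n)) : syzygy n.+1 -> cover (syzygy n))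
    \o @cover_map (syzygy n.+1).

HB.instance Definition _ n := GRing.Linear.on (@cover_d n).

(** [ext_vanishes] quantifies over all resolutions, so drawing a conclusion from it takes one that
    exists. Here each term is the free cover of the kernel of the preceding cover. *)
Lemma resolution_ex : inhabited (resolution M).
Proof.
split.
apply: (@Resolution _ _ _ M (fun n => cover (syzygy n)) (fun n => @cover_d n) (@cover_map M)).
- by move=> n; exact: free_projective.
- by move=> n i x hx; have := cover_homog hx.
- exact: cover_homog.
- exact: cover_surj.
- move=> x; split=> [hx|[y ->]]; last exact: (kernelP (@cover_map (syzygy 1) y)).
  have hx' : x \in kernel_pred (@cover_map M) by rewrite inE; apply/eqP.
  by have [y e] := @cover_surj (syzygy 1) (Kernel hx'); exists y; rewrite /= /cover_d /= e.
- move=> n x; split=> [hx|[y ->]] /=; last first.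
    by rewrite /cover_d /= (kernelP (@cover_map (syzygy n.+2) y)).
  have hx' : x \in kernel_pred (@cover_map (syzygy n.+1)).
    by rewrite inE; apply/eqP; apply: val_inj; exact: hx.
  by have [y e] := @cover_surj (syzygy n.+2) (Kernel hx'); exists y; rewrite /= /cover_d /= e.
Qed.

End Resolution.

End Free.

(** * Comparison of resolutions *)

Lemma dependent_choice_nat (T : nat -> Type) (R : forall i, T i -> T i.+1 -> Prop) :
  forall t0 : T 0%N, (forall i t, exists t', R i t t') ->
  exists F : forall i, T i, F 0%N = t0 /\ forall i, R i (F i) (F i.+1).
Proof.
move=> t0 step; exists (nat_rect T t0 (fun i t => projT1 (cid (step i t)))); split=> // i.
exact: (projT2 (cid (step i _))).
Qed.

Definition linear_map (R : pzRingType) (U V : lmodType R) (f : U -> V) (lf : linear f) :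
  {linear U -> V} := HB.pack f (GRing.isLinear.Build _ _ _ _ f lf).

Section Comparison.
Variables (k : fieldType) (A : algType k) (gr : nat -> A -> Prop).
Implicit Types M N P : gmod gr.

Lemma homog_comp M N P d e (f : N -> P) (g : M -> N) :
  homog d f -> homog e g -> homog (d + e) (f \o g).
Proof. by move=> hf hg i x /hg /hf; rewrite addrA addrAC. Qed.

Lemma homogD M N d (f g : M -> N) :
  homog d f -> homog d g -> homog d (fun x => f x + g x).
Proof.
move=> hf hg i x hx; apply: (gradingD (gmod_grading (gmodP N))); [exact: hf | exact: hg].
Qed.

Lemma homogB M N d (f g : M -> N) :
  homog d f -> homog d g -> homog d (fun x => f x - g x).
Proof.
move=> hf hg i x hx; apply: (gradingB (gmod_grading (gmodP N))); [exact: hf | exact: hg].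
Qed.

(** [projective] only lifts along surjections. Exactness makes [u] surjective onto the graded module
    ker [v], through which [f] also factors. *)
Lemma projective_lift (P X Y Z : gmod gr) (u : {linear X -> Y}) (v : {linear Y -> Z}) (f : {linear P -> Y}) :
  projective P -> homog 0 u -> homog 0 v -> homog 0 f ->
  (forall x, v (u x) = 0) -> (forall y, v y = 0 -> exists x, y = u x) ->
  (forall x, v (f x) = 0) ->
  exists g : {linear P -> X}, homog 0 g /\ forall x, u (g x) = f x.
Proof.
move=> Pp hu hv hf vu ex vf.
have ku x : u x \in kernel_pred v by rewrite inE vu.
have kf x : f x \in kernel_pred v by rewrite inE vf.
pose K := kernel_gmod hv.
have lu : linear (fun x => Kernel (ku x) : K).
  by move=> a x y; apply: val_inj; rewrite [RHS]linearP /= linearP.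
have lf : linear (fun x => Kernel (kf x) : K).
  by move=> a x y; apply: val_inj; rewrite [RHS]linearP /= linearP.
pose u' : {linear X -> K} := linear_map lu.
pose f' : {linear P -> K} := linear_map lf.
have su (y : K) : exists x, u' x = y.
  by have [x e] := ex _ (kernelP y); exists x; apply: val_inj; rewrite /= e.
have [g [hg eg]] := Pp X K u' f' hu su hf.
by exists g; split=> // x; have /(congr1 val) := eg x.
Qed.

Section Resolution.
Variables (M : gmod gr) (P : resolution M).

(** The augmentation is treated as the differential out of degree 0, so that stage 0 and the later
    stages share one lifting lemma. *)
Definition res_tgt (i : nat) : gmod gr := if i is j.+1 then P j else M.

Definition res_v (i : nat) : {linear P i -> res_tgt i} :=
  match i return {linear P i -> res_tgt i} with
  | 0 => res_aug P
  | j.+1 => res_d P j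
  end.

Lemma res_v_homog i : homog 0 (res_v i).
Proof. by case: i => [|i]; [exact: res_aug_homog | exact: res_d_homog]. Qed.

Lemma res_v_exact i x : res_v i x = 0 <-> exists y, x = res_d P i y.
Proof. by case: i x => [|i] x; [exact: res_aug_exact | exact: res_exact]. Qed.

Lemma res_vd i x : res_v i (res_d P i x) = 0.
Proof. by apply/res_v_exact; exists x. Qed.

Lemma res_lift i (N : gmod gr) (f : {linear N -> P i}) : projective N -> homog 0 f ->
  (forall x, res_v i (f x) = 0) ->
  exists g : {linear N -> P i.+1}, homog 0 g /\ forall x, res_d P i (g x) = f x.
Proof.
move=> Np hf vf; apply: (projective_lift Np _ (@res_v_homog i) hf) => //.
- exact: res_d_homog.
- exact: res_vd.
- by move=> y /res_v_exact.
Qed.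

End Resolution.

Section ChainMap.
Variables (M N : gmod gr) (P : resolution M) (Q : resolution N).

Lemma chain_map_ex (phi : {linear M -> N}) : homog 0 phi ->
  exists f : forall i, {linear P i -> Q i},
    [/\ forall i, homog 0 (f i), forall x, res_aug Q (f 0%N x) = phi (res_aug P x) &
        forall i x, res_d Q i (f i.+1 x) = f i (res_d P i x)].
Proof.
move=> hphi.
have [f0 [hf0 ef0]] : exists g : {linear P 0%N -> Q 0%N},
    homog 0 g /\ forall x, res_aug Q (g x) = (phi \o res_aug P) x.
  apply: res_projective; first exact: res_aug_homog.
    exact: res_aug_surj.
  by rewrite -[0]addr0; apply: homog_comp => //; exact: res_aug_homog.
(* Each stage carries the fact that [f] sends boundaries to cycles, which is the hypothesis of the
   next lift. *)
pose T i := {f : {linear P i -> Q i} | homog 0 f /\ forall x, res_v Q i (f (res_d P i x)) = 0}.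
have v0 x : res_v Q 0 (f0 (res_d P 0 x)) = 0.
  rewrite -[LHS]/(res_aug Q (f0 _)) ef0 -[LHS]/(phi (res_v P 0 (res_d P 0 x))).
  by rewrite res_vd raddf0.
pose t0 : T 0%N := exist _ f0 (conj hf0 v0).
have step i (f : T i) : exists g : T i.+1, forall x, res_d Q i (sval g x) = sval f (res_d P i x).
  case: f => f [hf vf].
  have [|g [hg eg]] := @res_lift _ Q i _ (f \o res_d P i) (@res_projective _ _ _ _ P i.+1) _ vf.
    by rewrite -[0]addr0; apply: homog_comp => //; exact: res_d_homog.
  have vg x : res_v Q i.+1 (g (res_d P i.+1 x)) = 0.
    rewrite -[LHS]/(res_d Q i (g _)) eg -[LHS]/(f (res_v P i.+1 (res_d P i.+1 x))).
    by rewrite res_vd raddf0.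
  by exists (exist _ g (conj hg vg)).
have [F [F0 FS]] := dependent_choice_nat t0 step.
exists (fun i => sval (F i)); split=> //; first by move=> i; case: (svalP (F i)).
by move=> x; rewrite F0 /= ef0.
Qed.

(** Only chain maps over the zero map are treated; this is enough, as it gets applied to the
    difference of two lifts of the identity. *)
Lemma homotopy_ex (g : forall i, {linear P i -> Q i}) :
  (forall i, homog 0 (g i)) -> (forall x, res_aug Q (g 0%N x) = 0) ->
  (forall i x, res_d Q i (g i.+1 x) = g i (res_d P i x)) ->
  exists h : forall i, {linear P i -> Q i.+1},
    [/\ forall i, homog 0 (h i), forall x, g 0%N x = res_d Q 0 (h 0%N x) &
        forall i x, g i.+1 x = res_d Q i.+1 (h i.+1 x) + h i (res_d P i x)].
Proof.
move=> hg g0 gS.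
pose T i := {h : {linear P i -> Q i.+1} | homog 0 h /\
  forall x, res_v Q i.+1 (g i.+1 x - h (res_d P i x)) = 0}.
have [h0 [hh0 eh0]] := res_lift (@res_projective _ _ _ _ P 0) (hg 0%N) g0.
have v0 x : res_v Q 1 (g 1%N x - h0 (res_d P 0 x)) = 0.
  by rewrite -[LHS]/(res_d Q 0 _) raddfB /= gS eh0 subrr.
pose t0 : T 0%N := exist _ h0 (conj hh0 v0).
have step i (h : T i) : exists h' : T i.+1,
    forall x, res_d Q i.+1 (sval h' x) = g i.+1 x - sval h (res_d P i x).
  case: h => h [hh vh].
  have lf : linear (fun x => g i.+1 x - h (res_d P i x)).
    by move=> a x y; rewrite !linearP scalerDr addrACA.
  pose f : {linear P i.+1 -> Q i.+1} := linear_map lf.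
  have [|h' [hh' eh']] := @res_lift _ Q i.+1 _ f (@res_projective _ _ _ _ P i.+1) _ vh.
    apply: homogB => //; rewrite -[0]addr0; apply: homog_comp => //; exact: res_d_homog.
  have dd x : res_d P i (res_d P i.+1 x) = 0 by exact: (res_vd (i := i.+1)).
  have vh' x : res_v Q i.+2 (g i.+2 x - h' (res_d P i.+1 x)) = 0.
    rewrite -[LHS]/(res_d Q i.+1 _) raddfB /= gS eh'.
    by rewrite subKr dd raddf0.
  by exists (exist _ h' (conj hh' vh')).
have [F [F0 FS]] := dependent_choice_nat t0 step.
exists (fun i => sval (F i)); split=> [i|x|i x]; first by case: (svalP (F i)).
  by rewrite F0 /= eh0.
by rewrite FS subrK.
Qed.

End ChainMap.

(** The composite [b \o a] lifts the identity of [M], hence is homotopic to it, and [f] kills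
    boundaries, so [f] and [f \o b \o a] differ by a coboundary, while [f \o b] is a coboundary by
    the hypothesis on [E]. One argument thus covers both the passage to a retract and the change of
    resolution. *)
Lemma ext_retract (M M' L : gmod gr) (Q : resolution M) (E : resolution M')
    (iota : {linear M -> M'}) (pi : {linear M' -> M}) (i : nat) (d : int) :
  homog 0 iota -> homog 0 pi -> (forall x, pi (iota x) = x) ->
  (forall f : {linear E i -> L}, ext_cocycle d f -> ext_coboundary d f) ->
  forall f : {linear Q i -> L}, ext_cocycle d f -> ext_coboundary d f.
Proof.
move=> hiota hpi piK hE f [hf cf].
have [a [ha a0 aS]] := chain_map_ex Q E hiota.
have [b [hb b0 bS]] := chain_map_ex E Q hpi.
have lg j : linear (fun x : Q j => x - b j (a j x)).
  by move=> c x y; rewrite !linearP scalerDr addrACA.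
pose g j : {linear Q j -> Q j} := linear_map (lg j).
have [h [hh h0 hS]] : exists h : forall i, {linear Q i -> Q i.+1},
    [/\ forall i, homog 0 (h i), forall x, g 0%N x = res_d Q 0 (h 0%N x) &
        forall i x, g i.+1 x = res_d Q i.+1 (h i.+1 x) + h i (res_d Q i x)].
  apply: homotopy_ex => [j|x|j x] /=.
  - apply: homogB; first by move=> e x; rewrite addr0.
    by rewrite -[0]addr0; apply: homog_comp.
  - by rewrite raddfB /= b0 a0 piK subrr.
  - by rewrite raddfB /= bS aS.
have /hE : ext_cocycle d (f \o b i).
  split; first by rewrite -[d]addr0; apply: homog_comp.
  by move=> x; rewrite /= -bS cf.
have fE x : f x = f (b i (a i x)) + f (g i x) by rewrite -raddfD /= addrC subrK.
case: i f hf cf hE fE => [|i] f hf cf hE fE /=.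
  by move=> fb0 x; rewrite fE h0 cf addr0 fb0.
move=> [w [hw ew]].
(* The primitive of [f]: [w \o a] accounts for [f \o b \o a], and of the two homotopy terms only f
   (h (d x)) survives, because [f] vanishes on d (h x). *)
have lu : linear (fun x => w (a i x) + f (h i x)).
  by move=> c x y; rewrite !linearP scalerDr addrACA.
exists (linear_map lu); split=> [|x] /=.
  by apply: homogD; rewrite -[d]addr0; apply: homog_comp.
by rewrite fE hS raddfD /= cf add0r ew aS.
Qed.

End Comparison.

(** * Transport of Ext *)

(** A graded algebra map R -> M_J(S), recorded by its entries, each of which is merely k-linear. *)
Record mx_rep (k : fieldType) (R S : algType k) (grR : nat -> R -> Prop)
    (grS : nat -> S -> Prop) (J : finType) := MxRep {
  mx_entry :> J -> J -> {linear R -> S};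
  mx_rep1 : forall i j, mx_entry i j 1 = (i == j)%:R;
  mx_repM : forall i j a b, mx_entry i j (a * b) = \sum_q mx_entry i q a * mx_entry q j b;
  mx_rep_gr : forall i j n a, grR n a -> grS n (mx_entry i j a)
}.

(** A type of its own, with [rho] as a parameter, keeps the R-action through [rho] apart from the
    pointwise structure on [{ffun J -> N}]. *)
Definition mxmod (k : fieldType) (R S : algType k) (grR : nat -> R -> Prop)
    (grS : nat -> S -> Prop) (J : finType) (rho : mx_rep grR grS J) (N : lmodType S) : Type :=
  {ffun J -> N}.

Section RestrictionModule.
Variables (k : fieldType) (R S : algType k) (grR : nat -> R -> Prop).
Variables (grS : nat -> S -> Prop) (J : finType) (rho : mx_rep grR grS J).

Section Module.
Variable N : lmodType S.

Local Notation mxmod := (mxmod rho N).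

HB.instance Definition _ := GRing.Zmodule.on mxmod.

Definition mxmod_scale (r : R) (v : mxmod) : mxmod :=
  [ffun l => \sum_j rho l j r *: (v j : N)].

Fact mxmod_scaleA a b v : mxmod_scale a (mxmod_scale b v) = mxmod_scale (a * b) v.
Proof.
apply/ffunP => l; rewrite !ffunE.
under eq_bigr => j _ do rewrite ffunE scaler_sumr.
rewrite exchange_big; apply: eq_bigr => j _ /=.
by rewrite mx_repM scaler_suml; apply: eq_bigr => q _; rewrite scalerA.
Qed.
Fact mxmod_scale1 : left_id 1 mxmod_scale.
Proof.
move=> v; apply/ffunP => l; rewrite ffunE (bigD1 l) //= mx_rep1 eqxx scale1r.
by rewrite big1 ?addr0 // => j /negPf jl; rewrite mx_rep1 eq_sym jl scale0r.
Qed.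
Fact mxmod_scaleDr : right_distributive mxmod_scale +%R.
Proof.
move=> a x y; apply/ffunP => l; rewrite !ffunE -big_split.
by apply: eq_bigr => j _; rewrite ffunE scalerDr.
Qed.
Fact mxmod_scaleDl v : {morph mxmod_scale^~ v : a b / a + b}.
Proof.
move=> a b; apply/ffunP => l; rewrite !ffunE -big_split.
by apply: eq_bigr => j _; rewrite raddfD scalerDl.
Qed.

HB.instance Definition _ := GRing.Zmodule_isLmodule.Build R mxmod
  mxmod_scaleA mxmod_scale1 mxmod_scaleDr mxmod_scaleDl.

Lemma mxmodZ (r : R) (v : mxmod) l : (r *: v) l = \sum_j rho l j r *: v j.
Proof. by rewrite [LHS]ffunE. Qed.

Lemma mxmodD (v w : mxmod) l : (v + w) l = v l + w l.
Proof. by rewrite [LHS]ffunE. Qed.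

Lemma mxmod_sumE (I : Type) (s : seq I) (P : pred I) (F : I -> mxmod) l :
  (\sum_(i <- s | P i) F i) l = \sum_(i <- s | P i) F i l.
Proof.
by elim/big_rec2: _ => [|i x y _ <-]; [rewrite [LHS]ffunE | rewrite mxmodD].
Qed.

End Module.

Section GradedModule.
Variable N : gmod grS.

Definition mxmod_gr (d : int) (v : mxmod rho N) : Prop := forall j, gmod_gr d (v j).

Fact mxmod_graded : graded_module grR mxmod_gr.
Proof.
have gN := gmod_grading (gmodP N).
have G0 d : mxmod_gr d 0 by move=> j; rewrite [X in gmod_gr _ X]ffunE; exact: grading0.
have GB d x y : mxmod_gr d x -> mxmod_gr d y -> mxmod_gr d (x - y).
  by move=> hx hy j; rewrite [X in gmod_gr _ X]ffunE [X in _ + X]ffunE; apply: gradingB.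
split; last first.
  move=> i d a v ha hv l; rewrite mxmodZ; apply: (grading_sum_closed gN) => j _ _.
  by apply: (gmod_scale (gmodP N)); [exact: mx_rep_gr | exact: hv].
apply: grading_of_decomposable => //.
- move=> v.
  have -> : v = \sum_j ([ffun l => if l == j then v j else 0] : mxmod rho N).
    apply/ffunP => l; rewrite mxmod_sumE (bigD1 l) //= ffunE eqxx big1 ?addr0 // => j.
    by rewrite eq_sym ffunE => /negPf->.
  apply: decomposable_sum => j _; have [s [us s0 e]] := gproj_sum gN (v j).
  have -> : [ffun l => if l == j then v j else 0] =
      \sum_(i <- s) ([ffun l => if l == j then gproj gN i (v j) else 0] : mxmod rho N).
    apply/ffunP => l; rewrite mxmod_sumE ffunE; under eq_bigr do rewrite ffunE.
    by case: eqP => // _; rewrite big1.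
  apply: decomposable_sum => i _; apply: (decomposable_homog (i := i)) => l.
  by rewrite ffunE; case: eqP => _; [exact: gproj_gr | exact: grading0].
move=> s c us cg e i si; apply/ffunP => l; rewrite [RHS]ffunE.
apply: (@grading_direct _ _ _ gN s (fun i => c i l)) => //.
  by move=> j; exact: cg.
by rewrite -mxmod_sumE e ffunE.
Qed.

Definition mx_gmod : gmod grR := Gmod mxmod_graded.

End GradedModule.

Section Functor.
Variables (M N : gmod grS) (f : {linear M -> N}).

Definition mx_map (v : mx_gmod M) : mx_gmod N := [ffun j => f (v j)] : mxmod rho N.

Fact mx_map_linear : linear mx_map.
Proof.
move=> a x y; apply/ffunP => l; rewrite mxmodD mxmodZ !ffunE raddfD raddf_sum.
by congr (_ + _); apply: eq_bigr => j _; rewrite /= linearZ ffunE.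
Qed.

HB.instance Definition _ :=
  GRing.isLinear.Build R (mx_gmod M) (mx_gmod N) *:%R mx_map mx_map_linear.

Lemma mx_mapE v j : mx_map v j = f (v j). Proof. by rewrite ffunE. Qed.

Lemma mx_map_homog d : homog d f -> homog d mx_map.
Proof. by move=> hf i x hx j; rewrite mx_mapE; apply: hf. Qed.

Lemma mx_map_surj : (forall y, exists x, f x = y) -> forall y, exists x, mx_map x = y.
Proof.
move=> /choice[g fg] y; exists ([ffun j => g (y j)] : mxmod rho M).
by apply/ffunP => j; rewrite mx_mapE ffunE fg.
Qed.

End Functor.

Lemma mx_map_exact (L M N : gmod grS) (f : {linear M -> N}) (g : {linear L -> M}) :
  (forall x, f x = 0 <-> exists y, x = g y) ->
  forall x, mx_map f x = 0 <-> exists y, x = mx_map g y.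
Proof.
move=> ex x; split=> [/ffunP x0|[y ->]]; last first.
  by apply/ffunP => j; rewrite !mx_mapE [RHS]ffunE; apply/ex; exists (y j).
have /choice[y xy] j : exists y, x j = g y.
  by apply/ex; have := x0 j; rewrite mx_mapE [X in _ = X -> _]ffunE.
by exists ([ffun j => y j] : mxmod rho L); apply/ffunP => j; rewrite mx_mapE ffunE.
Qed.
End RestrictionModule.

Arguments mx_map {k R S grR grS J} rho {M N} f v.

Section Adjunction.
Variables (k : fieldType) (R S : algType k) (grR : nat -> R -> Prop).
Variables (grS : nat -> S -> Prop) (J : finType).
Variables (alpha : mx_rep grR grS J) (gamma : mx_rep grS grR J).

(** With r b_j = sum_l b_l alpha_{lj}(r) and b_j s = sum_l gamma_{jl}(s) b_l in B, the identities
    result from expanding r b_j, or b_j s, on one side of the basis, then on the other, and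
    comparing coefficients. They play the role of unit and counit. *)
Definition mx_adjoint : Prop :=
  (forall q j r, \sum_l gamma l q (alpha l j r) = if q == j then r else 0) /\
  (forall q j s, \sum_l alpha q l (gamma j l s) = if q == j then s else 0).

Hypothesis adj : mx_adjoint.

Definition mx_inj (P : lmodType S) (j : J) (p : P) : mxmod alpha P :=
  [ffun l => if l == j then p else 0].

Lemma mx_injD (P : lmodType S) j (p q : P) : mx_inj j (p + q) = mx_inj j p + mx_inj j q.
Proof.
by apply/ffunP => l; rewrite mxmodD !ffunE; case: eqP => // _; rewrite addr0.
Qed.

(** The second identity of [mx_adjoint] trades a scalar of S inside for scalars of R outside.
    Consequently, for an R-linear [f], the map sending p to the tuple of all [f (mx_inj j p)] is
    S-linear into N^J. *)
Lemma mx_injZ (P : lmodType S) j s (p : P) :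
  mx_inj j (s *: p) = \sum_l gamma j l s *: mx_inj l p.
Proof.
apply/ffunP => q; rewrite mxmod_sumE !ffunE.
transitivity (\sum_l alpha q l (gamma j l s) *: p).
  by rewrite -scaler_suml adj.2; case: eqP => // _; rewrite scale0r.
apply: eq_bigr => l _; rewrite mxmodZ (bigD1 l) //= ffunE eqxx big1 ?addr0 // => i.
by rewrite ffunE => /negPf->; rewrite scaler0.
Qed.

Lemma mx_inj_sum (P : lmodType S) (v : mxmod alpha P) : v = \sum_j mx_inj j (v j).
Proof.
apply/ffunP => l; rewrite mxmod_sumE (bigD1 l) //= ffunE eqxx big1 ?addr0 // => j.
by rewrite eq_sym ffunE => /negPf->.
Qed.

Lemma mx_inj_gr (P : gmod grS) j d (p : P) :
  gmod_gr d p -> mxmod_gr (N := P) d (mx_inj j p).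
Proof.
move=> hp l; rewrite ffunE; case: eqP => // _.
exact: grading0 (gmod_grading (gmodP P)) d.
Qed.

(* Hom_R(P^J, N) = Hom_S(P, N^J), and N |-> N^J is exact. *)
Lemma mx_gmod_projective (P : gmod grS) : projective P -> projective (mx_gmod alpha P).
Proof.
move=> Pp M N p f hp ps hf.
have gM := gmod_grading (gmodP M).
pose fh (x : P) : mx_gmod gamma N := [ffun j => f (mx_inj j x)] : mxmod gamma N.
have lfh : linear fh.
  move=> s x y; apply/ffunP => j; rewrite mxmodD mxmodZ !ffunE mx_injD raddfD.
  congr (_ + _); rewrite mx_injZ raddf_sum; apply: eq_bigr => l _.
  by rewrite /= linearZ ffunE.
have [|||g [hg eg]] := Pp _ _ (mx_map gamma p) (linear_map lfh).
- exact: mx_map_homog.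
- exact: mx_map_surj.
- by move=> d x hx j; rewrite ffunE; apply: hf; exact: mx_inj_gr.
(* The inverse direction of the adjunction; its R-linearity is the first identity of
   [mx_adjoint]. *)
pose G (v : mx_gmod alpha P) : M := \sum_l g (v l) l.
have lG : linear G.
  move=> r x y; rewrite /G scaler_sumr.
  under eq_bigr => l _ do rewrite mxmodD mxmodZ raddfD mxmodD raddf_sum mxmod_sumE.
  rewrite big_split; congr (_ + _) => /=.
  under eq_bigr => l _.
    under eq_bigr => j _ do rewrite linearZ /= mxmodZ.
    over.
  rewrite exchange_big; apply: eq_bigr => j _ /=.
  rewrite exchange_big (bigD1 j) //= [X in _ + X]big1 ?addr0 => [|q /negPf qj].
    by rewrite -scaler_suml adj.1 eqxx.
  by rewrite -scaler_suml adj.1 qj scale0r.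
exists (linear_map lG); split=> [d x hx|x] /=.
  rewrite addr0; apply: (grading_sum_closed gM) => l _ _.
  by have := hg _ _ (hx l) l; rewrite addr0.
rewrite /G raddf_sum [in RHS](mx_inj_sum x) raddf_sum; apply: eq_bigr => l _ /=.
by have /ffunP/(_ l) := eg (x l); rewrite mx_mapE ffunE.
Qed.

Definition mx_resolution (M : gmod grS) (P : resolution M) : resolution (mx_gmod alpha M).
Proof.
apply: (@Resolution _ _ _ (mx_gmod alpha M) (fun n => mx_gmod alpha (P n))
  (fun n => mx_map alpha (res_d P n)) (mx_map alpha (res_aug P))).
- by move=> n; apply: mx_gmod_projective; exact: res_projective.
- by move=> n; apply: mx_map_homog; exact: res_d_homog.
- by apply: mx_map_homog; exact: res_aug_homog.
- by apply: mx_map_surj; exact: res_aug_surj.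
- by move=> x; exact: mx_map_exact (@res_aug_exact _ _ _ _ P) x.
- by move=> n x; exact: mx_map_exact (@res_exact _ _ _ _ P n) x.
Defined.

Variables (hR : connected_graded grR) (hS : connected_graded grS).

Lemma mx_rep_scalar (A B : algType k) (grA : nat -> A -> Prop) (grB : nat -> B -> Prop)
  (r : mx_rep grA grB J) i j (c : k) : r i j c%:A = if i == j then c%:A else 0.
Proof. by rewrite linearZ /= mx_rep1; case: eqP => //= _; rewrite scaler0. Qed.

(** Modulo positive degrees a representation is the identity matrix: scalars go to scalar matrices
    and positive degrees to positive degrees. Hence k^J, restricted along it, is a direct sum of
    copies of k. *)
Lemma mx_rep_augmentation (A B : algType k) (grA : nat -> A -> Prop) (grB : nat -> B -> Prop)
  (r : mx_rep grA grB J) (hA : connected_graded grA) (hB : connected_graded grB) i j a :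
  augmentation hB (r i j a) = if i == j then augmentation hA a else 0.
Proof.
elim/(connected_ind hA): a => [|x y hx hy|c|n a n0 ha].
- by rewrite raddf0 !augmentation0 if_same.
- by rewrite raddfD !augmentationD hx hy; case: eqP => // _; rewrite addr0.
- rewrite mx_rep_scalar augmentation_scalar; case: eqP => _.
    exact: augmentation_scalar.
  exact: augmentation0.
- rewrite (augmentation_homog _ n0 ha) if_same.
  by rewrite (augmentation_homog _ n0 (mx_rep_gr _ _ _ ha)).
Qed.

Lemma residueZ (A : algType k) (grA : nat -> A -> Prop) (hA : connected_graded grA) a
  (c : residue hA) : a *: c = (augmentation hA a * c : k).
Proof. by []. Qed.

Lemma mx_residueZ r (v : mx_gmod alpha (residue_gmod hS)) l :
  (r *: v) l = (augmentation hR r * v l : k) :> residue hS.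
Proof.
rewrite mxmodZ (bigD1 l) //= residueZ (mx_rep_augmentation _ hR) eqxx.
rewrite big1 ?addr0 // => j /negPf jl.
by rewrite residueZ (mx_rep_augmentation _ hR) eq_sym jl mul0r.
Qed.

(** The resolution [P] over S may be chosen, whereas [Q] over R is arbitrary; [ext_retract] bridges
    P^J and [Q], with k sitting in k^J as the coordinate [i0]. *)
Lemma ext_vanishes_transport (i0 : J) (i : nat) (d : int) :
  ext_vanishes (residue_gmod hS) (residue_gmod hS) i d ->
  ext_vanishes (residue_gmod hR) (residue_gmod hR) i d.
Proof.
move=> hE Q; have [P] := resolution_ex hS (residue_gmod hS).
have liota : linear (fun c : residue hR => mx_inj i0 (c : residue hS) :
    mx_gmod alpha (residue_gmod hS)).
  move=> a x y; apply/ffunP => l; rewrite mxmodD mx_residueZ !ffunE.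
  by case: eqP => // _; rewrite mulr0 addr0.
have lpi : linear (fun v : mx_gmod alpha (residue_gmod hS) => v i0 : residue_gmod hR).
  by move=> a x y; rewrite mxmodD mx_residueZ.
apply: (@ext_retract _ _ _ (residue_gmod hR) (mx_gmod alpha (residue_gmod hS))
  (residue_gmod hR) Q (mx_resolution P) (linear_map liota) (linear_map lpi) i d) => /=.
- by move=> e x hx; rewrite addr0; apply: (mx_inj_gr (P := residue_gmod hS)).
- by move=> e x hx; rewrite addr0; exact: hx.
- by move=> x; rewrite ffunE eqxx.
move=> f [hf cf].
(* The components of the adjunct of [f]: since S acts diagonally on k^J, each of them is S-linear
   separately. *)
have lfj j : linear (fun p : P i => f (mx_inj j p) : residue_gmod hS).
  move=> a x y; rewrite mx_injD raddfD; congr (_ + _).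
  rewrite mx_injZ raddf_sum (bigD1 j) //= linearZ /= residueZ.
  rewrite (mx_rep_augmentation gamma hS) eqxx big1 ?addr0 // => l /negPf lj.
  by rewrite linearZ /= residueZ (mx_rep_augmentation gamma hS) eq_sym lj mul0r.
have mdj n j (x : P n.+1) : mx_map alpha (res_d P n) (mx_inj j x) = mx_inj j (res_d P n x).
  apply/ffunP => l; rewrite mx_mapE !ffunE; case: eqP => // _; exact: raddf0.
have cj j : ext_cocycle d (linear_map (lfj j)).
  split=> [e x hx|x] /=.
    by apply: hf; exact: mx_inj_gr.
  by rewrite -mdj; exact: cf.
have {hE} {}cj := fun j => hE P _ (cj j).
case: i f lfj hf cf cj => [|i] f lfj hf cf /= cj.
  move=> x; rewrite (mx_inj_sum x) raddf_sum big1 // => j _; exact: cj.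
have [g hg] := choice cj.
(* The primitives of the components add up to one of [f]; R-linearity sees only the diagonal of
   [alpha], all other entries having augmentation 0. *)
have lG : linear (fun v : mx_gmod alpha (P i) => \sum_j g j (v j) : residue_gmod hR).
  move=> a x y; rewrite residueZ mulr_sumr -big_split; apply: eq_bigr => j _ /=.
  rewrite mxmodD mxmodZ raddfD raddf_sum; congr (_ + _).
  rewrite (bigD1 j) //= linearZ /= residueZ (mx_rep_augmentation alpha hR) eqxx.
  rewrite big1 ?addr0 // => l /negPf lj.
  by rewrite linearZ /= residueZ (mx_rep_augmentation alpha hR) eq_sym lj mul0r.
exists (linear_map lG); split=> [e x hx|x] /=.
  apply: (grading_sum_closed (gmod_grading (gmodP (residue_gmod hR)))) => j _ _.
  exact: (hg j).1 (hx j).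
rewrite {1}(mx_inj_sum x) raddf_sum; apply: eq_bigr => j _.
by rewrite mx_mapE; exact: (hg j).2.
Qed.

End Adjunction.

(** * Tensor algebras *)

(* As for [tens], formal combinations of words are identified when no linear
   map from V to an algebra separates them. *)
Section TensorAlgebra.
Local Open Scope quotient_scope.
Variables (k : fieldType) (V : lmodType k).

Definition word_eval (B : algType k) (f : V -> B) (s : seq (k * seq V)) : B :=
  \sum_(p <- s) p.1 *: \prod_(v <- p.2) f v.

Definition word_eq (s t : seq (k * seq V)) : bool :=
  `[< forall (B : algType k) (f : {linear V -> B}), word_eval f s = word_eval f t >].

Lemma word_eq_equiv : equiv_class_of word_eq.
Proof.
split=> [s|s t|t s r]; first exact/asboolP.
- by apply/asboolP/asboolP => H B f; rewrite H.
- by move=> /asboolP H1 /asboolP H2; apply/asboolP => B f; rewrite H1 H2.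
Qed.

Canonical word_equiv_rel := EquivRelPack word_eq_equiv.

Definition tensor_alg : Type := {eq_quot word_equiv_rel}.

HB.instance Definition _ := Choice.on tensor_alg.
HB.instance Definition _ := EqQuotient.on tensor_alg.

Local Notation TA := tensor_alg.

Definition ta_lift (B : algType k) (f : V -> B) (x : TA) : B := word_eval f (repr x).

Lemma ta_lift_pi (B : algType k) (f : {linear V -> B}) s :
  ta_lift f (\pi_TA s) = word_eval f s.
Proof.
have : \pi_TA (repr (\pi_TA s)) = \pi_TA s by rewrite reprK.
by move=> /eqP; rewrite piE => /asboolP h; exact: h.
Qed.

Lemma ta_sep (x y : TA) :
  (forall (B : algType k) (f : {linear V -> B}), ta_lift f x = ta_lift f y) -> x = y.
Proof.
by move=> H; rewrite -[x]reprK -[y]reprK; apply/eqP; rewrite piE; apply/asboolP.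
Qed.

Definition ta_add (x y : TA) : TA := \pi_TA (repr x ++ repr y).
Definition ta_scale (c : k) (x : TA) : TA := \pi_TA [seq (c * p.1, p.2) | p <- repr x].
Definition ta_mul (x y : TA) : TA :=
  \pi_TA [seq (p.1 * q.1, p.2 ++ q.2) | p <- repr x, q <- repr y].
Definition ta_one : TA := \pi_TA [:: (1, [::])].
Definition ta_zero : TA := \pi_TA [::].

Section Eval.
Variables (B : algType k) (f : {linear V -> B}).

Lemma ta_lift_add x y : ta_lift f (ta_add x y) = ta_lift f x + ta_lift f y.
Proof. by rewrite ta_lift_pi /word_eval big_cat. Qed.
Lemma ta_lift_scale c x : ta_lift f (ta_scale c x) = c *: ta_lift f x.
Proof.
rewrite ta_lift_pi /ta_lift /word_eval big_map scaler_sumr.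
by apply: eq_bigr => p _; rewrite scalerA.
Qed.
Lemma ta_lift_zero : ta_lift f ta_zero = 0.
Proof. by rewrite ta_lift_pi /word_eval big_nil. Qed.
Lemma ta_lift_one : ta_lift f ta_one = 1.
Proof. by rewrite ta_lift_pi /word_eval big_seq1 big_nil scale1r. Qed.
Lemma ta_lift_mul x y : ta_lift f (ta_mul x y) = ta_lift f x * ta_lift f y.
Proof.
rewrite ta_lift_pi /ta_lift /word_eval big_allpairs_dep mulr_suml.
apply: eq_bigr => p _; rewrite mulr_sumr; apply: eq_bigr => q _ /=.
by rewrite big_cat /= -scalerAl -scalerAr scalerA.
Qed.

Definition ta_liftE :=
  (ta_lift_add, ta_lift_scale, ta_lift_zero, ta_lift_one, ta_lift_mul).
End Eval.

Fact ta_addA : associative ta_add.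
Proof. by move=> x y z; apply: ta_sep => B f; rewrite !ta_liftE addrA. Qed.
Fact ta_addC : commutative ta_add.
Proof. by move=> x y; apply: ta_sep => B f; rewrite !ta_liftE addrC. Qed.
Fact ta_add0 : left_id ta_zero ta_add.
Proof. by move=> x; apply: ta_sep => B f; rewrite !ta_liftE add0r. Qed.
Fact ta_addN : left_inverse ta_zero (ta_scale (-1)) ta_add.
Proof. by move=> x; apply: ta_sep => B f; rewrite !ta_liftE scaleN1r addNr. Qed.

HB.instance Definition _ := GRing.isZmodule.Build TA ta_addA ta_addC ta_add0 ta_addN.

Fact ta_mulA : associative ta_mul.
Proof. by move=> x y z; apply: ta_sep => B f; rewrite !ta_liftE mulrA. Qed.
Fact ta_mul1l : left_id ta_one ta_mul.
Proof. by move=> x; apply: ta_sep => B f; rewrite !ta_liftE mul1r. Qed.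
Fact ta_mul1r : right_id ta_one ta_mul.
Proof. by move=> x; apply: ta_sep => B f; rewrite !ta_liftE mulr1. Qed.
Fact ta_mulDl : left_distributive ta_mul +%R.
Proof. by move=> x y z; apply: ta_sep => B f; rewrite !ta_liftE mulrDl. Qed.
Fact ta_mulDr : right_distributive ta_mul +%R.
Proof. by move=> x y z; apply: ta_sep => B f; rewrite !ta_liftE mulrDr. Qed.
Fact ta_one_neq0 : ta_one != 0.
Proof.
(* Sending all of V to 0 in k separates 1 from 0. *)
apply/eqP => /(congr1 (ta_lift (\0 : V -> k^o))).
by rewrite [LHS]ta_lift_one [RHS]ta_lift_zero => /eqP; rewrite oner_eq0.
Qed.

HB.instance Definition _ := GRing.Zmodule_isNzRing.Build TA
  ta_mulA ta_mul1l ta_mul1r ta_mulDl ta_mulDr ta_one_neq0.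

Fact ta_scaleA a b x : ta_scale a (ta_scale b x) = ta_scale (a * b) x.
Proof. by apply: ta_sep => B f; rewrite !ta_liftE scalerA. Qed.
Fact ta_scale1 : left_id 1 ta_scale.
Proof. by move=> x; apply: ta_sep => B f; rewrite !ta_liftE scale1r. Qed.
Fact ta_scaleDr : right_distributive ta_scale +%R.
Proof. by move=> a x y; apply: ta_sep => B f; rewrite !ta_liftE scalerDr. Qed.
Fact ta_scaleDl x : {morph ta_scale^~ x : a b / a + b}.
Proof. by move=> a b; apply: ta_sep => B f; rewrite !ta_liftE scalerDl. Qed.

HB.instance Definition _ := GRing.Zmodule_isLmodule.Build k TA
  ta_scaleA ta_scale1 ta_scaleDr ta_scaleDl.

Fact ta_scaleAl (c : k) (x y : TA) : c *: (x * y) = (c *: x) * y.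
Proof. by apply: ta_sep => B f; rewrite !ta_liftE scalerAl. Qed.
Fact ta_scaleAr (c : k) (x y : TA) : c *: (x * y) = x * (c *: y).
Proof. by apply: ta_sep => B f; rewrite !ta_liftE scalerAr. Qed.

HB.instance Definition _ := GRing.Lmodule_isLalgebra.Build k TA ta_scaleAl.
HB.instance Definition _ := GRing.Lalgebra_isAlgebra.Build k TA ta_scaleAr.

Definition ta_gen (v : V) : TA := \pi_TA [:: (1, [:: v])].

Lemma ta_lift_gen (B : algType k) (f : {linear V -> B}) v : ta_lift f (ta_gen v) = f v.
Proof. by rewrite ta_lift_pi /word_eval big_seq1 big_seq1 scale1r. Qed.

Fact ta_gen_linear : linear ta_gen.
Proof.
move=> a x y; apply: ta_sep => B f.
by rewrite !ta_liftE !ta_lift_gen linearP.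
Qed.

HB.instance Definition _ := GRing.isLinear.Build k V TA *:%R ta_gen ta_gen_linear.

Section Lift.
Variables (B : algType k) (f : {linear V -> B}).

Fact ta_lift_linear : linear (ta_lift f).
Proof. by move=> a x y; rewrite !ta_liftE. Qed.
Fact ta_lift_monoid : monoid_morphism (ta_lift f).
Proof. by split=> [|x y]; rewrite !ta_liftE. Qed.

HB.instance Definition _ := GRing.isLinear.Build k TA B *:%R (ta_lift f) ta_lift_linear.
HB.instance Definition _ := GRing.isMonoidMorphism.Build TA B (ta_lift f) ta_lift_monoid.
End Lift.

Lemma ta_words (x : TA) :
  x = \sum_(p <- repr x) p.1 *: \prod_(v <- p.2) ta_gen v.
Proof.
apply: ta_sep => B f; rewrite [RHS](raddf_sum (ta_lift f)); apply: eq_bigr => p _.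
rewrite [RHS]linearZ_LR /= rmorph_prod; congr (_ *: _).
by apply: eq_bigr => v _; rewrite /= ta_lift_gen.
Qed.

Lemma ta_is_tensor_algebra : is_tensor_algebra ta_gen.
Proof.
move=> B f; exists (ta_lift f); split=> [v|g hg x]; first exact: ta_lift_gen.
rewrite (ta_words x) !raddf_sum; apply: eq_bigr => p _ /=.
rewrite !linearZ /= !rmorph_prod; congr (_ *: _).
by apply: eq_bigr => v _; rewrite /= hg /= ta_lift_gen.
Qed.

End TensorAlgebra.

Section TensorDegree.
Variables (k : fieldType) (V : lmodType k) (F : algType k) (iota : {linear V -> F}).

(** Peeling off the last letter matches the map A ⊗ A_1 -> A through which relations are studied.
    Different degrees are told apart after mapping to A, by its grading. *)
Fixpoint tdeg (n : nat) (x : F) : Prop :=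
  match n with
  | 0 => exists c : k, x = c%:A
  | n.+1 => exists s : seq (F * V),
      (forall p, p \in s -> tdeg n p.1) /\ x = \sum_(p <- s) p.1 * iota p.2
  end.

Lemma tdeg0 n : tdeg n 0.
Proof.
by case: n => [|n]; [exists 0; rewrite scale0r | exists [::]; rewrite big_nil].
Qed.

Lemma tdegD n x y : tdeg n x -> tdeg n y -> tdeg n (x + y).
Proof.
case: n => [[c ->] [d ->]|n [s [hs ->]] [t [ht ->]]]; first by exists (c + d); rewrite scalerDl.
by exists (s ++ t); rewrite big_cat; split=> // p; rewrite mem_cat => /orP[/hs|/ht].
Qed.

Lemma tdegZ n c x : tdeg n x -> tdeg n (c *: x).
Proof.
elim: n c x => [|n IH] c x [s]; first by move=> ->; exists (c * s); rewrite scalerA.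
move=> [hs ->]; exists [seq (c *: p.1, p.2) | p <- s]; split.
  by move=> q /mapP[p /hs hp ->] /=; exact: IH.
by rewrite big_map scaler_sumr; apply: eq_bigr => p _; rewrite scalerAl.
Qed.

Lemma tdeg_sum n (T : eqType) (s : seq T) (P : pred T) (G : T -> F) :
  (forall t, t \in s -> P t -> tdeg n (G t)) -> tdeg n (\sum_(t <- s | P t) G t).
Proof.
move=> h; rewrite big_seq_cond; elim/big_ind: _ => [|x y|t /andP[]].
- exact: tdeg0.
- exact: tdegD.
- exact: h.
Qed.

Lemma tdegS n x v : tdeg n x -> tdeg n.+1 (x * iota v).
Proof. by move=> hx; exists [:: (x, v)]; rewrite big_seq1; split=> // p; rewrite inE => /eqP->. Qed.

Lemma tdegM a b x y : tdeg a x -> tdeg b y -> tdeg (a + b) (x * y).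
Proof.
elim: b y => [|b IH] y hx [s].
  by move=> ->; rewrite addn0 -scalerAr mulr1; exact: tdegZ.
move=> [hs ->]; rewrite mulr_sumr; apply: tdeg_sum => p ps _.
by rewrite addnS mulrA; apply: tdegS; apply: IH => //; exact: hs.
Qed.

Lemma tdeg1 x : tdeg 1 x -> exists v, x = iota v.
Proof.
move=> [s [hs ->]]; elim: s hs => [|p s IH] hs.
  by exists 0; rewrite big_nil linear0.
have [v ev] : exists v, \sum_(q <- s) q.1 * iota q.2 = iota v.
  by apply: IH => q qs; apply: hs; rewrite inE qs orbT.
have [c ec] := hs p (mem_head _ _).
exists (c *: p.2 + v); rewrite big_cons ev linearP; congr (_ + _).
by rewrite ec -scalerAl mul1r.
Qed.

Lemma tdeg_word c (s : seq V) : tdeg (size s) (c *: \prod_(v <- s) iota v).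
Proof.
elim/last_ind: s => [|s v IH]; first by rewrite big_nil; exists c.
by rewrite size_rcons -cats1 big_cat big_seq1 /= scalerAl; exact: tdegS.
Qed.

Lemma tensor_power_tdeg n x : tensor_power iota n x -> tdeg n x.
Proof.
move=> [s ->]; apply: tdeg_sum => t _ _.
by have := tdeg_word 1 t; rewrite scale1r size_tuple.
Qed.

Lemma tensor_power0 n : tensor_power iota n 0.
Proof. by exists [::]; rewrite big_nil. Qed.

Lemma tensor_powerD n x y :
  tensor_power iota n x -> tensor_power iota n y -> tensor_power iota n (x + y).
Proof. by move=> [s ->] [t ->]; exists (s ++ t); rewrite big_cat. Qed.

Lemma tensor_powerS n x v : tensor_power iota n x -> tensor_power iota n.+1 (x * iota v).
Proof.
move=> [s ->]; exists [seq [tuple of rcons (val (t : n.-tuple V)) v] | t <- s].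
rewrite big_map mulr_suml; apply: eq_bigr => t _.
by rewrite /= -cats1 big_cat big_seq1.
Qed.

(* Degree zero is excluded: [tensor_power _ 0] only contains the multiples
   of 1 by natural numbers. *)
Lemma tdeg_tensor_power n x : tdeg n.+1 x -> tensor_power iota n.+1 x.
Proof.
elim: n x => [|n IH] x.
  move=> /tdeg1[v ->]; exists [:: [tuple v]].
  by rewrite big_seq1 big_seq1.
move=> [s [hs ->]]; rewrite big_seq; elim/big_ind: _ => [|y z|p ps].
- exact: tensor_power0.
- exact: tensor_powerD.
- by apply: tensor_powerS; apply: IH; exact: hs.
Qed.

Hypothesis hF : is_tensor_algebra iota.

(** By uniqueness in the universal property the composite F -> [tensor_alg] -> F is the identity,
    and in the middle term every element is visibly a combination of words. *)
Lemma tdeg_decomposable x : decomposable tdeg x.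
Proof.
have [g [hg _]] := hF (@ta_gen k V).
have [g' [hg' _]] := ta_is_tensor_algebra iota.
have [u [_ hu]] := hF iota.
have e : x = g' (g x).
  rewrite -[LHS]/((idfun : {lrmorphism F -> F}) x) -[RHS]/((g' \o g : {lrmorphism F -> F}) x).
  by rewrite !hu // => v; rewrite /= ?hg ?hg'.
rewrite e (ta_words (g x)) raddf_sum; apply: decomposable_sum => p _ /=.
apply: (decomposable_homog (i := size p.2)).
rewrite linearZ rmorph_prod; under eq_bigr => v _ do rewrite /= hg'.
exact: tdeg_word.
Qed.

End TensorDegree.

(** * Kernels of tensor products of linear maps *)

Lemma tens0l (k : fieldType) (U V : lmodType k) (v : V) : (0 : U) ⊗ v = 0.
Proof. by rewrite -(scale0r 0) tensZl scale0r. Qed.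

Lemma tens0r (k : fieldType) (U V : lmodType k) (u : U) : u ⊗ (0 : V) = 0.
Proof. by rewrite -(scale0r 0) tensZr scale0r. Qed.

Lemma tens_suml (k : fieldType) (U V : lmodType k) (T : Type) (s : seq T) (P : pred T)
  (F : T -> U) (v : V) : (\sum_(t <- s | P t) F t) ⊗ v = \sum_(t <- s | P t) F t ⊗ v.
Proof.
rewrite (big_morph (fun x => x ⊗ v) (id1 := 0) (op1 := +%R)) //; last exact: tens0l.
by move=> x y; rewrite tensDl.
Qed.

Lemma tens_sumr (k : fieldType) (U V : lmodType k) (T : Type) (s : seq T) (P : pred T)
  (u : U) (F : T -> V) : u ⊗ (\sum_(t <- s | P t) F t) = \sum_(t <- s | P t) u ⊗ F t.
Proof.
rewrite (big_morph (fun x => u ⊗ x) (id1 := 0) (op1 := +%R)) //; last exact: tens0r.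
by move=> x y; rewrite tensDr.
Qed.

Section TensorKernel.
Variables (k : fieldType) (U U' V V' : lmodType k) (f : {linear U -> U'}) (g : {linear V -> V'}).
Hypothesis g_inj : injective g.
Variable G : U -> Prop.
Hypothesis GD : forall x y, G x -> G y -> G (x + y).
Hypothesis GZ : forall c x, G x -> G (c *: x).

(** For injective [g] the kernel of f ⊗ g is ker f ⊗ V; the form here keeps the first factors inside
    the subspace [G]. Induction on the length: one term is moved into ker f ⊗ V by subtracting
    multiples of its second factor [v] from the others. *)
Lemma tens_kernel (s : seq (U * V)) :
  (forall p, p \in s -> G p.1) -> \sum_(p <- s) f p.1 ⊗ g p.2 = 0 ->
  exists t : seq (U * V), (forall p, p \in t -> G p.1 /\ f p.1 = 0) /\
    \sum_(p <- s) p.1 ⊗ p.2 = \sum_(p <- t) p.1 ⊗ p.2.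
Proof.
have [n] := ubnP (size s); elim: n s => // n IH [|[u v] s] /= sn hs.
  by exists [::].
have hs' p : p \in s -> G p.1 by move=> ps; apply: hs; rewrite inE ps orbT.
have hu : G u := hs _ (mem_head _ _).
rewrite !big_cons /=; have [->|v0] := eqVneq v 0.
  by rewrite linear0 !tens0r !add0r; exact: IH.
have [mu [lmu muv]] : exists mu : V' -> k^o, linear mu /\ mu (g v) = 1.
  by apply: linear_form_ex; rewrite -(linear0 g) (inj_eq g_inj).
pose ml : {linear V' -> k^o} := HB.pack mu (GRing.isLinear.Build _ _ _ _ mu lmu).
(* Collecting all multiples of [v] gives it the coefficient [z]; applying x ⊗ y |-> mu(y) x to the
   vanishing sum yields f z = 0. *)
move=> e; pose z := u + \sum_(p <- s) (mu (g p.2) : k) *: p.1.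
pose s' := [seq (p.1, p.2 - (mu (g p.2) : k) *: v) | p <- s].
have fz : f z = 0.
  have bm : bilin (fun (x : U') (y : V') => (mu y : k) *: x).
    split=> [y|x] a x1 x2; first by rewrite scalerDr !scalerA mulrC.
    by rewrite lmu scalerDl scalerA.
  have := congr1 (linear_map (lift_linear bm)) e.
  rewrite raddf0 raddfD raddf_sum /= lift_tens // muv scale1r => <-.
  rewrite raddfD raddf_sum; congr (_ + _); apply: eq_bigr => p _.
  by rewrite /= lift_tens // linearZ.
have shift (W W' : lmodType k) (a : U -> W) (b : V -> W') : linear a -> linear b ->
    a u ⊗ b v + \sum_(p <- s) a p.1 ⊗ b p.2 = a z ⊗ b v + \sum_(p <- s') a p.1 ⊗ b p.2.
  move=> la lb; pose a' := linear_map la; pose b' := linear_map lb.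
  rewrite -![a _]/(a' _) -![b _]/(b' _) raddfD raddf_sum tensDl -addrA; congr (_ + _).
  rewrite big_map tens_suml -big_split; apply: eq_bigr => p _.
  have -> : b (p.2 - (mu (g p.2) : k) *: v) = b' p.2 - (mu (g p.2) : k) *: b' v.
    by rewrite -[LHS]/(b' _) linearB linearZ_LR.
  rewrite /=; have -> : a ((mu (g p.2) : k) *: p.1) = (mu (g p.2) : k) *: a p.1.
    by rewrite -[LHS]/(a' _) linearZ_LR.
  by rewrite tensDr -scaleN1r !(tensZl, tensZr) scalerA mulN1r scaleNr addrCA subrr addr0.
have [|||t [ht et]] := IH s'.
- by rewrite size_map.
- by move=> q /mapP[p ps ->]; exact: (hs' _ ps).
- have := shift _ _ f g (linearP f) (linearP g); rewrite e fz.
  by rewrite tens0l add0r => <-.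
exists ((z, v) :: t); split.
  move=> q; rewrite inE => /orP[/eqP->|/ht] //=; split=> //; apply: GD => //.
  rewrite big_seq; elim/big_ind: _ => [|x y|p ps].
  - by rewrite -(scale0r u); exact: GZ.
  - exact: GD.
  - by apply: GZ; exact: hs'.
have lid (W : lmodType k) : linear (idfun : W -> W) by [].
by rewrite big_cons -et; exact: (shift _ _ idfun idfun (lid _) (lid _)).
Qed.

End TensorKernel.

(** * Generators and syzygies *)

Section Presentation.
Variables (k : fieldType) (A : algType k) (gr : nat -> A -> Prop).

(** Over a field A_n ⊗ A_1 embeds into A ⊗ A, so the syzygies of A ⊗ A_1 -> A are handled without a
    separate type for A_1. *)
Definition tens_gr (n : nat) (x : A ⊗ A) : Prop :=
  exists s : seq (A * A),
    (forall p, p \in s -> gr n p.1 /\ gr 1%N p.2) /\ x = \sum_(p <- s) p.1 ⊗ p.2.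

Definition generated_in_degree1 : Prop :=
  forall n a, gr n.+1 a -> exists x, tens_gr n x /\ mulmap x = a.

Definition syzygy_span (m : nat) (x : A ⊗ A) : Prop :=
  exists s : seq (A * (A ⊗ A)),
    (forall p, p \in s -> tens_gr m.-1 p.2 /\ mulmap p.2 = 0) /\
    x = \sum_(p <- s) (p.1 ⊗ 1) * p.2.

Definition syzygies_in_degree (m : nat) : Prop :=
  forall n x, tens_gr n x -> mulmap x = 0 -> syzygy_span m x.

Lemma mulmapE (a b : A) : mulmap (a ⊗ b) = a * b.
Proof. exact: (lift_tens _ _ (@mul_bilin k A)). Qed.

Lemma tens_gr0 n : tens_gr n 0.
Proof. by exists [::]; rewrite big_nil. Qed.

Lemma tens_grD n x y : tens_gr n x -> tens_gr n y -> tens_gr n (x + y).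
Proof.
move=> [s [hs ->]] [t [ht ->]]; exists (s ++ t); rewrite big_cat; split=> // p.
by rewrite mem_cat => /orP[/hs|/ht].
Qed.

Lemma tens_gr_pure n a b : gr n a -> gr 1%N b -> tens_gr n (a ⊗ b).
Proof.
move=> ha hb; exists [:: (a, b)]; rewrite big_seq1; split=> // p.
by rewrite inE => /eqP->.
Qed.

Lemma tens_gr_sum n (T : eqType) (s : seq T) (F : T -> A ⊗ A) :
  (forall t, t \in s -> tens_gr n (F t)) -> tens_gr n (\sum_(t <- s) F t).
Proof.
move=> h; rewrite big_seq; elim/big_ind: _ => [|x y|t /h //].
- exact: tens_gr0.
- exact: tens_grD.
Qed.

Lemma syzygy_span0 m : syzygy_span m 0.
Proof. by exists [::]; rewrite big_nil. Qed.

Lemma syzygy_spanD m x y : syzygy_span m x -> syzygy_span m y -> syzygy_span m (x + y).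
Proof.
move=> [s [hs ->]] [t [ht ->]]; exists (s ++ t); rewrite big_cat; split=> // p.
by rewrite mem_cat => /orP[/hs|/ht].
Qed.

Lemma syzygy_span_mul m a x :
  tens_gr m.-1 x -> mulmap x = 0 -> syzygy_span m ((a ⊗ 1) * x).
Proof.
move=> hx hx0; exists [:: (a, x)]; rewrite big_seq1; split=> // p.
by rewrite inE => /eqP->.
Qed.

Lemma syzygy_span_sum m (T : eqType) (s : seq T) (F : T -> A ⊗ A) :
  (forall t, t \in s -> syzygy_span m (F t)) -> syzygy_span m (\sum_(t <- s) F t).
Proof.
move=> h; rewrite big_seq; elim/big_ind: _ => [|x y|t /h //].
- exact: syzygy_span0.
- exact: syzygy_spanD.
Qed.

End Presentation.

(** * Transport of generators and syzygies *)

Section TensRep.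
Variables (k : fieldType) (R S : algType k) (grR : nat -> R -> Prop).
Variables (grS : nat -> S -> Prop) (J : finType) (rho : mx_rep grR grS J).

(** The entries of R ⊗ R -> M_J(S) ⊗ M_J(S) -> M_J(S ⊗ S), the second map being the matrix product
    with ⊗ in place of multiplication of entries. *)
Definition tens_rep (i j : J) (x : R ⊗ R) : S ⊗ S := \sum_q tmap (rho i q) (rho q j) x.

Fact tens_rep_linear i j : linear (tens_rep i j).
Proof.
move=> a x y; rewrite /tens_rep scaler_sumr -big_split.
by apply: eq_bigr => q _; rewrite linearP.
Qed.

HB.instance Definition _ i j :=
  GRing.isLinear.Build k (R ⊗ R)%type (S ⊗ S)%type *:%R (tens_rep i j) (tens_rep_linear i j).

Lemma tens_repE i j a b : tens_rep i j (a ⊗ b) = \sum_q rho i q a ⊗ rho q j b.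
Proof. by apply: eq_bigr => q _; rewrite tmapE. Qed.

Lemma mulmap_tens_rep i j x : mulmap (tens_rep i j x) = rho i j (mulmap x).
Proof.
elim/tens_ind: x => [|a b x IH]; first by rewrite !raddf0.
rewrite !raddfD /= IH mulmapE mx_repM tens_repE raddf_sum; congr (_ + _).
by apply: eq_bigr => q _; rewrite /= mulmapE.
Qed.

Lemma tens_repMl i j a x :
  tens_rep i j ((a ⊗ 1) * x) = \sum_q (rho i q a ⊗ 1) * tens_rep q j x.
Proof.
elim/tens_ind: x => [|b c x IH].
  by rewrite mulr0 raddf0 big1 // => q _; rewrite raddf0 mulr0.
rewrite mulrDr raddfD /= IH.
under [RHS]eq_bigr => q _ do rewrite raddfD /= mulrDr.
rewrite big_split /=; congr (_ + _); rewrite tens_mulE mul1r tens_repE.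
under [RHS]eq_bigr => q _ do rewrite tens_repE mulr_sumr.
rewrite exchange_big; apply: eq_bigr => p _ /=.
rewrite mx_repM tens_suml.
by apply: eq_bigr => q _; rewrite tens_mulE mul1r.
Qed.

Lemma tens_rep_gr i j n x : tens_gr grR n x -> tens_gr grS n (tens_rep i j x).
Proof.
move=> [s [hs ->]]; rewrite raddf_sum; apply: tens_gr_sum => p /hs[h1 h2] /=.
rewrite tens_repE; apply: tens_gr_sum => q _.
by apply: tens_gr_pure; exact: mx_rep_gr.
Qed.

End TensRep.

Section Transport.
Variables (k : fieldType) (R S : algType k) (grR : nat -> R -> Prop).
Variables (grS : nat -> S -> Prop) (J : finType).
Variables (alpha : mx_rep grR grS J) (gamma : mx_rep grS grR J).
Hypothesis adj : mx_adjoint alpha gamma.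
Variable i0 : J.

(** On a ⊗ b the sum over [l] of the first factors gives a times a Kronecker delta on the two inner
    indices; the remaining sum over their common value gives b. Both are the first identity of
    [mx_adjoint]. *)
Lemma tens_repK x : x = \sum_l tens_rep gamma l i0 (tens_rep alpha l i0 x).
Proof.
elim/tens_ind: x => [|a b x IH].
  by rewrite big1 // => l _; rewrite !raddf0.
rewrite {1}IH; under [RHS]eq_bigr => l _ do rewrite !raddfD /=.
rewrite big_split; congr (_ + _) => /=.
transitivity (\sum_q \sum_p \sum_l gamma l p (alpha l q a) ⊗ gamma p i0 (alpha q i0 b)).
  transitivity (\sum_q a ⊗ gamma q i0 (alpha q i0 b)).
    by rewrite -tens_sumr adj.1 eqxx.
  apply: eq_bigr => q _; rewrite (bigD1 q) //= -tens_suml adj.1 eqxx.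
  rewrite big1 ?addr0 // => p /negPf pq.
  by rewrite -tens_suml adj.1 pq tens0l.
rewrite exchange_big /=.
under eq_bigr => p _ do rewrite exchange_big /=.
rewrite exchange_big /=; apply: eq_bigr => l _.
rewrite tens_repE raddf_sum exchange_big; apply: eq_bigr => q _ /=.
by rewrite tens_repE.
Qed.

Lemma generated_in_degree1_transport :
  generated_in_degree1 grS -> generated_in_degree1 grR.
Proof.
move=> hS n r hr.
have /choice[x hx] l := hS n (alpha l i0 r) (mx_rep_gr _ _ _ hr).
exists (\sum_l tens_rep gamma l i0 (x l)); split.
  by apply: tens_gr_sum => l _; apply: tens_rep_gr; exact: (hx l).1.
rewrite raddf_sum; under eq_bigr => l _ do rewrite /= mulmap_tens_rep (hx l).2.
by rewrite adj.1 eqxx.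
Qed.

(** The entries of [alpha] send a syzygy over R to syzygies over S, which are decomposed there; the
    entries of [gamma] bring the pieces back, [tens_repMl] preserving their shape and [tens_repK]
    their sum. *)
Lemma syzygies_in_degree_transport m :
  syzygies_in_degree grS m -> syzygies_in_degree grR m.
Proof.
move=> hS n x hx x0; rewrite (tens_repK x); apply: syzygy_span_sum => l _.
have [|s [hs ->]] := hS n _ (tens_rep_gr alpha l i0 hx).
  by rewrite mulmap_tens_rep x0 raddf0.
rewrite raddf_sum; apply: syzygy_span_sum => p /hs[h1 h2] /=.
rewrite tens_repMl; apply: syzygy_span_sum => q _; apply: syzygy_span_mul.
  exact: tens_rep_gr.
by rewrite mulmap_tens_rep h2 raddf0.
Qed.

End Transport.

(* The k-algebra structure is the one through the scalars of U, U being possibly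
   noncommutative. *)
Section Matrix2.
Variables (k : fieldType) (U : algType k).

Definition mx2 : Type := 'M[U]_2.

HB.instance Definition _ := GRing.NzRing.on mx2.

Definition mx2_scale (c : k) (x : mx2) : mx2 := \matrix_(i, j) (c *: (x : 'M_2) i j).

Fact mx2_scaleA a b x : mx2_scale a (mx2_scale b x) = mx2_scale (a * b) x.
Proof. by apply/matrixP => i j; rewrite !mxE scalerA. Qed.
Fact mx2_scale1 : left_id 1 mx2_scale.
Proof. by move=> x; apply/matrixP => i j; rewrite !mxE scale1r. Qed.
Fact mx2_scaleDr : right_distributive mx2_scale +%R.
Proof. by move=> a x y; apply/matrixP => i j; rewrite !mxE scalerDr. Qed.
Fact mx2_scaleDl x : {morph mx2_scale^~ x : a b / a + b}.
Proof. by move=> a b; apply/matrixP => i j; rewrite !mxE scalerDl. Qed.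

HB.instance Definition _ := GRing.Zmodule_isLmodule.Build k mx2
  mx2_scaleA mx2_scale1 mx2_scaleDr mx2_scaleDl.

Fact mx2_scaleAl (c : k) (x y : mx2) : c *: (x * y) = (c *: x) * y.
Proof.
apply/matrixP => i j; rewrite !mxE scaler_sumr; apply: eq_bigr => q _.
by rewrite !mxE scalerAl.
Qed.
Fact mx2_scaleAr (c : k) (x y : mx2) : c *: (x * y) = x * (c *: y).
Proof.
apply/matrixP => i j; rewrite !mxE scaler_sumr; apply: eq_bigr => q _.
by rewrite !mxE scalerAr.
Qed.

HB.instance Definition _ := GRing.Lmodule_isLalgebra.Build k mx2 mx2_scaleAl.
HB.instance Definition _ := GRing.Lalgebra_isAlgebra.Build k mx2 mx2_scaleAr.

End Matrix2.

(** * Relations in one degree versus syzygies in one degree *)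

Section Homogeneous.
Variables (k : fieldType) (A : algType k) (gr : nat -> A -> Prop).
Hypothesis h : connected_graded gr.

Section Forward.
Variables (V : lmodType k) (TV : algType k) (iota : {linear V -> TV}) (pi : {lrmorphism TV -> A}).
Hypothesis hTV : is_tensor_algebra iota.
Hypothesis pi_gr : forall v, gr 1%N (pi (iota v)).

Lemma tdeg_gr n x : tdeg iota n x -> gr n (pi x).
Proof.
elim: n x => [|n IH] x [s]; first by move=> ->; rewrite linearZ /= rmorph1; exact: cgr_scalar.
move=> [hs ->]; rewrite raddf_sum; apply: (grading_sum_closed (cgr_grading h)) => p /hs hp _ /=.
by rewrite rmorphM -[n.+1]addn1; apply: (cgr_mul h); [exact: IH | exact: pi_gr].
Qed.

Hypothesis pi_surj : forall a, exists x, pi x = a.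

(** Any preimage will do once only its terms of degree [n] are kept: the others land in other
    degrees of A, while [a] is its own component of degree [n]. *)
Lemma tdeg_lift n a : gr n a -> exists x, tdeg iota n x /\ pi x = a.
Proof.
move=> ha; have [x ex] := pi_surj a; have [s [hs e]] := tdeg_decomposable hTV x.
exists (\sum_(p <- s | p.1 == n) p.2); split.
  by apply: tdeg_sum => p /hs hp /eqP<-.
have := gproj_homog (cgr_grading h) n ha; rewrite eqxx -{1}ex e => <-.
rewrite !raddf_sum big_mkcond big_seq [RHS]big_seq; apply: eq_bigr => p /hs hp /=.
by rewrite (gproj_homog _ n (tdeg_gr hp)) eq_sym; case: eqP => // _; rewrite raddf0.
Qed.

Lemma homogeneous_generated : generated_in_degree1 gr.
Proof.
move=> n a /tdeg_lift[x [[s [hs ->]] <-]].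
exists (\sum_(p <- s) pi p.1 ⊗ pi (iota p.2)); split.
  by apply: tens_gr_sum => p /hs hp; apply: tens_gr_pure => //; exact: tdeg_gr.
by rewrite !raddf_sum; apply: eq_bigr => p _ /=; rewrite mulmapE rmorphM.
Qed.

(* The corner entry D of the morphism TV -> M_2(A ⊗ A) sending v to
   [[pi v ⊗ 1, 1 ⊗ pi v], [0, 0]] is a Fox derivative:
   D (x y) = pi x D y + D x eps y. *)
Lemma fox_derivative : exists g : {lrmorphism TV -> mx2 (A ⊗ A)%type},
  [/\ forall x, (g x : 'M_2) 0 0 = pi x ⊗ 1,
      forall x, (g x : 'M_2) 1 0 = 0,
      forall x, exists c : k, (g x : 'M_2) 1 1 = c%:A,
      forall n x, tdeg iota n.+1 x -> (g x : 'M_2) 1 1 = 0 &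
      forall x v, (g (x * iota v) : 'M_2) 0 1 = pi x ⊗ pi (iota v)].
Proof.
pose f0 (v : V) : mx2 (A ⊗ A)%type :=
  \matrix_(i, j) (if i == 0 then if j == 0 then pi (iota v) ⊗ 1 else 1 ⊗ pi (iota v) else 0).
have lf : linear f0.
  move=> c x y; apply/matrixP => i j; rewrite !mxE.
  by case: eqP => _; [case: eqP => _; rewrite !linearP !tensE | rewrite scaler0 addr0].
have [g [hg _]] := hTV (linear_map lf).
exists g.
have gM x y i j : (g (x * y) : 'M_2) i j =
    (g x : 'M_2) i 0 * (g y : 'M_2) 0 j + (g x : 'M_2) i 1 * (g y : 'M_2) 1 j.
  rewrite rmorphM mxE big_ord_recl big_ord1.
  by have -> : fintype.lift ord0 ord0 = 1 :> 'I_2 by apply: val_inj.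
have gD x y i j : (g (x + y) : 'M_2) i j = (g x : 'M_2) i j + (g y : 'M_2) i j.
  by rewrite rmorphD mxE.
have gZ c x i j : (g (c *: x) : 'M_2) i j = c *: (g x : 'M_2) i j.
  by rewrite linearZ mxE.
have g1 i j : (g 1 : 'M_2) i j = (i == j)%:R by rewrite rmorph1 mxE.
have g0 i j : (g 0 : 'M_2) i j = 0 by rewrite raddf0 mxE.
have gv v i j : (g (iota v) : 'M_2) i j =
    if i == 0 then if j == 0 then pi (iota v) ⊗ 1 else 1 ⊗ pi (iota v) else 0.
  by rewrite hg mxE.
(* TV is spanned by the scalars and by the products that end in a generator. *)
have ind (P : TV -> Prop) : P 0 -> (forall x y, P x -> P y -> P (x + y)) ->
    (forall c : k, P c%:A) -> (forall x v, P x -> P (x * iota v)) -> forall x, P x.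
  move=> P0 PD Pc PM x; have [s [hs ->]] := tdeg_decomposable hTV x.
  rewrite big_seq; elim/big_ind: _ => // -[n y] /hs /= {x s hs}.
  elim: n y => [|n IH] y [s]; first by move=> ->.
  by move=> [hs ->]; rewrite big_seq; elim/big_ind: _ => // p /hs/IH; exact: PM.
have h10 x : (g x : 'M_2) 1 0 = 0.
  elim/ind: x => [|x y hx hy|c|x v hx].
  - exact: g0.
  - by rewrite gD hx hy addr0.
  - by rewrite gZ g1 scaler0.
  - by rewrite gM hx mul0r gv mulr0 addr0.
have h11 n x : tdeg iota n.+1 x -> (g x : 'M_2) 1 1 = 0.
  move=> [s [hs ->]]; elim/big_ind: _ => [|a b ha hb|p _].
  - exact: g0.
  - by rewrite gD ha hb addr0.
  - by rewrite gM h10 mul0r gv mulr0 addr0.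
have h00 x : (g x : 'M_2) 0 0 = pi x ⊗ 1.
  elim/ind: x => [|x y hx hy|c|x v hx].
  + by rewrite g0 raddf0 tens0l.
  + by rewrite gD hx hy raddfD tensDl.
  + by rewrite gZ g1 linearZ /= tensZl (rmorph1 pi).
  + by rewrite gM hx gv /= gv /= mulr0 addr0 tens_mulE mul1r rmorphM.
split=> //.
- move=> x; elim/ind: x => [|x y [c hx] [d hy]|c|x v hx].
  + by exists 0; rewrite g0 scale0r.
  + by exists (c + d); rewrite gD hx hy scalerDl.
  + by exists c; rewrite gZ g1.
  + by exists 0; rewrite gM h10 mul0r gv mulr0 addr0 scale0r.
- by move=> x v; rewrite gM h00 !gv /= mulr0 addr0 tens_mulE mulr1 mul1r.
Qed.

Variables (m : nat) (R : TV -> Prop).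
Hypothesis R_deg : forall r, R r -> tensor_power iota m.+1 r.
Hypothesis pi_ker : forall x, pi x = 0 <-> ideal_generated R x.

(** A syzygy lifts to some y in TV with D y equal to it and pi y = 0. Writing y as a sum of terms a
    r b with r in [R], the derivation rule turns each into a left multiple of D r, itself a syzygy
    in A_m ⊗ A_1. *)
Lemma homogeneous_syzygies : syzygies_in_degree gr m.+1.
Proof.
move=> n x [s [hs ->]]; rewrite raddf_sum /= => mx0.
have [u pu] := choice pi_surj.
have /choice[w hw] a : exists w, gr 1%N a -> pi (iota w) = a.
  have [/tdeg_lift[y [/tdeg1[w ->] e]]|na] := pselect (gr 1%N a); first by exists w.
  by exists 0.
have [g [g00 g10 g11 g11S gS]] := fox_derivative.
pose D y := (g y : 'M_2) 0 1.
have DD y z : D (y + z) = D y + D z by rewrite /D rmorphD mxE.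
have D0 : D 0 = 0 by rewrite /D raddf0 mxE.
have Dsum (T : eqType) (l : seq T) (F : T -> TV) : D (\sum_(t <- l) F t) = \sum_(t <- l) D (F t).
  by rewrite (big_morph D (id1 := 0) (op1 := +%R)).
pose y := \sum_(p <- s) u p.1 * iota (w p.2).
have <- : D y = \sum_(p <- s) p.1 ⊗ p.2.
  rewrite Dsum big_seq [RHS]big_seq; apply: eq_bigr => p /hs[_ h2].
  by rewrite /D gS pu hw.
have /pi_ker[t [ht ->]] : pi y = 0.
  rewrite -mx0 raddf_sum big_seq [RHS]big_seq; apply: eq_bigr => p /hs[_ h2] /=.
  by rewrite rmorphM /= pu hw // mulmapE.
rewrite Dsum; apply: syzygy_span_sum => p /ht Rr.
have pr0 : pi p.1.2 = 0.
  apply/pi_ker; exists [:: (1, p.1.2, 1)]; rewrite big_seq1 /= mulr1 mul1r; split=> // q.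
  by rewrite inE => /eqP->.
have rdeg := tensor_power_tdeg (R_deg Rr).
have [c ec] := g11 p.2.
(* The term with D p.2 carries pi r = 0, the one with D p.1.1 carries eps r = 0 as r has positive
   degree; D r remains, scaled by c = eps p.2. *)
have -> : D (p.1.1 * p.1.2 * p.2) = ((c *: pi p.1.1) ⊗ 1) * D p.1.2.
  have gM a b i j : (g (a * b) : 'M_2) i j =
      (g a : 'M_2) i 0 * (g b : 'M_2) 0 j + (g a : 'M_2) i 1 * (g b : 'M_2) 1 j.
    rewrite rmorphM mxE big_ord_recl big_ord1.
    by have -> : fintype.lift ord0 ord0 = 1 :> 'I_2 by apply: val_inj.
  rewrite /D !gM !g00 pr0 tens0l mulr0 (g11S _ _ rdeg) mulr0 g10 mulr0 !addr0 mul0r add0r.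
  by rewrite ec tensZl -scalerAl -scalerAr mulr1.
have [l [hl er]] := rdeg.
have eD : D p.1.2 = \sum_(q <- l) pi q.1 ⊗ pi (iota q.2).
  by rewrite er Dsum; apply: eq_bigr => q _; rewrite /D gS.
apply: syzygy_span_mul; rewrite eD.
  by apply: tens_gr_sum => q /hl hq; apply: tens_gr_pure; [exact: tdeg_gr | exact: pi_gr].
rewrite -pr0 er !raddf_sum; apply: eq_bigr => q _ /=.
by rewrite mulmapE rmorphM.
Qed.

End Forward.

Section Backward.
Variable m : nat.
Hypotheses (hgen : generated_in_degree1 gr) (hsyz : syzygies_in_degree gr m.+1).

Definition degree1_pred : {pred A} := [pred a | `[< gr 1%N a >]].

Fact degree1_closed : GRing.submod_closed degree1_pred.
Proof.
split=> [|c x y]; first by apply/asboolP; exact: grading0 (cgr_grading h) 1%N.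
move=> /asboolP hx /asboolP hy; apply/asboolP.
by apply: (gradingD (cgr_grading h)) => //; exact: cgrZ.
Qed.

Record degree1 := Degree1 { degree1_val : A; _ : degree1_val \in degree1_pred }.

HB.instance Definition _ := [isSub of degree1 for degree1_val].
HB.instance Definition _ := [Choice of degree1 by <:].
HB.instance Definition _ :=
  GRing.SubChoice_isSubLmodule.Build k A _ degree1 degree1_closed.

Fact degree1_val_linear : linear degree1_val.
Proof. by move=> a x y; rewrite -![degree1_val _]/(\val _) linearP. Qed.

HB.instance Definition _ := GRing.isLinear.Build k degree1 A *:%R degree1_val degree1_val_linear.

Lemma degree1P (v : degree1) : gr 1%N (degree1_val v).
Proof. exact/asboolP/(valP v). Qed.

Section Kernel.
Variables (TV : algType k) (iota : {linear degree1 -> TV}) (pi : {lrmorphism TV -> A}).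
Hypothesis pi_gen : forall v, pi (iota v) = degree1_val v.

Let pi_gr v : gr 1%N (pi (iota v)).
Proof. by rewrite pi_gen; exact: degree1P. Qed.

Let lift_gr n a : gr n a -> exists x, tdeg iota n x /\ pi x = a.
Proof.
elim: n a => [|n IH] a.
  move=> /(cgr_0 h)[c ->]; exists c%:A; split; first by exists c.
  by rewrite linearZ /= rmorph1.
move=> /hgen[x [[s [hs ->]] <-]].
have /choice[u hu] b : exists y, gr n b -> tdeg iota n y /\ pi y = b.
  by have [/IH[y hy]|nb] := pselect (gr n b); [exists y | exists 0].
have /choice[w hw] b : exists w : degree1, gr 1%N b -> degree1_val w = b.
  have [hb|nb] := pselect (gr 1%N b); last by exists 0.
  have hb' : b \in degree1_pred by apply/asboolP.
  by exists (Degree1 hb').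
exists (\sum_(p <- s) u p.1 * iota (w p.2)); split.
  by apply: tdeg_sum => p /hs[h1 _] _; apply: tdegS; exact: (hu _ h1).1.
rewrite !raddf_sum big_seq [RHS]big_seq; apply: eq_bigr => p /hs[h1 h2] /=.
by rewrite rmorphM /= pi_gen mulmapE (hu _ h1).2 hw.
Qed.

Let pi_surj a : exists x, pi x = a.
Proof.
have [s [us _ e]] := gproj_sum (cgr_grading h) a.
have /choice[u hu] i : exists x, pi x = gproj (cgr_grading h) i a.
  by have [x [_ ex]] := lift_gr (gproj_gr (cgr_grading h) i a); exists x.
by exists (\sum_(i <- s) u i); rewrite raddf_sum [RHS]e; apply: eq_bigr => i _; exact: hu.
Qed.

(** The largest admissible set of relations of degree m+1. *)
Let rel (r : TV) : Prop := tensor_power iota m.+1 r /\ pi r = 0.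

Lemma ideal_generatedD (F : algType k) (R : F -> Prop) x y :
  ideal_generated R x -> ideal_generated R y -> ideal_generated R (x + y).
Proof.
move=> [s [hs ->]] [t [ht ->]]; exists (s ++ t); rewrite big_cat; split=> // p.
by rewrite mem_cat => /orP[/hs|/ht].
Qed.

Lemma ideal_generated0 (F : algType k) (R : F -> Prop) : ideal_generated R 0.
Proof. by exists [::]; rewrite big_nil. Qed.

Lemma ideal_generatedMr (F : algType k) (R : F -> Prop) x y :
  ideal_generated R x -> ideal_generated R (x * y).
Proof.
move=> [s [hs ->]]; exists [seq (p.1, p.2 * y) | p <- s]; split.
  by move=> q /mapP[p /hs hp ->].
by rewrite big_map mulr_suml; apply: eq_bigr => p _; rewrite mulrA.
Qed.

Lemma ideal_generatedMl (F : algType k) (R : F -> Prop) x r :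
  R r -> ideal_generated R (x * r).
Proof.
move=> Rr; exists [:: (x, r, 1)]; rewrite big_seq1 mulr1; split=> // p.
by rewrite inE => /eqP->.
Qed.

Lemma ideal_generated_sum (F : algType k) (R : F -> Prop) (T : eqType) (s : seq T) (G : T -> F) :
  (forall t, t \in s -> ideal_generated R (G t)) -> ideal_generated R (\sum_(t <- s) G t).
Proof.
move=> hG; rewrite big_seq; elim/big_ind: _ => [|x y|t /hG //].
- exact: ideal_generated0.
- exact: ideal_generatedD.
Qed.

(* A first factor of a syzygy can be replaced by its component of the right
   degree, and then lifted to TV. *)
Let lift_factor n (a : A) : exists x : TV,
  (forall y, tdeg iota m y -> tdeg iota n (x * y)) /\
  (forall z, tens_gr gr m z -> tmap (cproj h n) idfun ((a ⊗ 1) * z) = (pi x ⊗ 1) * z).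
Proof.
have ex : exists x : TV, (forall y, tdeg iota m y -> tdeg iota n (x * y)) /\
    (forall b, gr m b -> cproj h n (a * b) = pi x * b).
  have [mn|nm] := leqP m n; last first.
    exists 0; split=> [y _|b hb]; first by rewrite mul0r; exact: tdeg0.
    by rewrite raddf0 mul0r (cprojMr_lt h _ hb).
  have [x [xd ex]] := lift_gr (gproj_gr (cgr_grading h) (n - m)%N a).
  exists x; split=> [y hy|b hb]; first by rewrite -(subnK mn); exact: tdegM.
  by rewrite -{1}(subnK mn) (cprojMr h _ _ hb) ex.
have [x [h1 h2]] := ex; exists x; split=> // z [s [hs ->]].
rewrite !mulr_sumr raddf_sum big_seq [RHS]big_seq; apply: eq_bigr => p /hs[hp _].
by rewrite /= !tens_mulE tmapE /= !mul1r h2.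
Qed.

Let bmul : bilin (fun (x : TV) (v : degree1) => x * iota v).
Proof.
split=> [v|x] a y z; first by rewrite mulrDl scalerAl.
by rewrite linearP mulrDr scalerAr.
Qed.

Let rel_lift z : tens_gr gr m z -> mulmap z = 0 ->
  exists l : seq (TV * degree1), [/\ forall p, p \in l -> tdeg iota m p.1,
    rel (\sum_(p <- l) p.1 * iota p.2) &
    z = \sum_(p <- l) pi p.1 ⊗ degree1_val p.2].
Proof.
move=> [s [hs ->]]; rewrite raddf_sum /= => z0.
have /choice[u hu] b : exists y, gr m b -> tdeg iota m y /\ pi y = b.
  by have [/lift_gr[y hy]|nb] := pselect (gr m b); [exists y | exists 0].
have /choice[w hw] b : exists w : degree1, gr 1%N b -> degree1_val w = b.
  have [hb|nb] := pselect (gr 1%N b); last by exists 0.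
  have hb' : b \in degree1_pred by apply/asboolP.
  by exists (Degree1 hb').
have hd p : p \in [seq (u p.1, w p.2) | p <- s] -> tdeg iota m p.1.
  by move=> /mapP[q /hs[/hu[h1 _] _] ->].
exists [seq (u p.1, w p.2) | p <- s]; split=> //.
- split; first by apply: tdeg_tensor_power; exists [seq (u p.1, w p.2) | p <- s].
  rewrite -z0 raddf_sum big_map big_seq [RHS]big_seq; apply: eq_bigr => p /hs[h1 h2] /=.
  by rewrite rmorphM /= pi_gen mulmapE (hu _ h1).2 hw.
- rewrite big_map big_seq [RHS]big_seq; apply: eq_bigr => p /hs[h1 h2] /=.
  by rewrite (hu _ h1).2 hw.
Qed.

(** Induction on the degree. The image z of [x] in A_n ⊗ A_1 is a syzygy, hence a combination of
    syzygies of degree m+1, each of which lifts to a relation. Subtracting the corresponding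
    multiples of these relations from [x] leaves an element whose image in A ⊗ A vanishes; by
    [tens_kernel] its first factors can be taken in ker [pi], in degree [n], where the induction
    hypothesis applies. *)
Let kernel_homog n x : tdeg iota n x -> pi x = 0 -> ideal_generated rel x.
Proof.
elim: n x => [|n IH] x.
  move=> [c ->]; rewrite linearZ /= rmorph1 => /eqP.
  rewrite scaler_eq0 oner_eq0 orbF => /eqP->; rewrite scale0r; exact: ideal_generated0.
move=> [s [hs ->]] px0.
pose z := \sum_(p <- s) pi p.1 ⊗ degree1_val p.2.
have zn : tens_gr gr n z.
  apply: tens_gr_sum => p /hs hp; apply: tens_gr_pure; last exact: degree1P.
  exact: tdeg_gr hp.
have z0 : mulmap z = 0.
  rewrite -px0 !raddf_sum; apply: eq_bigr => p _ /=.
  by rewrite mulmapE rmorphM /= pi_gen.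
have [t [ht ez]] := hsyz zn z0.
(* Since [z] lies in A_n ⊗ A_1, cutting the first factors to degree [n] changes nothing, and it
   makes the coefficients of the syzygies homogeneous. *)
have {ez} ez : z = \sum_(p <- t) tmap (cproj h n) idfun ((p.1 ⊗ 1) * p.2).
  have -> : z = tmap (cproj h n) idfun z.
    case: zn => l [hl ->]; rewrite raddf_sum big_seq [RHS]big_seq; apply: eq_bigr.
    move=> p /hl[hp _] /=; rewrite tmapE /=.
    by have -> : cproj h n p.1 = p.1 by rewrite /cproj (gproj_homog _ _ hp) eqxx.
  by rewrite {1}ez raddf_sum.
have [X hX] := choice (lift_factor n).
have /choice[L hL] (y : A ⊗ A) : exists l : seq (TV * degree1),
    tens_gr gr m y /\ mulmap y = 0 -> [/\ forall p, p \in l -> tdeg iota m p.1,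
    rel (\sum_(p <- l) p.1 * iota p.2) & y = \sum_(p <- l) pi p.1 ⊗ degree1_val p.2].
  have [[h1 h2]|ny] := pselect (tens_gr gr m y /\ mulmap y = 0); last by exists [::].
  by have [l hl] := rel_lift h1 h2; exists l.
(* The pairs representing the subtracted multiples of relations, kept as formal tensors with last
   letter apart so that [tens_kernel] applies to [s ++ t']. *)
pose t' := flatten [seq [seq (- (X p.1 * q.1), q.2) | q <- L p.2] | p <- t].
have sum_t' (W : zmodType) (G : TV -> degree1 -> W) :
    \sum_(q <- s ++ t') G q.1 q.2 = \sum_(q <- s) G q.1 q.2 +
      \sum_(p <- t) \sum_(q <- L p.2) G (- (X p.1 * q.1)) q.2.
  rewrite big_cat /t' big_flatten big_map; congr (_ + _).
  by apply: eq_bigr => p _; rewrite big_map.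
have [||l [hl el]] := @tens_kernel k TV A degree1 A pi degree1_val val_inj (tdeg iota n)
    (@tdegD _ _ _ iota n) (@tdegZ _ _ _ iota n) (s ++ t').
- move=> p; rewrite mem_cat => /orP[/hs //|/flattenP[q /mapP[p' /ht pt ->]]].
  move=> /mapP[q' q'L ->] /=; rewrite -scaleN1r; apply: tdegZ.
  apply: (hX p'.1).1; have [hd _ _] := hL _ pt; exact: hd.
- have /= -> := sum_t' _ (fun x v => pi x ⊗ degree1_val v).
  rewrite -/z {1}ez -big_split big_seq big1 //= => p /ht pt.
  have [hd _ ep] := hL _ pt; rewrite (hX p.1).2; last exact: pt.1.
  rewrite {1}ep mulr_sumr -big_split big1 //= => q _.
  by rewrite tens_mulE mul1r raddfN /= rmorphM -scaleN1r tensZl scaleN1r subrr.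
have {el} := congr1 (linear_map (lift_linear bmul)) el.
rewrite !raddf_sum /=.
under eq_bigr => p _ do rewrite lift_tens //.
under [RHS]eq_bigr => p _ do rewrite lift_tens //.
have /= -> := sum_t' _ (fun x v => x * iota v); move=> el.
have -> : \sum_(p <- s) p.1 * iota p.2 = \sum_(p <- l) p.1 * iota p.2 +
    \sum_(p <- t) X p.1 * \sum_(q <- L p.2) q.1 * iota q.2.
  rewrite -el -addrA -big_split [X in _ = _ + X]big1 ?addr0 //= => p _.
  rewrite mulr_sumr -big_split big1 //= => q _.
  by rewrite mulNr mulrA addNr.
apply: ideal_generatedD; apply: ideal_generated_sum => p hp.
  by apply: ideal_generatedMr; have [h1 h2] := hl _ hp; exact: IH.
by have [_ hr _] := hL _ (ht _ hp); exact: ideal_generatedMl.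
Qed.

Hypothesis hTV : is_tensor_algebra iota.

Lemma presentation_homogeneous : m_homogeneous gr m.+1.
Proof.
exists degree1, TV, iota, rel, pi; split=> // [r []|x] //.
split=> [px0|[s [hs ->]]]; last first.
  by rewrite raddf_sum big_seq big1 // => p /hs[_ h0] /=; rewrite !rmorphM /= h0 mulr0 mul0r.
have [s [hs ex]] := tdeg_decomposable hTV x.
pose c n := \sum_(p <- s | p.1 == n) p.2.
have cd n : tdeg iota n (c n) by apply: tdeg_sum => p /hs hp /eqP<-.
have {}ex : x = \sum_(n <- undup (map fst s)) c n.
  rewrite ex /c (exchange_big_dep xpredT) //= big_seq [RHS]big_seq; apply: eq_bigr => p ps.
  have pu : p.1 \in undup (map fst s) by rewrite mem_undup; apply: map_f.
  rewrite big_mkcond (bigD1_seq p.1) ?undup_uniq //= eqxx big1 ?addr0 // => i ne.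
  by rewrite eq_sym (negPf ne).
rewrite ex; apply: ideal_generated_sum => n ns; apply: kernel_homog (cd n) _.
(* The components of [x] have images in distinct degrees of A, so each image vanishes. *)
move: px0; rewrite ex raddf_sum /= => px0.
apply: (@grading_direct _ _ _ (cgr_grading h) _ (fun n => pi (c n)) (undup_uniq _) _ px0 _ ns).
by move=> i; exact: (tdeg_gr pi_gr).
Qed.

End Kernel.
End Backward.

Theorem m_homogeneousP m :
  m_homogeneous gr m.+1 <-> generated_in_degree1 gr /\ syzygies_in_degree gr m.+1.
Proof.
split=> [[V [TV [iota [R [pi [hTV R_deg pi_gr pi_surj pi_ker]]]]]]|[hgen hsyz]].
  split; first exact: (homogeneous_generated hTV pi_gr pi_surj).
  exact: (homogeneous_syzygies hTV pi_gr pi_surj R_deg pi_ker).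
have [pi [pi_gen _]] := ta_is_tensor_algebra degree1_val.
exact: presentation_homogeneous hgen hsyz _ _ pi pi_gen (@ta_is_tensor_algebra _ _).
Qed.

End Homogeneous.

(** * The Galois maps of a torsor *)

Section TensorMaps.
Variable k : fieldType.

Lemma tens_ext (U V W : lmodType k) (f g : {linear (U ⊗ V)%type -> W}) :
  (forall u v, f (u ⊗ v) = g (u ⊗ v)) -> f =1 g.
Proof. exact: lift_unique (linearP f) (linearP g). Qed.

Lemma tmap_comp (U V U' V' U'' V'' : lmodType k) (f : {linear U -> U'}) (g : {linear V -> V'})
  (f' : {linear U' -> U''}) (g' : {linear V' -> V''}) x :
  tmap f' g' (tmap f g x) = tmap (f' \o f) (g' \o g) x.
Proof.
elim/tens_ind: x => [|u v x IH]; first by rewrite !raddf0.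
by rewrite !raddfD /= IH !tmapE.
Qed.

Lemma eq_tmap (U V U' V' : lmodType k) (f f' : {linear U -> U'}) (g g' : {linear V -> V'}) x :
  f =1 f' -> g =1 g' -> tmap f g x = tmap f' g' x.
Proof.
move=> ef eg; elim/tens_ind: x => [|u v x IH]; first by rewrite !raddf0.
by rewrite !raddfD /= IH !tmapE ef eg.
Qed.

Lemma tmap_id (U V : lmodType k) (x : U ⊗ V) : tmap idfun idfun x = x.
Proof.
by elim/tens_ind: x => [|u v x IH]; rewrite ?raddf0 // raddfD /= IH tmapE.
Qed.

Lemma tmap_suml (U V V' : lmodType k) (J : finType) (g : J -> {linear V -> V'})
  (g' : {linear V -> V'}) (x : U ⊗ V) :
  (forall v, \sum_j g j v = g' v) -> \sum_j tmap idfun (g j) x = tmap idfun g' x.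
Proof.
move=> e; elim/tens_ind: x => [|u v x IH].
  by rewrite raddf0 big1 // => j _; rewrite raddf0.
rewrite raddfD /= -IH tmapE -e tens_sumr -big_split.
by apply: eq_bigr => j _; rewrite raddfD /= tmapE.
Qed.

Section Pure.
Variables U V : lmodType k.

Definition tens_right (v : V) (u : U) : U ⊗ V := u ⊗ v.

Fact tens_right_linear v : linear (tens_right v).
Proof. by move=> a x y; rewrite /tens_right !tensE. Qed.

HB.instance Definition _ v :=
  GRing.isLinear.Build k U (U ⊗ V)%type *:%R (tens_right v) (tens_right_linear v).

Fact tswap_bilin : bilin (fun (u : U) (v : V) => v ⊗ u).
Proof. by split=> [v|u] a x y; rewrite !tensE. Qed.

Definition tswap : U ⊗ V -> V ⊗ U := Defs.lift (fun (u : U) (v : V) => v ⊗ u).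

HB.instance Definition _ :=
  GRing.isLinear.Build k (U ⊗ V)%type (V ⊗ U)%type *:%R tswap (lift_linear tswap_bilin).

Lemma tswapE u v : tswap (u ⊗ v) = v ⊗ u.
Proof. exact: (lift_tens _ _ tswap_bilin). Qed.

End Pure.

Lemma tswapK (U V : lmodType k) : cancel (@tswap U V) (@tswap V U).
Proof.
by elim/tens_ind => [|u v x IH]; rewrite ?raddf0 // !raddfD /= IH !tswapE.
Qed.

Lemma tunitlE (V : lmodType k) (c : k) (v : V) : tunitl ((c : k^o) ⊗ v) = c *: v.
Proof. exact: (lift_tens _ _ (@tunitl_bilin k V)). Qed.

Lemma tunitrE (V : lmodType k) (c : k) (v : V) : tunitr (v ⊗ (c : k^o)) = c *: v.
Proof. exact: (lift_tens _ _ (@tunitr_bilin k V)). Qed.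

Lemma tassoc_tmap (U V W U' V' W' : lmodType k) (f : {linear U -> U'}) (g : {linear V -> V'})
  (h : {linear W -> W'}) x :
  tassoc (tmap (tmap f g) h x) = tmap f (tmap g h) (tassoc x).
Proof.
elim/tens_ind: x => [|y w x IH]; first by rewrite !raddf0.
rewrite !raddfD /= IH tmapE; congr (_ + _).
elim/tens_ind: y => [|u v y IHy]; first by rewrite raddf0 !tens0l !raddf0.
by rewrite raddfD /= !tensDl !raddfD /= IHy !tmapE !tassocE tmapE /= tmapE.
Qed.

Lemma tassoc_tens_right (U V W : lmodType k) (w : W) (x : U ⊗ V) :
  tassoc (x ⊗ w) = tmap idfun (tens_right w) x.
Proof.
elim/tens_ind: x => [|u v x IH]; first by rewrite tens0l !raddf0.
by rewrite tensDl !raddfD /= IH tassocE tmapE.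
Qed.

Lemma tmap_tassoc_right (U V W X : lmodType k) (g : {linear (V ⊗ W)%type -> X}) (w : W) (x : U ⊗ V) :
  tmap idfun g (tassoc (x ⊗ w)) = tmap idfun (g \o tens_right w) x.
Proof. by rewrite tassoc_tens_right tmap_comp; exact: eq_tmap. Qed.

Lemma tmap_tassoc_idr (U U1 V W W' : lmodType k) (r : {linear U -> (U1 ⊗ V)%type})
    (g : {linear W -> W'}) (x : U ⊗ W) :
  tassoc (tmap r idfun (tmap idfun g x)) =
    tmap idfun (tmap idfun g) (tassoc (tmap r idfun x)).
Proof.
rewrite -tassoc_tmap !tmap_comp; congr (tassoc _).
by apply: eq_tmap => u //=; rewrite tmap_id.
Qed.

End TensorMaps.

Section FiniteBasis.
Variables (k : fieldType) (H : falgType k) (T : lmodType k).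
Variables (phi : {linear T -> H}) (phi_bij : bijective phi).

(** A basis of H carried over by [phi]. The size is a successor because 1 is nonzero in H; this
    later supplies the index [ord0]. *)
Lemma finite_basis : exists (n : nat) (b : 'I_n.+1 -> T) (tau : 'I_n.+1 -> {linear T -> k^o}),
  (forall t, t = \sum_j (tau j t : k) *: b j) /\
  (forall i j, tau i (b j) = (i == j)%:R).
Proof.
have [psi phiK psiK] := phi_bij.
have lpsi : linear psi by exact: (can2_linear phiK psiK).
have : (0 < \dim {:H})%N.
  by rewrite lt0n dimv_eq0; apply/eqP => e; have := memvf (1 : H);
    rewrite e memv0 oner_eq0.
move: (vbasisP {:H}); move: (vbasis _); case: (\dim _) => // n e he _.
have ltau j : linear (fun t => coord e j (phi t) : k^o).
  by move=> a x y; rewrite !linearP.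
exists n, (fun j => psi e`_j), (fun j => linear_map (ltau j)); split=> [t|i j] /=.
  rewrite -[LHS]phiK (coord_basis he (memvf (phi t))).
  rewrite -[psi]/(linear_map lpsi : _ -> _) raddf_sum; apply: eq_bigr => j _.
  by rewrite [LHS]linearZ_LR -(coord_basis he (memvf (phi t))).
by rewrite psiK coord_free ?(basis_free he) // eq_sym.
Qed.
End FiniteBasis.

Section Galois.
Variables (k : fieldType) (H : algType k) (hH : hopf_algebra H).
Variables (T : algType k) (rho : {lrmorphism T -> H ⊗ T}).
Hypothesis hT : left_comodule_algebra hH rho.

(* [mu] is the multiplication of T or the opposite one. *)
Definition galois_map (mu : {linear (T ⊗ T)%type -> T}) (x : T ⊗ T) : H ⊗ T :=
  tmap idfun mu (tassoc (tmap rho idfun x)).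

Fact galois_map_linear mu : linear (galois_map mu).
Proof. by move=> a x y; rewrite /galois_map !linearP. Qed.

HB.instance Definition _ mu := GRing.isLinear.Build k (T ⊗ T)%type (H ⊗ T)%type *:%R
  (galois_map mu) (galois_map_linear mu).

Lemma galois_mapE mu t t' : galois_map mu (t ⊗ t') = tmap idfun (mu \o tens_right t') (rho t).
Proof. by rewrite /galois_map tmapE /= tmap_tassoc_right. Qed.

Lemma galois_map_colinear mu x :
  tassoc (tmap (coproduct hH) idfun (galois_map mu x)) =
    tmap idfun (galois_map mu) (tassoc (tmap rho idfun x)).
Proof.
elim/tens_ind: x => [|t t' x IH]; first by rewrite !raddf0.
rewrite !raddfD /= IH; congr (_ + _).
rewrite galois_mapE tmap_tassoc_idr hT.1 tmapE /= tmap_tassoc_right tmap_comp.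
by apply: eq_tmap => // u /=; rewrite -galois_mapE.
Qed.

Lemma galois_map_counit mu x : tunitl (tmap (counit hH) idfun (galois_map mu x)) = mu x.
Proof.
elim/tens_ind: x => [|t t' x IH]; first by rewrite !raddf0.
rewrite !raddfD /= IH; congr (_ + _); rewrite galois_mapE -[in RHS](hT.2 t).
elim/tens_ind: (rho t) => [|h u w IHw]; first by rewrite !raddf0 tens0l raddf0.
rewrite !raddfD /= IHw tensDl raddfD; congr (_ + _).
by rewrite !tmapE /= !tunitlE tensZl linearZ.
Qed.

Section Inverse.
Variable mu : {linear (T ⊗ T)%type -> T}.
Hypothesis galois_bij : bijective (galois_map mu).
Variables (J : finType) (b : J -> T) (tau : J -> {linear T -> k^o}).
Hypothesis tauE : forall t, t = \sum_j (tau j t : k) *: b j.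
Hypothesis tauK : forall i j, tau i (b j) = (i == j)%:R.

(** The c_l are the coefficients of the inverse Galois map, sending y to sum_l c_l(y) ⊗ b_l. They
    inherit colinearity from the Galois map; the second formula follows from (counit ⊗ id) o galois
    = mu, the third from inverting the map on t ⊗ b_j. *)
Lemma galois_coordinates : exists c : J -> {linear (H ⊗ T)%type -> T},
  [/\ forall l y, rho (c l y) = tmap idfun (c l) (tassoc (tmap (coproduct hH) idfun y)),
      forall h t, \sum_l mu (c l (h ⊗ t) ⊗ b l) = (counit hH h : k) *: t &
      forall l j t, c l (galois_map mu (t ⊗ b j)) = if l == j then t else 0].
Proof.
have [ginv gK Kg] := galois_bij.
have lg : linear ginv by exact: (can2_linear gK Kg).
have [cc ccE] : exists cc : J -> {linear (T ⊗ T)%type -> T},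
    forall l t t', cc l (t ⊗ t') = (tau l t' : k) *: t.
  exists (fun l => @tunitr k T \o tmap idfun (tau l)) => l t t'.
  by rewrite /= tmapE tunitrE.
have ccK x : \sum_l cc l x ⊗ b l = x.
  elim/tens_ind: x => [|t t' x IH].
    by rewrite big1 // => l _; rewrite raddf0 tens0l.
  rewrite -[in RHS]IH [in RHS](tauE t') tens_sumr -big_split; apply: eq_bigr => l _.
  by rewrite raddfD /= tensDl ccE tensZl tensZr.
exists (fun l => cc l \o linear_map lg); split=> [l y|h t|l j t].
- rewrite -[LHS]/(rho (cc l (ginv y))) -[y in RHS]Kg; move: (ginv y) => x.
  rewrite galois_map_colinear tmap_comp.
  rewrite (@eq_tmap _ _ _ _ _ _ idfun _ (cc l)) //; last by move=> y' /=; rewrite gK.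
  elim/tens_ind: x => [|t t' x IH]; first by rewrite !raddf0.
  rewrite !raddfD /= -IH; congr (_ + _).
  rewrite ccE tmapE /= tmap_tassoc_right linearZ_LR /=.
  elim/tens_ind: (rho t) => [|h u w IHw]; first by rewrite !raddf0.
  by rewrite !raddfD /= IHw !tmapE /= ccE tensZr.
- transitivity (tunitl (tmap (counit hH) idfun (h ⊗ t))); last by rewrite tmapE tunitlE.
  by rewrite -[in RHS](Kg (h ⊗ t)) galois_map_counit -[in RHS](ccK (ginv (h ⊗ t))) raddf_sum.
- by rewrite -[LHS]/(cc l (ginv _)) gK ccE tauK; case: eqP => _; rewrite ?scale1r ?scale0r.
Qed.

End Inverse.

Definition opp_mulmap : {linear (T ⊗ T)%type -> T} := @mulmap k T \o @tswap k T T.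

Lemma opp_mulmapE t t' : opp_mulmap (t ⊗ t') = t' * t.
Proof. by rewrite /= tswapE mulmapE. Qed.

Hypothesis antipode_bij : bijective (antipode hH).
Hypothesis galois_bij : bijective (galois_map (@mulmap k T)).

(* h ⊗ u |-> h u_(-1) ⊗ u_0 and h ⊗ u |-> h S(u_(-1)) ⊗ u_0 *)
Let th (y : H ⊗ T) : H ⊗ T := Defs.lift (fun h u => (h ⊗ 1) * rho u) y.
Let th' (y : H ⊗ T) : H ⊗ T :=
  Defs.lift (fun h u => (h ⊗ 1) * tmap (antipode hH) idfun (rho u)) y.

Let lmul_bilin (f : {linear T -> (H ⊗ T)%type}) : bilin (fun (h : H) u => (h ⊗ 1) * f u).
Proof.
split=> [u|h] a x y; first by rewrite !tensE mulrDl -scalerAl.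
by rewrite linearP mulrDr scalerAr.
Qed.

Let th_linear : linear th. Proof. exact: (lift_linear (lmul_bilin rho)). Qed.
Let th'_linear : linear th'.
Proof. exact: (lift_linear (lmul_bilin (tmap (antipode hH) idfun \o rho))). Qed.

Let thL := linear_map th_linear.
Let thL' := linear_map th'_linear.

Let thE h u : th (h ⊗ u) = (h ⊗ 1) * rho u.
Proof. exact: (lift_tens _ _ (lmul_bilin rho)). Qed.
Let th'E h u : th' (h ⊗ u) = (h ⊗ 1) * tmap (antipode hH) idfun (rho u).
Proof. exact: (lift_tens _ _ (lmul_bilin (tmap (antipode hH) idfun \o rho))). Qed.

Let thMl h y : th ((h ⊗ 1) * y) = (h ⊗ 1) * th y.
Proof.
elim/tens_ind: y => [|g u y IH]; first by rewrite mulr0 -[th]/(thL : _ -> _) raddf0 mulr0.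
rewrite mulrDr -[th]/(thL : _ -> _) !raddfD mulrDr /= IH tens_mulE mul1r !thE mulrA.
by rewrite tens_mulE mulr1.
Qed.
Let th'Ml h y : th' ((h ⊗ 1) * y) = (h ⊗ 1) * th' y.
Proof.
elim/tens_ind: y => [|g u y IH]; first by rewrite mulr0 -[th']/(thL' : _ -> _) raddf0 mulr0.
rewrite mulrDr -[th']/(thL' : _ -> _) !raddfD mulrDr /= IH tens_mulE mul1r !th'E mulrA.
by rewrite tens_mulE mulr1.
Qed.

(** In Sweedler notation f(u_(-2)) g(u_(-1)) ⊗ u_0 = 1 ⊗ u, by coassociativity and then the counit.
    The pairs (S, id) and (id, S) give the two halves of the invertibility of [th]. *)
Let collapse (f g : {linear H -> H}) (u : T) :
  (forall h, mulmap (tmap f g (coproduct hH h)) = (counit hH h)%:A) ->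
  Defs.lift (fun h y => (f h ⊗ 1) * tmap g idfun y) (tmap idfun rho (rho u)) = 1 ⊗ u.
Proof.
move=> fg.
have bM : bilin (fun (h : H) (y : H ⊗ T) => (f h ⊗ 1) * tmap g idfun y).
  split=> [y|h] a x y'; first by rewrite linearP !tensE mulrDl -scalerAl.
  by rewrite linearP mulrDr scalerAr.
have [M [ME M_lift]] : exists M : {linear (H ⊗ (H ⊗ T))%type -> (H ⊗ T)%type},
    (forall h y, M (h ⊗ y) = (f h ⊗ 1) * tmap g idfun y) /\
    (forall x, M x = Defs.lift (fun h y => (f h ⊗ 1) * tmap g idfun y) x).
  by exists (linear_map (lift_linear bM)); split=> // h y; exact: lift_tens.
rewrite -M_lift -hT.1 -[in RHS](hT.2 u).
elim/tens_ind: (rho u) => [|h t w IH]; first by rewrite !raddf0 tens0r.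
rewrite !raddfD /= IH tensDr; congr (_ + _); rewrite !tmapE /= tunitlE tensZr -tensZl -fg.
elim/tens_ind: (coproduct hH h) => [|a c x IHx].
  by rewrite tens0l !raddf0 tens0l.
rewrite tensDl !raddfD tensDl /= IHx; congr (_ + _).
by rewrite tassocE ME !tmapE /= mulmapE tens_mulE mul1r.
Qed.

Let lift2E (f g : {linear H -> H}) (w : H ⊗ T) :
  Defs.lift (fun h y => (f h ⊗ 1) * tmap g idfun y) (tmap idfun rho w) =
  Defs.lift (fun h u => (f h ⊗ 1) * tmap g idfun (rho u)) w.
Proof.
have bM : bilin (fun (h : H) (y : H ⊗ T) => (f h ⊗ 1) * tmap g idfun y).
  split=> [y|h] a x y'; first by rewrite linearP !tensE mulrDl -scalerAl.
  by rewrite linearP mulrDr scalerAr.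
have bN : bilin (fun (h : H) (u : T) => (f h ⊗ 1) * tmap g idfun (rho u)).
  split=> [y|h] a x y'; first by rewrite linearP !tensE mulrDl -scalerAl.
  by rewrite !linearP mulrDr scalerAr.
pose N := linear_map (lift_linear bN); pose M := linear_map (lift_linear bM).
apply: (@tens_ext _ _ _ _ (M \o tmap idfun rho) N) => h u.
by rewrite /= tmapE /= !lift_tens.
Qed.

Let th_antipode u : th (tmap (antipode hH) idfun (rho u)) = 1 ⊗ u.
Proof.
rewrite -(@collapse (antipode hH) idfun u (antipodel hH)) lift2E.
have bN : bilin (fun (h : H) (u : T) => (antipode hH h ⊗ 1) * tmap idfun idfun (rho u)).
  split=> [y|h] a x y'; first by rewrite linearP !tensE mulrDl -scalerAl.
  by rewrite !linearP mulrDr scalerAr.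
pose N := linear_map (lift_linear bN).
apply: (@tens_ext _ _ _ _ (thL \o tmap (antipode hH) idfun) N) => h t.
by rewrite /= tmapE thE lift_tens //= tmap_id.
Qed.

Let th'_rho u : th' (rho u) = 1 ⊗ u.
Proof. by rewrite -(@collapse idfun (antipode hH) u (antipoder hH)) lift2E. Qed.

Let thK : cancel th th'.
Proof.
apply: (@tens_ext _ _ _ _ (thL' \o thL) idfun) => h u.
by rewrite /= thE th'Ml th'_rho tens_mulE mulr1 mul1r.
Qed.

Let th'K : cancel th' th.
Proof.
apply: (@tens_ext _ _ _ _ (thL \o thL') idfun) => h u.
by rewrite /= th'E thMl th_antipode tens_mulE mulr1 mul1r.
Qed.

(** The opposite map t ⊗ t' |-> t_(-1) ⊗ t' t_0 is a composite of bijections: swap, the Galois map,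
    S ⊗ id, [th]. Indeed [th] sends S(t'_(-1)) ⊗ t'_0 t to S(t'_(-2)) t'_(-1) t_(-1) ⊗ t'_0 t_0,
    where the antipode cancels the coaction of t'. *)
Lemma opp_galois_bij : bijective (galois_map opp_mulmap).
Proof.
have [S' SK KS] := antipode_bij.
have lS : linear S' by exact: (can2_linear SK KS).
have bS : bijective (tmap (antipode hH) (idfun : T -> T)).
  exists (tmap (linear_map lS) idfun) => x; rewrite tmap_comp -[RHS]tmap_id.
    by apply: eq_tmap => // y; exact: SK.
  by apply: eq_tmap => // y; exact: KS.
have e : galois_map opp_mulmap =1 th \o (tmap (antipode hH) idfun \o
    (galois_map (@mulmap k T) \o @tswap k T T)).
  apply: (@tens_ext _ _ _ _ (galois_map opp_mulmap) (thL \o (tmap (antipode hH) idfun \o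
    (galois_map (@mulmap k T) \o @tswap k T T)))) => t t'.
  rewrite /= tswapE galois_mapE [in RHS]galois_mapE.
  have -> : tmap idfun (opp_mulmap \o tens_right t') (rho t) = (1 ⊗ t') * rho t.
    elim/tens_ind: (rho t) => [|h u w IHw]; first by rewrite raddf0 mulr0.
    rewrite raddfD mulrDr -IHw; congr (_ + _).
    by rewrite /= tmapE /= tswapE mulmapE tens_mulE mul1r.
  rewrite -th_antipode; set w := rho t'.
  pose lhs := linear_map ((mul_bilin (H ⊗ T)%type).1 (rho t)).
  apply: (@tens_ext _ _ _ _ (lhs \o (thL \o tmap (antipode hH) idfun))
    (thL \o (tmap (antipode hH) idfun \o tmap idfun (@mulmap k T \o tens_right t)))) => h u.
  by rewrite /= !tmapE /= !thE /tens_right mulmapE rmorphM mulrA.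
apply: eq_bij (fun x => esym (e x)); apply: bij_comp; first by exists th'.
by apply: bij_comp => //; apply: bij_comp => //; exists (@tswap k T T); exact: tswapK.
Qed.

End Galois.

(** * The twisted algebra *)

Section TensSub.
Variables (k : fieldType) (A : algType k) (T : lmodType k) (gr : nat -> A -> Prop).
Hypothesis h : connected_graded gr.

Lemma tens_sub0 n : tens_sub (gr n) (0 : A ⊗ T).
Proof. by exists [::]; rewrite big_nil. Qed.

Lemma tens_subD n (x y : A ⊗ T) :
  tens_sub (gr n) x -> tens_sub (gr n) y -> tens_sub (gr n) (x + y).
Proof.
move=> [s [hs ->]] [t [ht ->]]; exists (s ++ t); rewrite big_cat; split=> // p.
by rewrite mem_cat => /orP[/hs|/ht].
Qed.

Lemma tens_sub_sum n (I : eqType) (s : seq I) (F : I -> A ⊗ T) :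
  (forall i, i \in s -> tens_sub (gr n) (F i)) -> tens_sub (gr n) (\sum_(i <- s) F i).
Proof.
move=> hF; rewrite big_seq; elim/big_ind: _ => [|x y|i /hF //].
- exact: tens_sub0.
- exact: tens_subD.
Qed.

Lemma tens_sub_pure n a (t : T) : gr n a -> tens_sub (gr n) (a ⊗ t).
Proof. by move=> ha; exists [:: (a, t)]; rewrite big_seq1; split=> // p; rewrite inE => /eqP->. Qed.

Lemma tens_subN n (x : A ⊗ T) : tens_sub (gr n) x -> tens_sub (gr n) (- x).
Proof.
move=> [s [hs ->]]; rewrite -sumrN; apply: tens_sub_sum => p /hs hp.
by rewrite -scaleN1r -tensZl; apply: tens_sub_pure; exact: cgrZ.
Qed.

Definition tproj n : {linear (A ⊗ T)%type -> (A ⊗ T)%type} := tmap (cproj h n) idfun.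

Lemma tproj_sub n x : tens_sub (gr n) (tproj n x).
Proof.
elim/tens_ind: x => [|a t x IH]; first by rewrite raddf0; exact: tens_sub0.
rewrite raddfD; apply: tens_subD => //; rewrite /tproj /= tmapE.
by apply: tens_sub_pure; exact: gproj_gr.
Qed.

Lemma tproj_homog n m x : tens_sub (gr m) x -> tproj n x = if n == m then x else 0.
Proof.
move=> [s [hs ->]]; rewrite raddf_sum /tproj.
case: eqP => [->|/eqP nm]; last rewrite big_seq big1 //; last move=> p /hs hp.
  by rewrite big_seq [RHS]big_seq; apply: eq_bigr => p /hs hp;
    rewrite /= tmapE /= /cproj (gproj_homog _ _ hp) eqxx.
by rewrite /= tmapE /= /cproj (gproj_homog _ _ hp) (negPf nm) tens0l.
Qed.

Lemma tproj_sum x : exists s : seq nat, forall r : seq nat, uniq r -> {subset s <= r} ->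
  x = \sum_(i <- r) tproj i x.
Proof.
elim/tens_ind: x => [|a t x [s hs]].
  by exists [::] => r _ _; rewrite big1 // => i _; rewrite raddf0.
have [s' hs'] := gproj_sum_sub (cgr_grading h) a.
exists (s' ++ s) => r ur sr.
under eq_bigr => i _ do rewrite raddfD /= /tproj /= tmapE /=.
rewrite big_split /= -tens_suml -hs' //; last by move=> i si; apply: sr; rewrite mem_cat si.
by rewrite -hs // => i si; apply: sr; rewrite mem_cat si orbT.
Qed.

End TensSub.

Section Twist.
Variables (k : fieldType) (H T A : algType k) (hH : hopf_algebra H).
Variables (rhoT : {lrmorphism T -> H ⊗ T}) (rhoA : {lrmorphism A -> A ⊗ H}).
Variable gr : nat -> A -> Prop.
Hypothesis gcaA : graded_comodule_algebra hH gr rhoA.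

Let h := gca_graded gcaA.
Local Notation twist := (@twist k H A T rhoA rhoT).
Local Notation twgr := (@twist_gr k H A T rhoA rhoT gr).

Lemma twistP (x : twist) :
  tassoc (tmap rhoA idfun (twist_val x)) = tmap idfun rhoT (twist_val x).
Proof. exact/eqP/(valP x). Qed.

Lemma rhoA_cproj n a : rhoA (cproj h n a) = tmap (cproj h n) idfun (rhoA a).
Proof.
have [s [us _ e]] := gproj_sum (cgr_grading h) a.
rewrite {2}e !raddf_sum /= {1}e raddf_sum /= raddf_sum; apply: eq_bigr => i _ /=.
have hi := gproj_gr (cgr_grading h) i a.
rewrite -[RHS]/(tproj _ h n _) (tproj_homog _ _ (gca_subcomodule gcaA hi)).
by rewrite /cproj (gproj_homog _ _ hi); case: eqP => // _; rewrite raddf0.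
Qed.

(** The coaction of A preserves degrees, so projecting the A-factor commutes with both sides of the
    equalizer condition. *)
Lemma tproj_twist n x : x \in twist_pred rhoA rhoT -> tproj T h n x \in twist_pred rhoA rhoT.
Proof.
rewrite !inE => /eqP hx; apply/eqP.
transitivity (tmap (cproj h n) idfun (tassoc (tmap rhoA idfun x))).
  elim/tens_ind: x {hx} => [|a t x IH]; first by rewrite !raddf0.
  rewrite !raddfD /= IH; congr (_ + _); rewrite /tproj /= !tmapE /= rhoA_cproj.
  elim/tens_ind: (rhoA a) => [|b g y IHy]; first by rewrite !raddf0 !tens0l !raddf0.
  by rewrite raddfD /= !tensDl !raddfD /= IHy tmapE /= !tassocE tmapE.
by rewrite hx /tproj /= !tmap_comp; apply: eq_tmap.
Qed.

Lemma twist_valL : linear (@twist_val k H A T rhoA rhoT).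
Proof. by move=> a x y; rewrite -![twist_val _]/(\val _) linearP. Qed.

Lemma twist_val_sum (I : Type) (s : seq I) (F : I -> twist) :
  twist_val (\sum_(i <- s) F i) = \sum_(i <- s) twist_val (F i).
Proof. exact: (raddf_sum (linear_map twist_valL)). Qed.

Lemma twist_valM (x y : twist) : twist_val (x * y) = twist_val x * twist_val y.
Proof. by rewrite -![twist_val _]/(\val _) rmorphM. Qed.

Hypothesis coinvT : forall t, rhoT t = 1 ⊗ t <-> exists c : k, t = c%:A.

(** In degree 0 an element has the form 1 ⊗ t, and the equalizer condition says that t is
    coinvariant, hence a scalar. *)
Lemma twist_connected_graded : connected_graded twgr.
Proof.
split.
- apply: grading_of_decomposable.
  + by move=> i; rewrite /twist_gr -[twist_val _]/(\val _) raddf0; exact: tens_sub0.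
  + move=> i x y hx hy; rewrite /twist_gr -[twist_val _]/(\val _) raddfB.
    by apply: tens_subD => //; apply: tens_subN.
  + move=> x; have [s hs] := tproj_sum h (twist_val x).
    exists [seq (i, Twist (tproj_twist i (valP x))) | i <- undup s]; split.
      by move=> q /mapP[i _ ->]; exact: tproj_sub.
    apply: val_inj; rewrite big_map -[RHS]/(twist_val _) twist_val_sum.
    by rewrite -[LHS]/(twist_val x) {1}(hs _ (undup_uniq s)) // => i; rewrite mem_undup.
  + move=> s c us cg e i si; apply: val_inj; rewrite raddf0.
    have := congr1 (fun x => tproj T h i (twist_val x)) e.
    rewrite twist_val_sum -[RHS]/(tproj T h i (\val (0 : twist))) !raddf0 raddf_sum /= => <-.
    rewrite (bigD1_seq i) //= (tproj_homog _ _ (cg i)) eqxx big1 ?addr0 // => j /negPf ji.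
    by rewrite (tproj_homog _ _ (cg j)) eq_sym ji.
- move=> i j x y [s [hs ex]] [t [ht ey]].
  rewrite /twist_gr twist_valM ex ey mulr_suml; apply: tens_sub_sum => p /hs hp.
  rewrite mulr_sumr; apply: tens_sub_sum => q /ht hq.
  by rewrite tens_mulE; apply: tens_sub_pure; exact: (cgr_mul h).
- move=> x; split=> [[s [hs ex]]|[c ->]]; last first.
    rewrite /twist_gr -[twist_val _]/(\val _) linearZ rmorph1 /= -tensZl.
    by apply: tens_sub_pure; exact: cgr_scalar.
  have [t et] : exists t, twist_val x = 1 ⊗ t.
    rewrite ex; elim: (s) hs => [|p l IH] hl; first by exists 0; rewrite big_nil tens0r.
    have [t et] : exists t, \sum_(p <- l) p.1 ⊗ p.2 = 1 ⊗ t.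
      by apply: IH => q ql; apply: hl; rewrite inE ql orbT.
    have /(cgr_0 h)[c ec] := hl p (mem_head _ _).
    by exists (c *: p.2 + t); rewrite big_cons et ec tensZl tensDr tensZr.
  have := twistP x; rewrite et !tmapE /= rmorph1 tassocE => e1.
  (* A linear form with value 1 at 1 cancels the factor 1 ⊗ _. *)
  have [f [lf f1]] := linear_form_ex (oner_neq0 A).
  have inj1 (W : lmodType k) (w w' : W) : (1 : A) ⊗ w = 1 ⊗ w' -> w = w'.
    move=> /(congr1 (@tunitl k W \o tmap (linear_map lf) idfun)) /=.
    by rewrite !tmapE /= !f1 !tunitlE !scale1r.
  have /coinvT[c ec] : rhoT t = 1 ⊗ t by apply: inj1; rewrite e1.
  exists c; apply: val_inj; rewrite linearZ rmorph1 -[LHS]/(twist_val x) et ec.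
  by rewrite tensZr.
Qed.

Section Coordinates.
Hypothesis hT : left_comodule_algebra hH rhoT.
Variable mu : {linear (T ⊗ T)%type -> T}.
Hypothesis galois_bij : bijective (galois_map rhoT mu).
Variables (J : finType) (b : J -> T) (tau : J -> {linear T -> k^o}).
Hypothesis tauE : forall t, t = \sum_j (tau j t : k) *: b j.
Hypothesis tauK : forall i j, tau i (b j) = (i == j)%:R.

(** L_l sends a ⊗ t to a_0 ⊗ c_l(a_1 ⊗ t). Colinearity of c_l with coassociativity of [rhoA] puts
    the value in the twist; the first formula reduces to the counit of the coaction, and in the
    second the equalizer condition replaces [rhoA] by [rhoT], so that c_l meets the Galois map. *)
Lemma twist_coordinates : exists L : J -> {linear (A ⊗ T)%type -> twist},
  [/\ forall x, \sum_l tmap idfun (mu \o tens_right (b l)) (twist_val (L l x)) = x,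
      forall l j s, L l (tmap idfun (mu \o tens_right (b j)) (twist_val s)) =
        if l == j then s else 0 &
      forall l n x, tens_sub (gr n) x -> twgr n (L l x)].
Proof.
have [c [c1 c2 c3]] := galois_coordinates hT galois_bij tauE tauK.
have [L0 L0_def] : exists L0 : J -> {linear (A ⊗ T)%type -> (A ⊗ T)%type},
    forall l x, L0 l x = tmap idfun (c l) (tassoc (tmap rhoA idfun x)).
  by exists (fun l => tmap idfun (c l) \o (@tassoc k A H T \o tmap rhoA idfun)).
have L0E l a t : L0 l (a ⊗ t) = tmap idfun (c l \o tens_right t) (rhoA a).
  by rewrite L0_def tmapE /= tmap_tassoc_right.
have L0p l x : L0 l x \in twist_pred rhoA rhoT.
  rewrite inE; apply/eqP; elim/tens_ind: x => [|a t x IH]; first by rewrite !raddf0.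
  rewrite !raddfD /= IH; congr (_ + _); rewrite L0E.
  rewrite tmap_tassoc_idr (gca_comodule gcaA).1 !tmap_comp.
  by apply: eq_tmap => // g /=; rewrite c1 tmapE /= tmap_tassoc_right.
have lL l : linear (fun x => Twist (L0p l x)).
  by move=> a x y; apply: val_inj; rewrite [RHS]linearP /= linearP.
exists (fun l => linear_map (lL l)); split=> [x|l j s|l n x].
- have [e e_def] : exists e : J -> {linear (A ⊗ T)%type -> (A ⊗ T)%type},
      forall l x, e l x = tmap idfun (mu \o tens_right (b l)) (L0 l x).
    by exists (fun l => tmap idfun (mu \o tens_right (b l)) \o L0 l).
  rewrite /=; under eq_bigr => l _ do rewrite -e_def.
  elim/tens_ind: x => [|a t x IH]; first by rewrite big1 // => l _; rewrite raddf0.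
  under eq_bigr => l _ do rewrite raddfD /=.
  rewrite big_split IH /=; congr (_ + _); rewrite -[in RHS]((gca_comodule gcaA).2 a).
  have eE l : e l (a ⊗ t) =
      tmap idfun ((mu \o tens_right (b l)) \o (c l \o tens_right t)) (rhoA a).
    by rewrite e_def L0E tmap_comp; exact: eq_tmap.
  under eq_bigr => l _ do rewrite eE.
  rewrite (@tmap_suml _ _ _ _ J _
    (@tunitl k T \o (tmap (counit hH) idfun \o tens_right t))); last first.
    by move=> g; rewrite /= tmapE tunitlE; exact: c2.
  elim/tens_ind: (rhoA a) => [|a' g u IHu]; first by rewrite !raddf0 tens0l.
  rewrite !raddfD tensDl /= IHu; congr (_ + _).
  by rewrite !tmapE /= tmapE tunitlE tunitrE tensZl tensZr.
- apply: val_inj; rewrite -[LHS]/(L0 l _) L0_def tmap_tassoc_idr twistP.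
  have -> : \val (if l == j then s else 0) = if l == j then twist_val s else 0.
    by case: eqP => // _; exact: raddf0.
  rewrite !tmap_comp; elim/tens_ind: (twist_val s) => [|a t x IH].
    by rewrite raddf0 if_same.
  rewrite raddfD /= IH tmapE /= -galois_mapE c3.
  by case: eqP => _; rewrite ?tens0r ?addr0.
- move=> [s [hs ->]]; rewrite /twist_gr /= raddf_sum; apply: tens_sub_sum => p /hs hp.
  rewrite -[X in tens_sub _ X]/(L0 l _) L0E.
  have [s' [hs' ->]] := gca_subcomodule gcaA hp.
  rewrite raddf_sum; apply: tens_sub_sum => q /hs' hq; rewrite /= tmapE.
  exact: tens_sub_pure.
Qed.

End Coordinates.
End Twist.

(* B is free with basis b as a right S-module and as a left R-module; alpha and
   gamma describe the left action of R on B_S and the right action of S on B. *)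
Lemma bifree_adjoint (k : fieldType) (R S B : algType k) (grR : nat -> R -> Prop)
    (grS : nat -> S -> Prop) (J : finType) (b : J -> B)
    (iR : {linear R -> B}) (iS : {linear S -> B})
    (rc : J -> {linear B -> S}) (lc : J -> {linear B -> R}) :
  monoid_morphism iR -> monoid_morphism iS ->
  (forall x, \sum_l b l * iS (rc l x) = x) ->
  (forall l j s, rc l (b j * iS s) = if l == j then s else 0) ->
  (forall x, \sum_l iR (lc l x) * b l = x) ->
  (forall l j r, lc l (iR r * b j) = if l == j then r else 0) ->
  (forall l j n r, grR n r -> grS n (rc l (iR r * b j))) ->
  (forall l j n s, grS n s -> grR n (lc l (b j * iS s))) ->
  exists (alpha : mx_rep grR grS J) (gamma : mx_rep grS grR J), mx_adjoint alpha gamma.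
Proof.
move=> [iR1 iRM] [iS1 iSM] rcE rcK lcE lcK rcg lcg.
have rcM l x s : rc l (x * iS s) = rc l x * s.
  rewrite -{1}(rcE x) mulr_suml raddf_sum (bigD1 l) //= -mulrA -iSM rcK eqxx.
  by rewrite big1 ?addr0 // => j /negPf jl; rewrite -mulrA -iSM rcK eq_sym jl.
have lcM l x r : lc l (iR r * x) = r * lc l x.
  rewrite -{1}(lcE x) mulr_sumr raddf_sum (bigD1 l) //= mulrA -iRM lcK eqxx.
  by rewrite big1 ?addr0 // => j /negPf jl; rewrite mulrA -iRM lcK eq_sym jl.
have la l j : linear (fun r => rc l (iR r * b j)).
  by move=> c x y; rewrite linearP mulrDl -scalerAl linearP.
have lg j l : linear (fun s => lc l (b j * iS s)).
  by move=> c x y; rewrite linearP mulrDr -scalerAr linearP.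
have [alpha alphaE] : exists a : mx_rep grR grS J, forall l j r, a l j r = rc l (iR r * b j).
  unshelve eexists (@MxRep _ _ _ _ _ _ (fun l j => linear_map (la l j)) _ _ _) => //=.
  - by move=> l j; rewrite iR1 mul1r -[b j]mulr1 -iS1 rcK; case: eqP.
  - move=> l j x y; rewrite iRM -mulrA -{1}(rcE (iR y * b j)) mulr_sumr raddf_sum.
    by apply: eq_bigr => q _; rewrite /= mulrA rcM.
have [gamma gammaE] : exists g : mx_rep grS grR J, forall j l s, g j l s = lc l (b j * iS s).
  unshelve eexists (@MxRep _ _ _ _ _ _ (fun j l => linear_map (lg j l)) _ _ _) => //=.
  - by move=> j l; rewrite iS1 mulr1 -[b j]mul1r -iR1 lcK eq_sym; case: eqP.
  - move=> j l x y; rewrite iSM mulrA -{1}(lcE (b j * iS x)) mulr_suml raddf_sum.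
    by apply: eq_bigr => q _; rewrite /= -mulrA lcM.
  - by move=> j l i x; exact: lcg.
exists alpha, gamma; split=> q j x.
  under eq_bigr => l _ do rewrite alphaE gammaE.
  by rewrite -raddf_sum /= rcE lcK.
under eq_bigr => l _ do rewrite alphaE gammaE.
by rewrite -raddf_sum /= lcE rcK.
Qed.

Lemma m_koszul_transport (k : fieldType) (R S : algType k) (grR : nat -> R -> Prop)
    (grS : nat -> S -> Prop) (J : finType) (i0 : J)
    (alpha : mx_rep grR grS J) (gamma : mx_rep grS grR J) (m : nat) :
  mx_adjoint alpha gamma -> connected_graded grR -> m_koszul grS m.+1 -> m_koszul grR m.+1.
Proof.
move=> adj hR [hS [/(m_homogeneousP hS)[hgen hsyz] hext]]; exists hR; split.
  apply/(m_homogeneousP hR); split; first exact: generated_in_degree1_transport adj i0 hgen.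
  exact: syzygies_in_degree_transport adj i0 _ hsyz.
move=> i; have [d hd] := hext i; exists d => d' /hd.
exact: ext_vanishes_transport adj _ _ i0 _ _.
Qed.

Theorem corollary4p5 (k : fieldType) (H : falgType k) (hH : hopf_algebra H)
    (antipode_bij : bijective (antipode hH))
    (T : algType k) (rhoT : {lrmorphism T -> H ⊗ T})
    (torsorT : left_torsor hH rhoT)
    (m : nat) (m_ge2 : (2 <= m)%N)
    (A : algType k) (gr : nat -> A -> Prop) (rhoA : {lrmorphism A -> A ⊗ H})
    (gcaA : graded_comodule_algebra hH gr rhoA) :
  m_koszul gr m <-> m_koszul (@twist_gr k H A T rhoA rhoT gr) m.
Proof.
have [hT [phi [phi_bij _]] coinvT galois_bij] := torsorT.
have hA := gca_graded gcaA.
have htw := twist_connected_graded gcaA coinvT.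
have [n [b [tau [tauE tauK]]]] := finite_basis phi_bij.
case: m m_ge2 => // m _.
pose iA : {linear A -> (A ⊗ T)%type} := tens_right (1 : T).
pose iW := linear_map (@twist_valL k H T A rhoT rhoA).
have iA_mon : monoid_morphism iA.
  by split=> // x y; rewrite /iA /= /tens_right tens_mulE mulr1.
have iW_mon : monoid_morphism iW by split=> // x y; exact: twist_valM.
pose B j : A ⊗ T := 1 ⊗ b j.
have [co coE] : exists co : 'I_n.+1 -> {linear (A ⊗ T)%type -> A},
    forall l a t, co l (a ⊗ t) = (tau l t : k) *: a.
  exists (fun l => @tunitr k A \o tmap idfun (tau l)) => l a t.
  by rewrite /= tmapE tunitrE.
have co_sum x : \sum_l co l x ⊗ b l = x.
  elim/tens_ind: x => [|a t x IH]; first by rewrite big1 // => l _; rewrite raddf0 tens0l.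
  rewrite -[in RHS]IH [in RHS](tauE t) tens_sumr -big_split; apply: eq_bigr => l _.
  by rewrite raddfD /= tensDl coE tensZl tensZr.
have coK l j a : co l (a ⊗ b j) = if l == j then a else 0.
  by rewrite coE tauK; case: eqP => _; rewrite ?scale1r ?scale0r.
have co_gr l i x : tens_sub (gr i) x -> gr i (co l x).
  move=> [s [hs ->]]; rewrite raddf_sum; apply: (grading_sum_closed (cgr_grading hA)) => p /hs hp _.
  by rewrite /= coE; exact: cgrZ.
have mulBr i j s : tens_sub (gr i) s -> tens_sub (gr i) (s * B j).
  move=> [l [hl ->]]; rewrite mulr_suml; apply: tens_sub_sum => p /hl hp.
  by rewrite tens_mulE mulr1; exact: tens_sub_pure.
have mulBl i j s : tens_sub (gr i) s -> tens_sub (gr i) (B j * s).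
  move=> [l [hl ->]]; rewrite mulr_sumr; apply: tens_sub_sum => p /hl hp.
  by rewrite tens_mulE mul1r; exact: tens_sub_pure.
have muE j x : tmap idfun (@mulmap k T \o tens_right (b j)) x = x * B j.
  elim/tens_ind: x => [|a t x IH]; first by rewrite raddf0 mul0r.
  by rewrite raddfD /= IH mulrDl tmapE /= mulmapE tens_mulE mulr1.
have opp_muE j x : tmap idfun (opp_mulmap T \o tens_right (b j)) x = B j * x.
  elim/tens_ind: x => [|a t x IH]; first by rewrite raddf0 mulr0.
  rewrite raddfD /= IH mulrDr; congr (_ + _).
  by rewrite tmapE tens_mulE mul1r -[in RHS]opp_mulmapE.
have iAB a j : iA a * B j = a ⊗ b j by rewrite /iA /= /tens_right tens_mulE mulr1 mul1r.
have BiA a j : B j * iA a = a ⊗ b j by rewrite /iA /= /tens_right tens_mulE mulr1 mul1r.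
have opp_bij := opp_galois_bij hT antipode_bij galois_bij.
have [L [LE LK Lg]] := twist_coordinates gcaA hT galois_bij tauE tauK.
have [L' [LE' LK' Lg']] := twist_coordinates gcaA hT opp_bij tauE tauK.
pose grW := @twist_gr k H A T rhoA rhoT gr.
split.
(* From A to the twist: R is the twist and S is A, with left coordinates [L] over the twist. *)
- have [alpha [gamma adj]] : exists (alpha : mx_rep grW gr 'I_n.+1)
      (gamma : mx_rep gr grW 'I_n.+1), mx_adjoint alpha gamma.
    apply: (@bifree_adjoint _ _ _ _ _ _ _ B iW iA co L) => //.
    + by move=> x; rewrite -[RHS]co_sum; apply: eq_bigr => l _; rewrite BiA.
    + by move=> l j s; rewrite BiA.
    + by move=> x; rewrite -[RHS]LE; apply: eq_bigr => l _; rewrite muE.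
    + by move=> l j s; rewrite -muE LK.
    + by move=> l j i s hs; apply: co_gr; exact: mulBr.
    + by move=> l j i a ha; apply: Lg; rewrite BiA; exact: tens_sub_pure.
  exact (m_koszul_transport ord0 adj htw).
(* From the twist to A: the right coordinates [L'] over the twist come from the opposite Galois
   map. *)
- have [alpha [gamma adj]] : exists (alpha : mx_rep gr grW 'I_n.+1)
      (gamma : mx_rep grW gr 'I_n.+1), mx_adjoint alpha gamma.
    apply: (@bifree_adjoint _ _ _ _ _ _ _ B iA iW L' co) => //.
    + by move=> x; rewrite -[RHS]LE'; apply: eq_bigr => l _; rewrite opp_muE.
    + by move=> l j s; rewrite -opp_muE LK'.
    + by move=> x; rewrite -[RHS]co_sum; apply: eq_bigr => l _; rewrite iAB.
    + by move=> l j s; rewrite iAB.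
    + by move=> l j i a ha; apply: Lg'; rewrite iAB; exact: tens_sub_pure.
    + by move=> l j i s hs; apply: co_gr; exact: mulBl.
  exact (m_koszul_transport ord0 adj hA).
Qed.
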